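(* Let $\nu,\mu$ be normal weights on $\mathbb D$, let $\alpha>-1$ and let $\omega$ be a weight function such that $\{\nu,\omega\}$ is a normal pair with $\nu(r)\omega(r)=(1-r^2)^\alpha$ for $0\le r<1$. Let $g\in H(\mathbb D)$ and let $\phi$ be an analytic self-map of $\mathbb D$ such that $S_g^\phi:\mathcal H^\infty_\nu\to\mathcal H^\infty_\mu$ is bounded. Then the following statements are equivalent. (a) $S_g^\phi:\mathcal H^0_\nu\to\mathcal H^0_\mu$ is nuclear. (b) $S_g^\phi:\mathcal H^\infty_\nu\to\mathcal H^\infty_\mu$ is nuclear. (c) $g$, $\nu$, $\mu$ and $\phi$ satisfy the following condition: $$N_\alpha=\int_{\mathbb D}\left[\sup_{z\in\mathbb D}\frac{(1-|z|^2)\mu(z)|g(z)|}{|1-\bar\zeta\phi(z)|^{\alpha+3}}\right]\frac{(1-|\zeta|^2)^\alpha}{\nu(\zeta)}\,dA(\zeta)<\infty.$$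
   Context: $\mathbb D$ is the open unit disk in $\mathbb C$, $H(\mathbb D)$ the class of analytic functions on $\mathbb D$, and $dA$ normalized Lebesgue measure on $\mathbb D$. For $g\in H(\mathbb D)$ and an analytic map $\phi:\mathbb D\to\mathbb D$, $(S_g^\phi f)(z)=\int_0^z f'(\phi(\zeta))g(\zeta)\,d\zeta$ for $f\in H(\mathbb D)$, $z\in\mathbb D$. A radial weight is a non-negative continuous function $\nu$ on $\mathbb D$ with $\nu(z)=\nu(|z|)$, non-increasing in $|z|$. It is normal if: (I) there is $\beta>0$ such that $r\mapsto\nu(r)/(1-r^2)^\beta$ is almost increasing on $[0,1)$, or equivalently $\inf_n \nu(1-2^{-(n+1)})/\nu(1-2^{-n})>0$; and (II) there is $\gamma>0$ such that $r\mapsto\nu(r)/(1-r^2)^\gamma$ is almost decreasing on $[0,1)$, or equivalently there is $k\in\mathbb N$ with $\limsup_n \nu(1-2^{-(n+k)})/\nu(1-2^{-n})<1$. (A function $h$ is almost increasing if there is $C>0$ with $h(r)\le C h(s)$ for all $r\le s$; almost decreasing if there is $C>0$ with $h(s)\le C h(r)$ for all $r\le s$.) $\{\nu,\omega\}$ is a normal pair if $\nu$ is a normal weight, $\omega$ is radial, positive and continuous with $\int_0^1\omega(r)\,dr<\infty$, and $\nu(r)\omega(r)=(1-r^2)^\alpha$, $0\le r<1$, for some $\alpha>\beta-1$, where $\beta>0$ is an exponent as in (I) for $\nu$. For a normal weight $\nu$ (and likewise $\mu$), $\mathcal H^\infty_\nu=\{f\in H(\mathbb D):\|f\|_{\mathcal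 H^\infty_\nu}=\sup_{z\in\mathbb D}\nu(z)|f(z)|<\infty\}$ and $\mathcal H^0_\nu=\{f\in H(\mathbb D):\lim_{|z|\to1^-}\nu(z)|f(z)|=0\}$, the latter with the norm of $\mathcal H^\infty_\nu$. A linear operator $T:X\to Y$ between Banach spaces is nuclear if there are sequences $(x_k')\subset X'$ (the dual of $X$) and $(y_k)\subset Y$ with $\sum_k\|x_k'\|\|y_k\|<\infty$ and $Tx=\sum_k x_k'(x)y_k$ for all $x\in X$.
   Formalization: The equivalence of (a) with (b) and (c) is stated only when S_g^φ maps H^0_ν into H^0_μ, which boundedness on H^∞ does not imply (e.g. ν=μ=1-|z|², φ=0, g=(1-z)^{-2}); (b)⇔(c) is unconditional. *)

(* Defs.v *)
From HB Require Import structures.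
From mathcomp Require Import all_boot all_order all_algebra.
From mathcomp Require Import all_classical all_reals all_analysis.
From mathcomp Require Import complex.

Set Implicit Arguments.
Unset Strict Implicit.
Unset Printing Implicit Defensive.

Import Order.TTheory GRing.Theory Num.Theory numFieldNormedType.Exports.
Import Normc.

Local Open Scope classical_set_scope.
Local Open Scope ring_scope.
Local Open Scope complex_scope.

(* The library gives [R[i]] no topology; use the one coming from its norm. *)
HB.instance Definition _ (R : realType) := NormedModule.copy R[i] R[i]^o.

Section AnalyticFunctions.
Variable R : realType.
Local Notation C := (R[i]).

Definition disk : set C := [set z | normc z < 1].

Definition analytic (f : C -> C) : Prop := forall z, disk z -> derivable f z 1.

(* [H(D)] as a space of total functions: the value outside the disk is fixed to
   be 0, so that Leibniz equality of members is equality on the disk. *)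
Definition holo : set (C -> C) :=
  [set f | analytic f /\ forall z, ~ disk z -> f z = 0].

(* Integral of [h] along the segment from 0 to [z]. *)
Definition segment_integral (h : C -> C) (z : C) : C :=
  (\int[lebesgue_measure]_(t in `[0, 1]) complex.Re (z * h (t%:C * z)))
  +i* (\int[lebesgue_measure]_(t in `[0, 1]) complex.Im (z * h (t%:C * z))).

Definition Sop (g phi f : C -> C) : C -> C :=
  segment_integral (fun zeta => derive1 f (phi zeta) * g zeta).

(* Integral over the disk for the area measure normalized to total mass 1. *)
Definition area_integral (F : C -> \bar R) : \bar R :=
  ((pi^-1)%:E * \int[lebesgue_measure \x lebesgue_measure]_(
      p in [set p : R * R | disk (p.1 +i* p.2)]) F (p.1 +i* p.2))%E.

End AnalyticFunctions.

Section Weights.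
Variable R : realType.
Local Notation C := (R[i]).

(* Weights are functions on [R[i]] of which only the restriction to the disk is
   meaningful; since the disk is open, continuity on it is continuity at each
   of its points. *)
Definition radial_weight (nu : C -> R) : Prop :=
  [/\ forall z, disk z -> 0 <= nu z,
      forall z, disk z -> {for z, continuous nu},
      forall z, disk z -> nu z = nu (normc z)%:C
    & forall z w, disk z -> disk w -> normc z <= normc w -> nu w <= nu z].

Definition almost_increasing (h : R -> R) : Prop :=
  exists2 c, 0 < c & forall r s, 0 <= r -> r <= s -> s < 1 -> h r <= c * h s.

Definition almost_decreasing (h : R -> R) : Prop :=
  exists2 c, 0 < c & forall r s, 0 <= r -> r <= s -> s < 1 -> h s <= c * h r.

Definition normalI (nu : C -> R) (beta : R) : Prop :=
  0 < beta /\ almost_increasing (fun r => nu r%:C / (1 - r ^+ 2) `^ beta).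

Definition normalII (nu : C -> R) (gamma : R) : Prop :=
  0 < gamma /\ almost_decreasing (fun r => nu r%:C / (1 - r ^+ 2) `^ gamma).

(* The last clause only excludes the zero weight: it satisfies both growth
   conditions in the form above, but not the equivalent form of the first one
   by the quotients nu(1 - 2^-(n+1)) / nu(1 - 2^-n), and it does not define a
   norm.  Together with the first growth condition it makes [nu] positive on
   the disk ([normal_gt0]). *)
Definition normal (nu : C -> R) : Prop :=
  [/\ radial_weight nu, exists beta, normalI nu beta,
      exists gamma, normalII nu gamma & exists2 z, disk z & nu z != 0].

Record normalWeight := NormalWeight {
  weight_fun :> C -> R;
  weight_normal : normal weight_fun
}.

Definition normal_pair (nu omega : C -> R) (alpha : R) : Prop :=
  normal nu /\
  [/\ forall z, disk z -> omega z = omega (normc z)%:C,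
      forall z, disk z -> 0 < omega z,
      forall z, disk z -> {for z, continuous omega},
      (\int[lebesgue_measure]_(r in `[0%R, 1%R[) (omega r%:C)%:E < +oo)%E
    & (forall r, 0 <= r -> r < 1 -> nu r%:C * omega r%:C = (1 - r ^+ 2) `^ alpha)
      /\ exists2 beta, normalI nu beta & beta - 1 < alpha].

Lemma normcR (r : R) : 0 <= r -> normc r%:C = r.
Proof. by move=> r0; rewrite /normc /= expr0n addr0 sqrtr_sqr ger0_norm. Qed.

Lemma normc_ge0 (z : C) : 0 <= normc z.
Proof. by case: z => a b /=; rewrite sqrtr_ge0. Qed.

Lemma normal_gt0 (nu : C -> R) z : normal nu -> disk z -> 0 < nu z.
Proof.
move=> [[nu0 _ nur nudec] [beta [_ [c c0 incr]]] _ [w dw nw]] dz.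
rewrite lt_neqAle eq_sym nu0// andbT; apply/negP => /eqP nz.
suff : nu w <= 0 by apply/negP; rewrite -ltNge lt_neqAle eq_sym nw nu0.
have [zw|/ltW wz] := leP (normc z) (normc w); first by rewrite -nz nudec.
have := incr _ _ (normc_ge0 w) wz dz.
rewrite -!nur// nz mul0r mulr0 pmulr_lle0// invr_gt0 powR_gt0// subr_gt0.
by rewrite expr_lt1// normc_ge0.
Qed.

End Weights.

Section WeightedSup.
Variable R : realType.
Local Notation C := (R[i]).
Implicit Types (f h : C -> C) (nu : C -> R).

Definition weighted_values nu f : set R :=
  [set nu z * normc (f z) | z in @disk R].

Definition wnorm nu f : R := sup (weighted_values nu f).

(* lim_{|z| -> 1^-} nu(z)|f(z)| = 0 *)
Definition vanishing nu f : Prop :=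
  forall e : R, 0 < e ->
  \forall r \near 1^'-, forall z, normc z = r -> nu z * normc (f z) < e.

Definition Hinf_set nu : set (C -> C) :=
  [set f | holo f /\ has_ubound (weighted_values nu f)].

Definition H0_set nu : set (C -> C) := [set f | holo f /\ vanishing nu f].

Lemma lt_normcR (z : C) (e : R) : (`|z| < e%:C) = (normc z < e).
Proof. by rewrite -ltcR. Qed.

Lemma lt0cE (e : C) : 0 < e -> exists2 d : R, 0 < d & e = d%:C.
Proof.
case: e => a b; rewrite ltcE /= => /andP[/eqP b0 a0].
by exists a => //; rewrite b0.
Qed.

Lemma le_normcB (z w : C) : `|normc z - normc w| <= normc (z - w).
Proof.
have h (x y : C) : normc x - normc y <= normc (x - y).
  by rewrite lerBlDr -{1}(subrK y x) le_normcD.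
rewrite ler_norml h andbT lerNl opprB.
by rewrite -(normcN (z - w)) opprB h.
Qed.

Lemma normc_continuous : continuous (@normc R : C -> R).
Proof.
move=> z; have Fz : Filter (nbhs z) by exact: nbhs_filter.
apply: (iffRL (@cvgrPdist_lt R R C (nbhs z) Fz _ _)) => e e0.
have e0' : 0 < e%:C by rewrite ltcR.
apply: (@filterS _ (nbhs z) _ _ _ _ (nbhsx_ballx z _ e0')) => w.
rewrite -ball_normE /= => zw.
by apply: le_lt_trans (le_normcB _ _) _; rewrite -lt_normcR.
Qed.

Lemma complex_continuous : continuous (fun p : R * R => p.1 +i* p.2 : C).
Proof.
move=> -[a b]; apply/cvgrPdist_lt => e /lt0cE[d d0 ->].
have d20 : 0 < d / 2 by rewrite divr_gt0.
exists (ball a (d / 2), ball b (d / 2)).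
  by split; exact: nbhsx_ballx.
move=> -[x y] /= [ax yb]; rewrite lt_normcR.
have -> : (a +i* b) - (x +i* y) = (a - x)%:C + 'i%C * (b - y)%:C :> C.
  by simpc.
apply: le_lt_trans (le_normcD _ _) _; rewrite normcM.
rewrite /= !expr0n /= !addr0 add0r expr1n sqrtr1 mul1r !sqrtr_sqr.
by rewrite [ltRHS]splitr ltrD.
Qed.

Lemma analytic_continuous f z : analytic f -> disk z -> {for z, continuous f}.
Proof.
move=> af dz; apply: differentiable_continuous; apply/derivable1_diffP.
exact: af.
Qed.

Lemma closed_disk_bounded nu f (r : R) : radial_weight nu -> analytic f ->
  r < 1 -> exists M, forall z, normc z <= r -> nu z * normc (f z) <= M.
Proof.
move=> [_ nuc _ _] af r1.
pose K := [set p : R * R | normc (p.1 +i* p.2) <= r].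
pose F (p : R * R) : R := nu (p.1 +i* p.2) * normc (f (p.1 +i* p.2)).
have cK : compact K.
  apply: (@subclosed_compact _ _ (`[- r, r] `*` `[- r, r])).
  - apply: (@closed_comp _ _ (fun p : R * R => normc (p.1 +i* p.2)) [set x | x <= r]).
    + move=> p _; apply: continuous_comp; first exact: complex_continuous.
      exact: normc_continuous.
    + exact: closed_le.
  - by apply: compact_setX; exact: segment_compact.
  - move=> [a b] Kab.
    have le_abs (x y : R) : `|x| <= Num.sqrt (x ^+ 2 + y ^+ 2).
      by rewrite -sqrtr_sqr ler_wsqrtr// lerDl sqr_ge0.
    split; rewrite /= in_itv /= -ler_norml; apply: le_trans Kab => /=.
      exact: le_abs.
    by rewrite addrC; exact: le_abs.
have cF : {within K, continuous F}.
  apply: continuous_in_subspaceT => p; rewrite inE => Kp.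
  have dp : disk (p.1 +i* p.2) by exact: le_lt_trans Kp r1.
  apply: (@continuousM _ _ (fun p : R * R => nu (p.1 +i* p.2))
    (fun p : R * R => normc (f (p.1 +i* p.2)))).
    apply: (@continuous_comp _ _ _ (fun p : R * R => p.1 +i* p.2 : C) nu).
      exact: complex_continuous.
    exact: nuc.
  apply: (@continuous_comp _ _ _ (fun p : R * R => p.1 +i* p.2 : C)
    (fun z => normc (f z))); first exact: complex_continuous.
  apply: continuous_comp; first exact: analytic_continuous.
  exact: normc_continuous.
have [M [_ FM]] := compact_bounded (continuous_compact cF cK).
exists (M + 1) => -[a b] zr.
apply: le_trans (ler_norm _) _; apply: (FM (M + 1)); first by rewrite ltrDl.
by exists (a, b).
Qed.

Lemma H0_sub_Hinf nu : radial_weight nu -> H0_set nu `<=` Hinf_set nu.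
Proof.
move=> nuw f [hf vf]; split=> //.
have [d /= d0 hd] := vf 1 ltr01.
have [r [r1 hr]] : exists r, r < 1 /\ forall z, disk z -> r < normc z ->
    nu z * normc (f z) < 1.
  exists (1 - d); split; first by rewrite ltrBlDr ltrDl.
  move=> z dz rz; apply: (hd (normc z)) => //.
  by rewrite /= ger0_norm ?subr_ge0 1?ltW// ltrBlDr addrC -ltrBlDr.
have [M hM] := closed_disk_bounded nuw hf.1 r1.
exists (Num.max M 1) => _ [z dz <-]; rewrite le_max.
by have [/hM->//|/(hr _ dz)/ltW ->] := leP (normc z) r; rewrite orbT.
Qed.

Lemma holo_submod (a : C) f h : holo f -> holo h -> holo (a *: f + h).
Proof.
move=> [af f0] [ah h0]; split=> z dz.
  by apply: derivableD; [apply: derivableZ; exact: af|exact: ah].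
have -> : (a *: f + h) z = a * f z + h z by [].
by rewrite f0// h0// mulr0 addr0.
Qed.

Lemma holo0 : holo (0 : C -> C).
Proof. by split=> // z dz; exact: derivable_cst. Qed.

Lemma weighted_submod nu (a : C) f h (z : C) : 0 <= nu z ->
  nu z * normc ((a *: f + h) z) <=
  normc a * (nu z * normc (f z)) + nu z * normc (h z).
Proof.
move=> nuz; rewrite mulrCA -mulrDr ler_wpM2l//.
by rewrite -normcM le_normcD.
Qed.

Lemma Hinf_submod nu : radial_weight nu -> submod_closed (mem (Hinf_set nu)).
Proof.
move=> [nu0 _ _ _]; split.
  apply/mem_set; split; first exact: holo0.
  by exists 0 => _ [z _ <-]; rewrite normc0 mulr0.
move=> a f h /set_mem[hf [M hM]] /set_mem[hh [N hN]]; apply/mem_set.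
split; first exact: holo_submod.
exists (normc a * M + N) => _ [z dz <-].
apply: le_trans (weighted_submod _ _ _ (nu0 _ dz)) _.
rewrite lerD//; last by apply: hN; exists z.
by rewrite ler_wpM2l ?normc_ge0//; apply: hM; exists z.
Qed.

Lemma H0_submod nu : radial_weight nu -> submod_closed (mem (H0_set nu)).
Proof.
move=> [nu0 _ _ _]; split.
  apply/mem_set; split; first exact: holo0.
  by move=> e e0; near=> r => z _; rewrite normc0 mulr0.
move=> a f h /set_mem[hf vf] /set_mem[hh vh]; apply/mem_set.
split; first exact: holo_submod.
move=> e e0.
have a1 : 0 < normc a + 1 by rewrite ltr_wpDl ?normc_ge0.
have e1 : 0 < e / 2 / (normc a + 1) by rewrite !divr_gt0.
have e2 : 0 < e / 2 by rewrite divr_gt0.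
near=> r => z zr.
have dz : disk z by rewrite /disk /= zr; near: r; exact: nbhs_left_lt.
apply: le_lt_trans (weighted_submod _ _ _ (nu0 _ dz)) _.
rewrite [ltRHS]splitr ler_ltD//; last first.
  by move: (z) zr {dz}; near: r; exact: vh.
apply: (@le_trans _ _ ((normc a + 1) * (nu z * normc (f z)))).
  by rewrite ler_wpM2r ?lerDl// mulr_ge0 ?normc_ge0 ?nu0.
rewrite mulrC -ler_pdivlMr// ltW//.
by move: (z) zr {dz}; near: r; exact: vf.
Unshelve. all: by end_near. Qed.

Lemma disk0 : @disk R 0.
Proof. by rewrite /disk /= expr0n addr0 sqrtr0 ltr01. Qed.

Lemma wnorm_ub nu f z : Hinf_set nu f -> disk z ->
  nu z * normc (f z) <= wnorm nu f.
Proof. by move=> [_ bf] dz; apply: ub_le_sup => //; exists z. Qed.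

Lemma wnorm_le nu f M : (forall z, disk z -> nu z * normc (f z) <= M) ->
  wnorm nu f <= M.
Proof.
move=> h; apply: ge_sup; first by exists (nu 0 * normc (f 0)), 0 => //; exact: disk0.
by move=> _ [z dz <-]; exact: h.
Qed.

Lemma wnormD nu f h : radial_weight nu -> Hinf_set nu f -> Hinf_set nu h ->
  wnorm nu (f + h) <= wnorm nu f + wnorm nu h.
Proof.
move=> [nu0 _ _ _] hf hh; apply: wnorm_le => z dz.
apply: (@le_trans _ _ (nu z * normc (f z) + nu z * normc (h z))).
  by rewrite -mulrDr ler_wpM2l ?nu0// le_normcD.
by rewrite lerD// wnorm_ub.
Qed.

Lemma wnormZ nu (a : C) f : Hinf_set nu f -> Hinf_set nu (a *: f) ->
  wnorm nu (a *: f) = normc a * wnorm nu f.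
Proof.
move=> hf haf; apply/eqP; rewrite eq_le; apply/andP; split.
  apply: wnorm_le => z dz.
  have -> : (a *: f) z = a * f z by [].
  by rewrite normcM mulrCA ler_wpM2l ?normc_ge0// wnorm_ub.
have [a0|a0] := eqVneq a 0.
  rewrite {1}a0 normc0 mul0r; have := wnorm_ub haf disk0.
  have -> : (a *: f) 0 = 0 by rewrite a0 scale0r.
  by rewrite normc0 mulr0.
have na0 : 0 < normc a.
  by rewrite lt_neqAle normc_ge0 andbT eq_sym; apply: contraNneq a0 => /eq0_normc->.
rewrite mulrC -ler_pdivlMr//; apply: wnorm_le => z dz.
rewrite ler_pdivlMr// -mulrA -normcM.
have -> : f z * a = (a *: f) z by rewrite mulrC.
exact: wnorm_ub.
Qed.

Lemma wnorm0_eq0 nu f : normal nu -> Hinf_set nu f -> wnorm nu f = 0 -> f = 0.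
Proof.
move=> nuN hf f0; apply/funext => z.
have [dz|/hf.1.2//] := pselect (disk z).
have := wnorm_ub hf dz; rewrite f0 pmulr_rle0 ?normal_gt0// => h.
by apply/eq0_normc/eqP; rewrite eq_le h normc_ge0.
Qed.

End WeightedSup.

Section Spaces.
Variables (R : realType) (nu : normalWeight R).
Local Notation C := (R[i]).

Let nu_radial : radial_weight nu.
Proof. by case: (weight_normal nu). Qed.

Definition Hinf_pred : {pred C -> C} := mem (Hinf_set nu).
Definition H0_pred : {pred C -> C} := mem (H0_set nu).

HB.instance Definition _ :=
  GRing.isSubmodClosed.Build C (C -> C) Hinf_pred (Hinf_submod nu_radial).
HB.instance Definition _ :=
  GRing.isSubmodClosed.Build C (C -> C) H0_pred (H0_submod nu_radial).

Record Hinf := MkHinf { Hinf_fun :> C -> C; Hinf_funP : Hinf_fun \in Hinf_pred }.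

HB.instance Definition _ := [isSub for Hinf_fun].
HB.instance Definition _ := [Choice of Hinf by <:].
HB.instance Definition _ := [SubChoice_isSubLmodule of Hinf by <:].

Record H0 := MkH0 { H0_fun :> C -> C; H0_funP : H0_fun \in H0_pred }.

HB.instance Definition _ := [isSub for H0_fun].
HB.instance Definition _ := [Choice of H0 by <:].
HB.instance Definition _ := [SubChoice_isSubLmodule of H0 by <:].

Lemma HinfP (f : Hinf) : Hinf_set nu f.
Proof. by have /set_mem := Hinf_funP f. Qed.

Lemma H0P (f : H0) : Hinf_set nu f.
Proof. by have /set_mem/H0_sub_Hinf := H0_funP f; apply. Qed.

Definition Hinf_norm (f : Hinf) : C := (wnorm nu f)%:C.
Definition H0_norm (f : H0) : C := (wnorm nu f)%:C.

Lemma Hinf_normD f h : Hinf_norm (f + h) <= Hinf_norm f + Hinf_norm h.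
Proof.
rewrite /Hinf_norm -rmorphD /= lecR.
by apply: wnormD => //; exact: HinfP.
Qed.

Lemma Hinf_normZ (a : C) f : Hinf_norm (a *: f) = `|a| * Hinf_norm f.
Proof.
rewrite /Hinf_norm -[`|a|]/((normc a)%:C) -rmorphM /=; congr (_%:C).
by apply: wnormZ; [exact: HinfP|exact: (HinfP (a *: f))].
Qed.

Lemma Hinf_norm0_eq0 f : Hinf_norm f = 0 -> f = 0.
Proof.
move=> [f0]; apply/val_inj.
by apply: (wnorm0_eq0 (weight_normal nu)) => //; exact: HinfP.
Qed.

HB.instance Definition _ :=
  Lmodule_isNormed.Build C Hinf Hinf_normD Hinf_normZ Hinf_norm0_eq0.

Lemma H0_normD f h : H0_norm (f + h) <= H0_norm f + H0_norm h.
Proof.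
rewrite /H0_norm -rmorphD /= lecR.
by apply: wnormD => //; exact: H0P.
Qed.

Lemma H0_normZ (a : C) f : H0_norm (a *: f) = `|a| * H0_norm f.
Proof.
rewrite /H0_norm -[`|a|]/((normc a)%:C) -rmorphM /=; congr (_%:C).
by apply: wnormZ; [exact: H0P|exact: (H0P (a *: f))].
Qed.

Lemma H0_norm0_eq0 f : H0_norm f = 0 -> f = 0.
Proof.
move=> [f0]; apply/val_inj.
by apply: (wnorm0_eq0 (weight_normal nu)) => //; exact: H0P.
Qed.

HB.instance Definition _ :=
  Lmodule_isNormed.Build C H0 H0_normD H0_normZ H0_norm0_eq0.

End Spaces.

Section NuclearOperators.
Variable R : realType.
Local Notation C := (R[i]).
Implicit Types X Y : normedModType C.

(* Norms in a [normedModType R[i]] are nonnegative reals seen in [R[i]]. *)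
Definition rnorm X (x : X) : R := complex.Re `|x|.

Definition bounded_operator X Y (T : X -> Y) : Prop :=
  exists M : R, forall x, rnorm (T x) <= M * rnorm x.

(* Operator norm of a continuous linear functional. *)
Definition dual_norm X (x' : X -> C) : R :=
  sup [set normc (x' x) | x in [set x | rnorm x <= 1]].

Definition nuclear X Y (T : X -> Y) : Prop :=
  exists (x' : nat -> {scalar X}) (y : nat -> Y),
    [/\ forall k, continuous (x' k),
        (\sum_(0 <= k <oo) (dual_norm (x' k) * rnorm (y k))%:E < +oo)%E
      & forall x, series (fun k => x' k x *: y k) @ \oo --> T x].

End NuclearOperators.

(* N_alpha; the supremum is taken in the extended reals. *)
Definition Nalpha (R : realType) (nu mu : R[i] -> R) (alpha : R)
    (g phi : R[i] -> R[i]) : \bar R :=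
  area_integral (fun zeta =>
    ereal_sup [set ((1 - normc z ^+ 2) * mu z * normc (g z) /
                    normc (1 - zeta^* * phi z) `^ (alpha + 3))%:E
              | z in @disk R]
    * ((1 - normc zeta ^+ 2) `^ alpha / nu zeta)%:E)%E.

(* Main.v *)
(** Put A(z) = (1 - |z|^2) mu(z) |g(z)| ([gauge]).  Since (S f)' = g f'(phi), the
    norm of S f is comparable to sup_z A(z) |f'(phi(z))|.  Everything is compared
    on a lattice of nodes, 2^j of them on the j-th circle, at distance about 2^-j
    from the unit circle ([node], [dy]).

    If S is nuclear it is absolutely summing.  Applied to normalized powers of the
    Cauchy kernel at the nodes this bounds A(z) by numbers b_jk whenever phi(z) is
    near the node (j, k), with sum_jk b_jk / (2^-j nu_j) finite; a Forelli-Rudin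
    sum over the lattice then turns this into the finiteness of N_alpha.

    If N_alpha is finite, integrating over small disjoint squares around the nodes
    gives A(z) <= b_jk |1 - conj(node j k) phi(z)|^(alpha+3) with
    sum_jk 2^(-j (alpha+2)) b_jk / nu_j finite.  The reproducing formula which
    writes f as a telescoping sum over the dilations f(q_j z) of circular means,
    discretized at roots of unity and telescoped once more in the number of these
    roots, expands f into rank one terms, and the estimates of the kernels make
    the expansion of S absolutely summable.  Both halves only use that the two
    spaces contain the bounded analytic functions, hence apply to H^infty_nu and
    to H^0_nu alike. *)
Require Import Defs.
From HB Require Import structures.
From mathcomp Require Import all_boot all_order all_algebra.
From mathcomp Require Import all_classical all_reals all_analysis.
From mathcomp Require Import measurable_realfun complex ring lra.
Import Order.TTheory GRing.Theory Num.Theory numFieldNormedType.Exports.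
Import Normc.

Set Implicit Arguments.
Unset Strict Implicit.
Unset Printing Implicit Defensive.

Local Open Scope classical_set_scope.
Local Open Scope ring_scope.
Local Open Scope complex_scope.

(** * Complex modulus and derivatives *)

(** Contour integrals appear only as limits of means over the roots of unity of order [2 ^ n],
    because there the mean of the Cauchy kernel is exactly [1 / (1 - x ^+ (2 ^ n))]; Cauchy's
    formula, the Poisson means and the sums over one circle of nodes all rest on this identity. In
    the second half the obstacle is that the Cauchy kernel is too large to be summed over the
    layers. The telescoping therefore runs through products of [M] factors [1 - q^i D], with [D] the
    dilation by [q]: such a product turns the Cauchy kernel into about [(1 - q)^M] times a kernel of
    order [M + 1]. Taking [M] at least [be + 1] makes the layers summable for each [f] in the
    weighted space; taking it at least [al + 1] lets the exponent [al + 3] in the bound of A pay for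
    the kernel. The mean on a layer is only a limit, so the rank one terms come from its increments
    when the number of roots doubles. Each increment carries a difference of [f] or of the kernel at
    neighbouring roots, which gains the factor [2^-(n-j)] that makes the double sum converge. *)

Section ComplexModulus.
Variable R : realType.
Local Notation C := (R[i]).
Implicit Types x y z w : C.

Lemma normcD x y : normc (x + y) <= normc x + normc y.
Proof. exact: le_normcD. Qed.

Lemma normcNE x : normc (- x) = normc x.
Proof. exact: normcN. Qed.

Lemma normc_distC x y : normc (x - y) = normc (y - x).
Proof. by rewrite -normcNE opprB. Qed.

Lemma normcB x y : normc (x - y) <= normc x + normc y.
Proof. by rewrite -(normcNE y); exact: normcD. Qed.

Lemma normc_dist_tri y x z : normc (x - z) <= normc (x - y) + normc (y - z).
Proof. by have := normcD (x - y) (y - z); rewrite addrA subrK. Qed.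

Lemma normc_sub_ge x y : normc x - normc y <= normc (x - y).
Proof. by rewrite lerBlDr -{1}(subrK y x) normcD. Qed.

Lemma normcX z n : normc (z ^+ n) = normc z ^+ n.
Proof. by elim: n => [|n ih]; rewrite ?expr0 ?normc1// !exprS normcM ih. Qed.

Lemma normc_sum (I : Type) (r : seq I) (P : pred I) (F : I -> C) :
  normc (\sum_(i <- r | P i) F i) <= \sum_(i <- r | P i) normc (F i).
Proof.
elim/big_rec2: _ => [|i a b _ ab]; first by rewrite normc0.
by apply: le_trans (normcD _ _) _; rewrite lerD2l.
Qed.

Lemma normcJE z : normc (conjc z) = normc z.
Proof. by case: z => a b /=; rewrite sqrrN. Qed.

Lemma conjcM x y : conjc (x * y) = conjc x * conjc y. Proof. exact: (rmorphM (@conjc R)). Qed.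
Lemma conjcN x : conjc (- x) = - conjc x. Proof. exact: (rmorphN (@conjc R)). Qed.
Lemma conjcB x y : conjc (x - y) = conjc x - conjc y. Proof. exact: (rmorphB (@conjc R)). Qed.
Lemma conjcX x n : conjc (x ^+ n) = conjc x ^+ n. Proof. exact: (rmorphXn (@conjc R)). Qed.
Lemma conjc1E : conjc 1 = 1 :> C. Proof. exact: conjc1. Qed.
Lemma conjcR (r : R) : conjc r%:C = r%:C :> C. Proof. exact: conjc_real. Qed.

Lemma normc_real (r : R) : normc r%:C = `|r|.
Proof. by rewrite /normc /= expr0n addr0 sqrtr_sqr. Qed.

Lemma normc_nat n : normc (n%:R : C) = n%:R.
Proof. by rewrite -(rmorph_nat (real_complex R)) normc_real normr_nat. Qed.

Lemma normc_eq0 z : (normc z == 0) = (z == 0).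
Proof.
apply/eqP/eqP => [|->]; [exact: eq0_normc|exact: normc0].
Qed.

Lemma normc_gt0 z : (0 < normc z) = (z != 0).
Proof. by rewrite lt_neqAle normc_ge0 andbT eq_sym normc_eq0. Qed.

Lemma Re_le_normc z : `|complex.Re z| <= normc z.
Proof. by case: z => a b /=; rewrite -sqrtr_sqr ler_wsqrtr// lerDl sqr_ge0. Qed.

Lemma Im_le_normc z : `|complex.Im z| <= normc z.
Proof. by case: z => a b /=; rewrite -sqrtr_sqr ler_wsqrtr// lerDr sqr_ge0. Qed.

Lemma normc_le_ReIm z : normc z <= `|complex.Re z| + `|complex.Im z|.
Proof.
case: z => a b /=; rewrite -[leRHS]ger0_norm ?addr_ge0// -sqrtr_sqr ler_wsqrtr//.
by rewrite sqrrD !real_normK ?num_real// -addrA lerD2l lerDr mulrn_wge0// mulr_ge0.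
Qed.

Lemma normc_sqr z : normc z ^+ 2 = complex.Re z ^+ 2 + complex.Im z ^+ 2.
Proof. by case: z => a b /=; rewrite sqr_sqrtr// addr_ge0 ?sqr_ge0. Qed.

Lemma ReD x y : complex.Re (x + y) = complex.Re x + complex.Re y.
Proof. by case: x; case: y. Qed.

Lemma ReB x y : complex.Re (x - y) = complex.Re x - complex.Re y.
Proof. by case: x; case: y. Qed.

Lemma ImB x y : complex.Im (x - y) = complex.Im x - complex.Im y.
Proof. by case: x; case: y. Qed.

Lemma ReZ (a : R) x : complex.Re (a%:C * x) = a * complex.Re x.
Proof. by case: x => u v /=; rewrite mul0r subr0. Qed.

Lemma ImZ (a : R) x : complex.Im (a%:C * x) = a * complex.Im x.
Proof. by case: x => u v /=; rewrite mul0r addr0. Qed.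

Lemma normc_div1 x : normc (1 / x) = (normc x)^-1.
Proof. by rewrite div1r normcV. Qed.

Lemma normc_sub1_ge x : 1 - normc x <= normc (1 - x).
Proof. by have := normc_sub_ge 1 x; rewrite normc1. Qed.

Lemma normc_sub1_gt0 x : normc x < 1 -> 0 < normc (1 - x).
Proof. by move=> x1; apply: lt_le_trans (normc_sub1_ge x); rewrite subr_gt0. Qed.

Lemma sub1_neq0 x : normc x < 1 -> 1 - x != 0.
Proof. by move=> x1; rewrite -normc_gt0 normc_sub1_gt0. Qed.

Lemma normcM_lt1 x y : normc x < 1 -> normc y <= 1 -> normc (x * y) < 1.
Proof.
move=> x1 y1; rewrite normcM; apply: le_lt_trans x1.
by rewrite ler_piMr ?normc_ge0.
Qed.

(** Differentiability as a remainder bound with real constants, so that estimates can be chained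
    without filters; [cderivP] and [cderiv_derivable] translate from and to [derivable]. *)
Definition cderiv (f : C -> C) z D := forall e : R, 0 < e ->
  exists2 d : R, 0 < d & forall h, normc h < d ->
    normc (f (z + h) - f z - h * D) <= e * normc h.

End ComplexModulus.
Section CDerivative.
Variable R : realType.
Local Notation C := (R[i]).

Lemma cderivP (f : C -> C) z : derivable f z 1 -> cderiv f z (derive1 f z).
Proof.
move=> df e e0; have e0' : 0 < e%:C by rewrite ltcR.
have Hc : (fun h : C => h^-1 *: ((f \o shift z) (h *: 1) - f z)) @ 0^' --> derive1 f z.
  by rewrite derive1E; exact: df.
have Fz : Filter (@dnbhs C 0) := dnbhs_filter 0.
have [d /lt0cE[d' d0 dE] H] := (iffLR (@cvgrPdist_le C C C (@dnbhs C 0) Fz _ _)) Hc _ e0'.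
exists d' => // h hd.
have [->|h0] := eqVneq h 0.
  by rewrite addr0 mul0r subr0 subrr normc0 mulr0.
have := H h; rewrite /= sub0r normrN dE lt_normcR => /(_ hd h0).
rewrite -[`| _ |]/((normc _)%:C) lecR => /(ler_wpM2l (normc_ge0 h)).
rewrite -normcM mulrC [e * _]mulrC mulrC; apply: le_trans.
rewrite normc_distC mulrC le_eqVlt; apply/orP; left; apply/eqP; congr normc.
have -> : h%:A = h by rewrite -[LHS]/(h * 1) mulr1.
rewrite (_ : h^-1 *: _ = h^-1 * (f (h + z) - f z))// [h + z]addrC.
by field.
Qed.

Lemma cderiv_derivable (f : C -> C) z D : cderiv f z D ->
  derivable f z 1 /\ derive1 f z = D.
Proof.
move=> df.
have Fz : Filter (@dnbhs C 0) := dnbhs_filter 0.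
have Hc : (fun h : C => h^-1 *: ((f \o shift z) (h *: 1) - f z)) @ 0^' --> D.
  apply: (iffRL (@cvgrPdist_le C C C (@dnbhs C 0) Fz _ _)) => e /lt0cE[e' e0 ->].
  have [d d0 H] := df _ e0; exists d%:C; first by rewrite /= ltcR.
  move=> h /=; rewrite sub0r normrN lt_normcR => hd h0.
  rewrite -[`| _ |]/((normc _)%:C) lecR.
  have hp : 0 < normc h by rewrite normc_gt0.
  rewrite -(ler_pM2l hp) -normcM [normc h * e']mulrC.
  apply: le_trans (H _ hd); rewrite normc_distC le_eqVlt; apply/orP; left; apply/eqP.
  congr normc.
  have -> : h%:A = h by rewrite -[LHS]/(h * 1) mulr1.
  rewrite (_ : h^-1 *: _ = h^-1 * (f (h + z) - f z))// [h + z]addrC.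
  by field.
split; first by apply/cvg_ex; exists D.
by rewrite derive1E; exact: (@cvg_lim C _ _ _ _ _ _ Hc).
Qed.

Lemma cderiv_unique (f : C -> C) z D D' : cderiv f z D -> cderiv f z D' -> D = D'.
Proof. by move=> /cderiv_derivable[_ <-] /cderiv_derivable[_ <-]. Qed.

Lemma cderivD (f g : C -> C) z D E : cderiv f z D -> cderiv g z E ->
  cderiv (fun w => f w + g w) z (D + E).
Proof.
move=> hf hg e e0; have e2 : 0 < e / 2 by rewrite divr_gt0.
have [d d0 Hf] := hf _ e2; have [d' d'0 Hg] := hg _ e2.
exists (Num.min d d'); first by rewrite lt_min d0.
move=> h; rewrite lt_min => /andP[hd hd'].
have -> : f (z + h) + g (z + h) - (f z + g z) - h * (D + E) =
  (f (z + h) - f z - h * D) + (g (z + h) - g z - h * E) by ring.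
apply: le_trans (normcD _ _) _.
by rewrite [e]splitr mulrDl lerD ?Hf ?Hg.
Qed.

Lemma cderivZ (f : C -> C) z D a : cderiv f z D -> cderiv (fun w => a * f w) z (a * D).
Proof.
move=> hf e e0; have a1 : 0 < normc a + 1 by rewrite ltr_wpDl ?normc_ge0.
have [d d0 Hf] := hf _ (divr_gt0 e0 a1); exists d => // h hd.
have -> : a * f (z + h) - a * f z - h * (a * D) = a * (f (z + h) - f z - h * D) by ring.
rewrite normcM; apply: (@le_trans _ _ (normc a * (e / (normc a + 1) * normc h))).
  by rewrite ler_wpM2l ?normc_ge0 ?Hf.
rewrite mulrA ler_wpM2r ?normc_ge0// mulrCA -[leRHS]mulr1 ler_wpM2l ?(ltW e0)//.
by rewrite ler_pdivrMr// mul1r lerDl.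
Qed.

Lemma cderivN (f : C -> C) z D : cderiv f z D -> cderiv (fun w => - f w) z (- D).
Proof.
by move=> /(cderivZ (-1)); rewrite mulN1r; under eq_fun do rewrite mulN1r.
Qed.

Lemma cderivB (f g : C -> C) z D E : cderiv f z D -> cderiv g z E ->
  cderiv (fun w => f w - g w) z (D - E).
Proof. by move=> hf /cderivN; exact: cderivD. Qed.

Lemma cderiv_cst (a : C) z : cderiv (fun=> a) z 0.
Proof.
move=> e e0; exists 1 => // h _.
by rewrite subrr mulr0 subr0 normc0 mulr_ge0 ?normc_ge0 ?ltW.
Qed.

Lemma cderiv_sum (I : Type) (s : seq I) (f : I -> C -> C) (D : I -> C) z :
  (forall i, cderiv (f i) z (D i)) ->
  cderiv (fun w => \sum_(i <- s) f i w) z (\sum_(i <- s) D i).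
Proof.
move=> hf; elim: s => [|i s ih].
  rewrite big_nil (_ : (fun w => _) = fun=> 0); first exact: cderiv_cst.
  by apply/funext => w; rewrite big_nil.
rewrite big_cons (_ : (fun w => _) = fun w => f i w + \sum_(k <- s) f k w).
  exact: cderivD.
by apply/funext => w; rewrite big_cons.
Qed.

Lemma cderiv_scale (f : C -> C) z D a :
  cderiv f (a * z) D -> cderiv (fun w => f (a * w)) z (a * D).
Proof.
move=> hf e e0; have a1 : 0 < normc a + 1 by rewrite ltr_wpDl ?normc_ge0.
have [d d0 Hf] := hf _ (divr_gt0 e0 a1).
exists (d / (normc a + 1)); first by rewrite divr_gt0.
move=> h; rewrite ltr_pdivlMr// => hd.
have ahd : normc (a * h) < d.
  apply: le_lt_trans hd; rewrite normcM mulrC ler_wpM2l ?normc_ge0//.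
  by rewrite lerDl.
rewrite mulrDr (_ : h * (a * D) = a * h * D); last by ring.
apply: le_trans (Hf _ ahd) _.
rewrite normcM mulrA ler_wpM2r ?normc_ge0// mulrAC -mulrA -[leRHS]mulr1 ler_wpM2l ?(ltW e0)//.
by rewrite ler_pdivrMr// mul1r lerDl.
Qed.

Lemma cderiv_cont (f : C -> C) z D : cderiv f z D -> forall e : R, 0 < e ->
  exists2 d : R, 0 < d & forall h, normc h < d -> normc (f (z + h) - f z) <= e.
Proof.
move=> hf e e0; have [d d0 H] := hf 1 ltr01.
have D2 : 0 < normc D + 1 by rewrite ltr_wpDl ?normc_ge0.
exists (Num.min d (e / (normc D + 1))); first by rewrite lt_min d0 divr_gt0.
move=> h; rewrite lt_min => /andP[/H hd]; rewrite ltr_pdivlMr// => he.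
apply: le_trans (ltW he).
have -> : f (z + h) - f z = (f (z + h) - f z - h * D) + h * D by ring.
apply: le_trans (normcD _ _) _; rewrite mulrDr mulr1 addrC normcM lerD2l.
by rewrite mul1r in hd.
Qed.

Lemma analytic_cderiv (f : C -> C) z : analytic f -> disk z -> cderiv f z (derive1 f z).
Proof. by move=> af /af; exact: cderivP. Qed.

End CDerivative.

(** * Means over roots of unity *)

Section RootsOfUnity.
Variable R : realType.
Local Notation C := (R[i]).

(** The argument counts full turns, so the period is 1 and the roots of unity below sit at dyadic
    arguments. *)
Definition cis (t : R) : C := cos (2 * pi * t) +i* sin (2 * pi * t).

Lemma cis0 : cis 0 = 1.
Proof. by rewrite /cis mulr0 cos0 sin0. Qed.

Lemma cis1 : cis 1 = 1.
Proof. by rewrite /cis mulr1 mulr_natl cos2pi sin2pi. Qed.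

Lemma cisD s t : cis (s + t) = cis s * cis t.
Proof.
apply/eqP; rewrite /cis mulrDr cosD sinD eq_complex /= eqxx /=.
by apply/eqP; ring.
Qed.

Lemma cisN s : cis (- s) = conjc (cis s).
Proof. by rewrite /cis mulrN cosN sinN. Qed.

Lemma normc_cis t : normc (cis t) = 1.
Proof. by rewrite /= cos2Dsin2 sqrtr1. Qed.

Lemma cis_neq0 t : cis t != 0.
Proof. by rewrite -normc_gt0 normc_cis. Qed.

Lemma cis_conj t : conjc (cis t) = (cis t)^-1.
Proof.
apply: (mulfI (cis_neq0 t)); rewrite divff ?cis_neq0//.
by rewrite -cisN -cisD subrr cis0.
Qed.

Lemma cis_half : cis (1 / 2) = -1.
Proof.
rewrite /cis (_ : 2 * pi * (1 / 2) = pi); last by field.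
by rewrite cospi sinpi; apply/eqP; rewrite eq_complex /= oppr0 !eqxx.
Qed.

Lemma cisX t n : cis t ^+ n = cis (n%:R * t).
Proof.
elim: n => [|n ih]; first by rewrite expr0 mul0r cis0.
by rewrite exprS ih -cisD -natr1; congr cis; ring.
Qed.

Lemma cos_lipschitz (s t : R) : `|cos s - cos t| <= `|s - t|.
Proof.
wlog st : s t / t <= s.
  move=> h; have [|/ltW] := leP t s; first exact: h.
  by rewrite (distrC (cos s)) (distrC s); exact: h.
have [|c _ ->] := @MVT_segment R cos (fun x => - sin x) t s st.
  by apply: continuous_subspaceT => x; exact: continuous_cos.
by rewrite normrM normrN ler_piMl// sin_max.
Qed.

Lemma sin_lipschitz (s t : R) : `|sin s - sin t| <= `|s - t|.
Proof.
rewrite -!cosBpihalf; apply: le_trans (cos_lipschitz _ _) _.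
by rewrite opprB addrA subrK.
Qed.

Lemma cis_lipschitz s t : normc (cis s - cis t) <= 4 * pi * `|s - t|.
Proof.
apply: le_trans (normc_le_ReIm _) _ => /=.
have h : `|2 * pi * s - 2 * pi * t| = 2 * pi * `|s - t|.
  by rewrite -mulrBr normrM ger0_norm// mulr_ge0// pi_ge0.
rewrite (_ : 4 * pi * `|s - t| = 2 * pi * `|s - t| + 2 * pi * `|s - t|); last by ring.
by rewrite lerD// -h; [exact: cos_lipschitz|exact: sin_lipschitz].
Qed.

Lemma polar (w : C) : exists2 t, 0 <= t < 1 & w = (normc w)%:C * cis t.
Proof.
have [->|w0] := eqVneq w 0.
  by exists 0; rewrite ?lexx ?ltr01// normc0 mul0r.
have nw : 0 < normc w by rewrite normc_gt0.
have pp : 0 < pi :> R by exact: pi_gt0.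
pose a := complex.Re w / normc w; pose b := complex.Im w / normc w.
have ab : a ^+ 2 + b ^+ 2 = 1.
  by rewrite /a /b !expr_div_n -mulrDl -normc_sqr divff// expf_neq0// gt_eqF.
have a1 : -1 <= a <= 1.
  have a2 : a ^+ 2 <= 1 by rewrite -ab lerDl sqr_ge0.
  by rewrite -ler_norml -(@ler_pXn2r _ 2)// ?nnegrE// expr1n real_normK ?num_real.
have [c0 cE] := acos_def a1.
have sE : sin (acos a) = `|b|.
  by rewrite sin_acos// (_ : 1 - a ^+ 2 = b ^+ 2) ?sqrtr_sqr// -ab; ring.
have wE : w = (normc w)%:C * (a +i* b).
  rewrite /a /b; case: (w) nw => u v nw; apply/eqP; rewrite eq_complex.
  move: nw; set m := normc _ => nw /=.
  have nw' : m != 0 by rewrite gt_eqF.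
  by rewrite !mul0r subr0 addr0 [m * (u / m)]mulrC [m * (v / m)]mulrC !divfK// !eqxx.
have [b0|b0] := leP 0 b.
  exists (acos a / (2 * pi)).
    move/andP: c0 => [c0 c1]; rewrite divr_ge0 ?mulr_ge0 ?(ltW pp)//=.
    by rewrite ltr_pdivrMr ?mulr_gt0//; lra.
  rewrite {1}wE /cis [2 * pi * _]mulrC divfK ?mulf_neq0 ?gt_eqF//.
  by rewrite cE sE ger0_norm.
exists (1 - acos a / (2 * pi)).
  move/andP: c0 => [c0 c1].
  have ca : 0 < acos a.
    rewrite lt_neqAle c0 andbT; apply/eqP => ca; move: sE; rewrite -ca sin0.
    by move/esym/normr0_eq0 => be; rewrite be ltxx in b0.
  rewrite ltrBlDr ltrDl divr_gt0 ?mulr_gt0// andbT subr_ge0.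
  by rewrite ler_pdivrMr ?mulr_gt0//; lra.
rewrite cisD cis1 mul1r cisN {1}wE /cis [2 * pi * _]mulrC divfK ?mulf_neq0 ?gt_eqF//.
by rewrite cE sE ltr0_norm//= opprK.
Qed.

Definition root2 n k : C := cis (k%:R / 2 ^+ n).

Lemma expr2_gt0 n : 0 < 2 ^+ n :> R. Proof. exact: exprn_gt0. Qed.
Lemma expr2_neq0 n : 2 ^+ n != 0 :> R. Proof. by rewrite gt_eqF ?expr2_gt0. Qed.
Lemma expr2V_ge0 n : 0 <= (2 ^+ n)^-1 :> R. Proof. by rewrite invr_ge0 exprn_ge0. Qed.
Hint Resolve expr2_gt0 expr2_neq0 expr2V_ge0 : core.

Lemma normc_root2 n k : normc (root2 n k) = 1. Proof. exact: normc_cis. Qed.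

Lemma root2S_even n k : root2 n.+1 k.*2 = root2 n k.
Proof.
rewrite /root2 -muln2 natrM exprS; congr cis.
by field; rewrite expr2_neq0.
Qed.

Lemma root2S_odd n k : root2 n.+1 k.*2.+1 = root2 n.+1 1 * root2 n k.
Proof.
rewrite -(root2S_even n k) /root2 -cisD -mulrDl; congr (cis (_ / _)).
by rewrite -natr1 addrC.
Qed.

Lemma root2S1X n : root2 n.+1 1 ^+ (2 ^ n) = -1.
Proof.
by rewrite /root2 cisX natrX -cis_half; congr cis; rewrite exprS; field.
Qed.

Definition cmean n (F : C -> C) : C := (2 ^+ n)^-1%:C * \sum_(k < 2 ^ n) F (root2 n k).
Definition rmean n (F : C -> R) : R := (2 ^+ n)^-1 * \sum_(k < 2 ^ n) F (root2 n k).

Lemma sum_double (V : nmodType) (F : nat -> V) N :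
  \sum_(k < N.*2) F k = \sum_(k < N) F k.*2 + \sum_(k < N) F k.*2.+1.
Proof.
elim: N => [|N ih]; first by rewrite !big_ord0 addr0.
by rewrite doubleS !big_ord_recr /= ih !addrA; congr (_ + _); rewrite addrAC.
Qed.

Lemma sum_root2S (V : nmodType) n (F : C -> V) :
  \sum_(k < 2 ^ n.+1) F (root2 n.+1 k) =
  \sum_(k < 2 ^ n) F (root2 n k) + \sum_(k < 2 ^ n) F (root2 n.+1 1 * root2 n k).
Proof.
rewrite expnS mul2n (sum_double (fun k => F (root2 n.+1 k))).
by congr (_ + _); apply: eq_bigr => k _; rewrite ?root2S_even ?root2S_odd.
Qed.

Lemma cmeanS n F :
  cmean n.+1 F = (cmean n F + cmean n (fun z => F (root2 n.+1 1 * z))) / 2.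
Proof.
have e : ((2 ^+ n.+1)^-1)%:C = (2 ^+ n)^-1%:C / 2 :> C.
  rewrite exprS invfM mulrC rmorphM; congr (_ * _).
  by rewrite fmorphV rmorph_nat.
by rewrite /cmean sum_root2S e; ring.
Qed.

Lemma normc_cmean n F : normc (cmean n F) <= rmean n (fun z => normc (F z)).
Proof.
by rewrite normcM normc_real ger0_norm// /rmean ler_wpM2l// normc_sum.
Qed.

Lemma rmean_le n (F G : C -> R) : (forall z, normc z = 1 -> F z <= G z) ->
  rmean n F <= rmean n G.
Proof.
move=> FG; rewrite /rmean ler_wpM2l// ler_sum// => k _.
by rewrite FG// normc_root2.
Qed.

Lemma sum_cst2 n (c : R) : \sum_(k < 2 ^ n) c = 2 ^+ n * c.
Proof. by rewrite sumr_const card_ord -[LHS]mulr_natl natrX. Qed.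

Lemma rmean_cst n (c : R) : rmean n (fun=> c) = c.
Proof. by rewrite /rmean sum_cst2 mulrA mulVf// mul1r. Qed.

Lemma rmeanZ n (c : R) F : rmean n (fun z => c * F z) = c * rmean n F.
Proof. by rewrite /rmean -mulr_sumr mulrCA. Qed.

Lemma rmeanD n F G : rmean n (fun z => F z + G z) = rmean n F + rmean n G.
Proof. by rewrite /rmean big_split mulrDr. Qed.

Lemma cmeanZ n (c : C) F : cmean n (fun z => c * F z) = c * cmean n F.
Proof. by rewrite /cmean -mulr_sumr mulrCA. Qed.

Lemma cmeanD n F G : cmean n (fun z => F z + G z) = cmean n F + cmean n G.
Proof. by rewrite /cmean big_split mulrDr. Qed.

Lemma cmeanB n F G : cmean n (fun z => F z - G z) = cmean n F - cmean n G.
Proof. by rewrite /cmean sumrB mulrBr. Qed.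

Lemma eq_cmean n F G : (forall z, normc z = 1 -> F z = G z) -> cmean n F = cmean n G.
Proof.
by move=> FG; congr (_ * _); apply: eq_bigr => k _; rewrite FG// normc_root2.
Qed.

(** The odd roots of order [2 ^ n.+1] are the roots of order [2 ^ n] rotated by an element whose
    [2 ^ n]-th power is -1. With [u = x ^+ (2 ^ n)] the two halves of the mean are [1 / (1 - u)] and
    [1 / (1 + u)], and they average to [1 / (1 - u ^+ 2)]. *)
Lemma cmean_cauchy_kernel n x : normc x < 1 ->
  cmean n (fun z => 1 / (1 - conjc z * x)) = 1 / (1 - x ^+ (2 ^ n)).
Proof.
elim: n x => [|n ih] x x1.
  have r1 : root2 0 (@ord0 0) = 1 by rewrite /root2 mul0r cis0.
  transitivity (1 / (1 - conjc (root2 0 (@ord0 0)) * x)); last by rewrite r1 conjc1E (mul1r x) expn0 expr1.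
  by rewrite /cmean expr0 invr1 big_ord1 rmorph1 [LHS]mul1r.
rewrite cmeanS ih//.
have -> : cmean n (fun z => 1 / (1 - conjc (root2 n.+1 1 * z) * x)) =
  cmean n (fun z => 1 / (1 - conjc z * (conjc (root2 n.+1 1) * x))).
  by apply: eq_cmean => z _; rewrite conjcM mulrA [conjc z * _]mulrC.
have ux : normc (conjc (root2 n.+1 1) * x) < 1.
  by rewrite mulrC normcM_lt1// normcJE normc_root2.
have uX : (conjc (root2 n.+1 1) * x) ^+ (2 ^ n) = - x ^+ (2 ^ n).
  by rewrite exprMn -conjcX root2S1X conjcN conjc1E mulN1r.
rewrite ih// uX expnS mulnC exprM.
have xn : normc (x ^+ (2 ^ n)) < 1 by rewrite normcX exprn_ilt1 ?normc_ge0 ?expn_eq0.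
have d1 := sub1_neq0 xn.
have d2 : 1 + x ^+ (2 ^ n) != 0 by rewrite -[x ^+ _]opprK sub1_neq0// normcNE.
have d3 : 1 - (x ^+ (2 ^ n)) ^+ 2 != 0 by rewrite -[X in X - _](expr1n _ 2) subr_sqr mulf_neq0.
by field; rewrite d3 opprK d2 d1.
Qed.

Lemma Re_inv_sub1 (y : C) : normc y < 1 ->
  (1 - normc y ^+ 2) / normc (1 - y) ^+ 2 = 2 * complex.Re (1 / (1 - y)) - 1.
Proof.
move=> y1; have n0 : normc (1 - y) != 0 by rewrite gt_eqF// normc_sub1_gt0.
have -> : complex.Re (1 / (1 - y)) = complex.Re (1 - y) / normc (1 - y) ^+ 2.
  rewrite div1r; case: (1 - y) => a b /=.
  by rewrite sqr_sqrtr// addr_ge0 ?sqr_ge0.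
apply: (mulIf (expf_neq0 2 n0)); rewrite /= divfK ?expf_neq0//.
rewrite mulrBl mul1r -mulrA divfK ?expf_neq0// !normc_sqr.
by case: y {y1 n0} => a b /=; ring.
Qed.

(** By [Re_inv_sub1] the Poisson kernel is [2 Re (1 / (1 - y)) - 1], so its mean is read off from
    the exact mean of the Cauchy kernel. *)
Lemma rmean_poisson n x : normc x < 1 ->
  rmean n (fun z => (normc (1 - conjc z * x) ^+ 2)^-1) <=
  2 / ((1 - normc x ^+ 2) * (1 - normc x ^+ (2 ^ n))).
Proof.
move=> x1; have x2 : 0 < 1 - normc x ^+ 2 by rewrite subr_gt0 exprn_ilt1 ?normc_ge0.
have xn : 0 < 1 - normc x ^+ (2 ^ n).
  by rewrite subr_gt0 exprn_ilt1 ?normc_ge0 ?expn_eq0.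
rewrite ler_pdivlMr ?mulr_gt0// mulrA [X in X * _]mulrC -rmeanZ.
have -> : rmean n (fun z => (1 - normc x ^+ 2) * (normc (1 - conjc z * x) ^+ 2)^-1) =
    rmean n (fun z => 2 * complex.Re (1 / (1 - conjc z * x)) - 1).
  congr (_ * _); apply: eq_bigr => k _.
  have rx : normc (conjc (root2 n k) * x) = normc x by rewrite normcM normcJE normc_root2 mul1r.
  by rewrite -Re_inv_sub1 rx.
have -> : rmean n (fun z => 2 * complex.Re (1 / (1 - conjc z * x)) - 1) =
    2 * complex.Re (1 / (1 - x ^+ (2 ^ n))) - 1.
  rewrite (rmeanD n _ (fun=> -1)) rmean_cst rmeanZ -cmean_cauchy_kernel//.
  rewrite /cmean ReZ /rmean; congr (_ * (_ * _) + _).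
  elim/big_rec2: _ => [|i a b _ ->]; first by [].
  by rewrite ReD.
have h : complex.Re (1 / (1 - x ^+ (2 ^ n))) <= (1 - normc x ^+ (2 ^ n))^-1.
  apply: le_trans (ler_norm _) _; apply: le_trans (Re_le_normc _) _.
  rewrite normc_div1 lef_pV2 ?posrE ?normc_sub1_gt0 ?normcX//.
    by rewrite -normcX; exact: normc_sub1_ge.
  by rewrite exprn_ilt1 ?normc_ge0 ?expn_eq0.
set c := complex.Re _ in h *; set b := 1 - _ in h xn *.
have h' : c * b <= 1 by rewrite -ler_pdivlMr// div1r.
have -> : (2 * c - 1) * b = 2 * (c * b) - b by ring.
by lra.
Qed.

(** For a root [z] of order [2 ^ n.+1], [z ^+ 2 - 1] factors as [(z - 1) * (z + 1)] with second
    factor at most 2, so passing to the next order at most halves the distance to 1. When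
    [z ^+ 2 = 1] this says nothing, but then [z = -1]. *)
Lemma root2_separated n m : (0 < m < 2 ^ n)%N -> 2 / 2 ^+ n <= normc (root2 n m - 1).
Proof.
elim: n m => [|n ih] m; first by rewrite expn0 ltnS; case: m.
have sq : root2 n.+1 m ^+ 2 = root2 n m.
  by rewrite /root2 cisX exprS; congr cis; field; rewrite expr2_neq0.
have up : normc (root2 n.+1 m + 1) <= 2.
  by apply: le_trans (normcD _ _) _; rewrite normc_root2 normc1.
have key u : 2 / 2 ^+ n <= u -> u <= normc (root2 n m - 1) ->
    2 / 2 ^+ n.+1 <= normc (root2 n.+1 m - 1).
  move=> h1 h2; have := le_trans h1 h2.
  rewrite -sq -[X in _ - X](expr1n _ 2) subr_sqr normcM => h.
  rewrite exprS invfM mulrA mulrAC ler_pdivrMr//.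
  by apply: le_trans h _; rewrite ler_wpM2l ?normc_ge0.
move=> /andP[m0 m2]; have [mn|mn|mn] := ltngtP m (2 ^ n).
- by apply: key (lexx _); apply: ih; rewrite m0.
- have -> : m = (2 ^ n + (m - 2 ^ n))%N by rewrite subnKC// ltnW.
  have rE : root2 n m = root2 n (m - 2 ^ n).
    rewrite -{1}(subnKC (ltnW mn)) /root2 natrD mulrDl cisD natrX divff//.
    by rewrite cis1 mul1r.
  rewrite subnKC ?(ltnW mn)//; apply: key (lexx _); rewrite rE; apply: ih.
  by rewrite subn_gt0 mn/= ltn_subLR ?(ltnW mn)// addnn -mul2n -expnS.
- rewrite mn (_ : root2 _ _ = -1); last first.
    by rewrite /root2 natrX exprS -cis_half; congr cis; field.
  rewrite -opprD normcNE -[1 + 1]/(2%:R) normc_nat ler_pdivrMr//.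
  by rewrite ler_peMr// exprn_ege1// ler1n.
Qed.

End RootsOfUnity.

(** * Cauchy's theorem and formula *)

Section Goursat.
Variable R : realType.
Local Notation C := (R[i]).

Lemma expr2_unbounded (x : R) : exists N, forall n, (N <= n)%N -> x <= 2 ^+ n.
Proof.
exists (Num.truncn `|x|).+1 => n nN; apply: le_trans (ler_norm _) _.
apply: le_trans (ltW (truncnS_gt _)) _.
apply: (@le_trans _ _ n%:R); first by rewrite ler_nat.
by rewrite -natrX ler_nat ltnW// ltn_expl.
Qed.

Lemma expr2_small (x e : R) : 0 < e ->
  exists N, forall n, (N <= n)%N -> x / 2 ^+ n <= e.
Proof.
move=> e0; have [N HN] := expr2_unbounded (x / e); exists N => n /HN.
by rewrite ler_pdivrMr// ler_pdivrMr ?exprn_gt0// mulrC.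
Qed.

Lemma dyadic_nested (u : nat -> R) (l : R) : 0 <= l ->
  (forall i, u i <= u i.+1 /\ u i.+1 + l / 2 ^+ i.+1 <= u i + l / 2 ^+ i) ->
  exists x, forall i, u i <= x <= u i + l / 2 ^+ i.
Proof.
move=> l0 h.
have up i j : (i <= j)%N -> u i <= u j.
  elim: j => [|j ih]; first by rewrite leqn0 => /eqP->.
  rewrite leq_eqVlt => /orP[/eqP->//|ij].
  by apply: le_trans (ih ij) _; case: (h j).
have dn i j : (i <= j)%N -> u j + l / 2 ^+ j <= u i + l / 2 ^+ i.
  elim: j => [|j ih]; first by rewrite leqn0 => /eqP->.
  rewrite leq_eqVlt => /orP[/eqP->//|ij].
  by apply: le_trans (ih ij); case: (h j).
have le0 i : 0 <= l / 2 ^+ i by rewrite divr_ge0 ?exprn_ge0.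
have b i j : u j <= u i + l / 2 ^+ i.
  have [ij|/ltnW ji] := leqP i j.
    by apply: le_trans (dn _ _ ij); rewrite lerDl.
  by apply: le_trans (up _ _ ji) _; rewrite lerDl.
have hs : has_sup (range u).
  by split; [exists (u 0%N), 0%N|exists (u 0%N + l / 2 ^+ 0) => _ [j _ <-]].
exists (sup (range u)) => i; apply/andP; split.
  by apply: ub_le_sup; [case: hs|exists i].
by apply: ge_sup; [case: hs|move=> _ [j _ <-]].
Qed.

(** For [G u v = h u * (v - u)] this is a Riemann sum of a contour integral. A general two-point [G]
    lets exact differences [P v - P u] and error terms be summed along the same subdivision. *)
Definition path_sum n (G : C -> C -> C) (g : R -> C) (s t : R) : C :=
  \sum_(k < 2 ^ n) G (g (s + (t - s) * (k%:R / 2 ^+ n)))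
                     (g (s + (t - s) * (k.+1%:R / 2 ^+ n))).

Lemma path_sum_split n G g s t :
  path_sum n.+1 G g s t =
  path_sum n G g s ((s + t) / 2) + path_sum n G g ((s + t) / 2) t.
Proof.
rewrite /path_sum.
have -> : (2 ^ n.+1 = 2 ^ n + 2 ^ n)%N by rewrite expnS mul2n addnn.
rewrite big_split_ord /=; congr (_ + _); apply: eq_bigr => k _; congr (G (g _) (g _)).
- by rewrite exprS; field; rewrite expf_neq0.
- by rewrite exprS; field; rewrite expf_neq0.
- by rewrite natrD natrX exprS; field; rewrite expf_neq0.
- by rewrite -addnS natrD natrX exprS; field; rewrite expf_neq0.
Qed.

Lemma path_sumD n G H g s t :
  path_sum n (fun u v => G u v + H u v) g s t = path_sum n G g s t + path_sum n H g s t.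
Proof. by rewrite /path_sum big_split. Qed.

Lemma path_sum_exact n P g s t :
  path_sum n (fun u v => P v - P u) g s t = P (g t) - P (g s).
Proof.
rewrite /path_sum.
pose F k := P (g (s + (t - s) * (k%:R / 2 ^+ n))).
rewrite -(big_mkord predT (fun k => F k.+1 - F k)) telescope_sumr//.
rewrite /F mul0r mulr0 addr0 natrX divff ?expf_neq0// mulr1.
by rewrite [s + _]addrC subrK.
Qed.

Lemma path_sum_le n G g s t c : s <= t ->
  (forall x y, s <= x <= t -> s <= y <= t -> y - x = (t - s) / 2 ^+ n ->
    normc (G (g x) (g y)) <= c) ->
  normc (path_sum n G g s t) <= 2 ^+ n * c.
Proof.
move=> st h; apply: le_trans (normc_sum _ _ _) _.
rewrite -sum_cst2 ler_sum// => k _.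
have E : 0 < 2 ^+ n :> R by rewrite exprn_gt0.
have inside j : (j <= 2 ^ n)%N -> s <= s + (t - s) * (j%:R / 2 ^+ n) <= t.
  move=> jn; have j1 : j%:R / 2 ^+ n <= 1 :> R.
    by rewrite ler_pdivrMr// mul1r -natrX ler_nat.
  have st0 : 0 <= t - s by rewrite subr_ge0.
  rewrite lerDl mulr_ge0 ?divr_ge0 ?(ltW E)//=.
  by rewrite -lerBrDl ler_piMr.
apply: h; [by apply/inside/ltnW|exact: inside|].
by rewrite -natr1; field; rewrite gt_eqF.
Qed.

(* The integral along the boundary of the image under [p] of the rectangle
   [a, b] x [c, d], each side being cut into [2 ^ n] pieces. *)
Definition rect_sum n G (p : R -> R -> C) (a b c d : R) : C :=
  path_sum n G (p b) c d - path_sum n G (p a) c d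
  - path_sum n G (p^~ d) a b + path_sum n G (p^~ c) a b.

Lemma rect_sum_split n G p a b c d :
  rect_sum n.+1 G p a b c d =
  rect_sum n G p a ((a + b) / 2) c ((c + d) / 2) +
  rect_sum n G p ((a + b) / 2) b c ((c + d) / 2) +
  rect_sum n G p a ((a + b) / 2) ((c + d) / 2) d +
  rect_sum n G p ((a + b) / 2) b ((c + d) / 2) d.
Proof. by rewrite /rect_sum !path_sum_split; ring. Qed.

Lemma rect_sumD n G H p a b c d :
  rect_sum n (fun u v => G u v + H u v) p a b c d =
  rect_sum n G p a b c d + rect_sum n H p a b c d.
Proof. by rewrite /rect_sum !path_sumD; ring. Qed.

Lemma rect_sum_exact n P p a b c d :
  rect_sum n (fun u v => P v - P u) p a b c d = 0.
Proof. by rewrite /rect_sum !path_sum_exact; ring. Qed.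

Lemma rect_sum_le n G p a b c d K : a <= b -> c <= d ->
  (forall x y x' y', a <= x <= b -> c <= y <= d -> a <= x' <= b -> c <= y' <= d ->
     `|x' - x| + `|y' - y| <= ((b - a) + (d - c)) / 2 ^+ n ->
     normc (G (p x y) (p x' y')) <= K) ->
  normc (rect_sum n G p a b c d) <= 4 * (2 ^+ n * K).
Proof.
move=> ab cd h.
have E : 0 <= (2 ^+ n)^-1 :> R by exact: expr2V_ge0.
have aab : a <= a <= b by rewrite lexx. have bab : a <= b <= b by rewrite lexx andbT.
have ccd : c <= c <= d by rewrite lexx. have dcd : c <= d <= d by rewrite lexx andbT.
have ba0 : 0 <= (b - a) / 2 ^+ n by rewrite mulr_ge0 ?subr_ge0.
have dc0 : 0 <= (d - c) / 2 ^+ n by rewrite mulr_ge0 ?subr_ge0.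
have h1 x : a <= x <= b -> normc (path_sum n G (p x) c d) <= 2 ^+ n * K.
  move=> xab; apply: path_sum_le => // y y' ycd y'cd yy'.
  by apply: h => //; rewrite subrr normr0 add0r yy' ger0_norm// (mulrDl (b - a)) lerDr.
have h2 y : c <= y <= d -> normc (path_sum n G (p^~ y) a b) <= 2 ^+ n * K.
  move=> ycd; apply: path_sum_le => // x x' xab x'ab xx'.
  by apply: h => //; rewrite subrr normr0 addr0 xx' ger0_norm// (mulrDl (b - a)) lerDl.
rewrite (_ : 4 * _ = 2 ^+ n * K + 2 ^+ n * K + 2 ^+ n * K + 2 ^+ n * K); last by ring.
apply: le_trans (normcD _ _) _; apply: lerD; last exact: h2.
apply: le_trans (normcB _ _) _; apply: lerD; last exact: h2.
by apply: le_trans (normcB _ _) _; apply: lerD; exact: h1.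
Qed.

Definition cauchy_form (h : C -> C) u v := h u * (v - u).

(** The affine part of [h] at [p s t] has the primitive [P], whose differences cancel around the
    boundary. What is left, [err], is the differentiability remainder times the step, minus
    [D * (v - u) ^+ 2 / 2], which disappears as the subdivision is refined. *)
Lemma rect_sum_local (h : C -> C) (p : R -> R -> C) (D : C) (K e d0 : R)
    a b c d s t : 0 <= K -> 0 <= e ->
  a <= s <= b -> c <= t <= d ->
  (forall x y x' y', a <= x <= b -> c <= y <= d -> a <= x' <= b -> c <= y' <= d ->
    normc (p x' y' - p x y) <= K * (`|x' - x| + `|y' - y|)) ->
  (forall z, normc z < d0 -> normc (h (p s t + z) - h (p s t) - z * D) <= e * normc z) ->
  K * ((b - a) + (d - c)) < d0 ->
  forall n, normc (rect_sum n (cauchy_form h) p a b c d) <=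
    4 * (K * ((b - a) + (d - c))) ^+ 2 * (normc D / 2 ^+ n + e).
Proof.
move=> K0 e0 sab tcd lip hd Kd n; set L := (b - a) + (d - c) in Kd *.
have ab : a <= b by case/andP: sab; exact: le_trans.
have cd : c <= d by case/andP: tcd; exact: le_trans.
have E : 0 < 2 ^+ n :> R by rewrite exprn_gt0.
have E1 : (2 ^+ n)^-1 <= 1 :> R by rewrite invf_le1 ?exprn_ege1 ?ler1n.
have L0 : 0 <= L by rewrite addr_ge0 ?subr_ge0.
pose z0 := p s t.
pose P z := h z0 * z + D * (z - z0) ^+ 2 / 2.
pose err u v := (h u - h z0 - (u - z0) * D) * (v - u) - D * (v - u) ^+ 2 / 2.
have -> : rect_sum n (cauchy_form h) p a b c d =
    rect_sum n (fun u v => (P v - P u) + err u v) p a b c d.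
  by congr (rect_sum n _ p a b c d); apply/funext => u; apply/funext => v;
    rewrite /cauchy_form /P /err; field.
rewrite rect_sumD rect_sum_exact add0r.
have -> : 4 * (K * L) ^+ 2 * (normc D / 2 ^+ n + e) =
    4 * (2 ^+ n * ((K * L) ^+ 2 * (normc D / 2 ^+ n + e) / 2 ^+ n)).
  by field; rewrite gt_eqF.
apply: rect_sum_le => // x y x' y' hx hy hx' hy' dd.
set u := p x y; set v := p x' y'.
have uv : normc (v - u) <= K * L / 2 ^+ n.
  by apply: le_trans (lip _ _ _ _ hx hy hx' hy') _; rewrite -mulrA ler_wpM2l.
have uz : normc (u - z0) <= K * L.
  apply: le_trans (lip _ _ _ _ sab tcd hx hy) _; rewrite ler_wpM2l//.
  move: hx hy sab tcd => /andP[? ?] /andP[? ?] /andP[? ?] /andP[? ?].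
  by rewrite lerD// ler_norml; apply/andP; split; lra.
have r1 : normc (h u - h z0 - (u - z0) * D) <= e * (K * L).
  have := hd (u - z0) (le_lt_trans uz Kd); rewrite -/z0 (addrC z0) subrK => /le_trans; apply.
  by rewrite ler_wpM2l.
rewrite /err; apply: le_trans (normcB _ _) _.
have -> : (K * L) ^+ 2 * (normc D / 2 ^+ n + e) / 2 ^+ n =
   e * (K * L) * (K * L / 2 ^+ n) + normc D * (K * L / 2 ^+ n) ^+ 2.
  by field; rewrite gt_eqF.
apply: lerD; first by rewrite normcM ler_pM ?normc_ge0.
rewrite normcM normcM normcX normcV (normc_nat _ 2) -mulrA ler_wpM2l ?normc_ge0//.
apply: (@le_trans _ _ (normc (v - u) ^+ 2)).
  by rewrite ler_piMr ?sqr_ge0// invf_le1// ler1n.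
by rewrite lerXn2r ?nnegrE ?normc_ge0// (le_trans (normc_ge0 _) uv).
Qed.

Definition eventually_le n0 (F : nat -> C) (x : R) :=
  forall n, (n0 <= n)%N -> normc (F n) <= x.

(** Bisection as in Goursat's proof, carried out on Riemann sums: if the sums over a rectangle do
    not become smaller than [eta], those over some quarter do not become smaller than [eta / 4], and
    differentiability at the common point of the nested quarters contradicts this. The Lipschitz map
    [p] allows curved rectangles, in particular annular regions. *)
Lemma goursat (h : C -> C) (p : R -> R -> C) (K a c l m : R) :
  0 <= K -> 0 <= l -> 0 <= m ->
  (forall x y x' y', a <= x <= a + l -> c <= y <= c + m ->
     a <= x' <= a + l -> c <= y' <= c + m ->
    normc (p x' y' - p x y) <= K * (`|x' - x| + `|y' - y|)) ->
  (forall x y, a <= x <= a + l -> c <= y <= c + m -> exists D, cderiv h (p x y) D) ->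
  forall eta : R, 0 < eta -> exists n0,
    eventually_le n0 (fun n => rect_sum n (cauchy_form h) p a (a + l) c (c + m)) eta.
Proof.
move=> K0 l0 m0 lip hd eta eta0; apply: contrapT => bad.
pose sz (i : nat) := (2 ^+ i : R).
pose Bad i (x : R * R) := ~ exists n0, eventually_le n0
  (fun n => rect_sum n (cauchy_form h) p x.1 (x.1 + l / sz i) x.2 (x.2 + m / sz i))
  (eta / 4 ^+ i).
have sz0 i : 0 < sz i by rewrite exprn_gt0.
have szS i : sz i.+1 = 2 * sz i by rewrite /sz exprS.
have step i x : Bad i x -> exists y, Bad i.+1 y /\
    (x.1 <= y.1 /\ y.1 + l / sz i.+1 <= x.1 + l / sz i) /\
    (x.2 <= y.2 /\ y.2 + m / sz i.+1 <= x.2 + m / sz i).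
  move=> B; apply: contrapT => nex; apply: B.
  have half (q : R) : q / sz i = q / sz i.+1 + q / sz i.+1.
    by rewrite szS; field; rewrite gt_eqF.
  have q0 (q : R) : 0 <= q -> 0 <= q / sz i.+1 by move=> ?; rewrite divr_ge0// ltW.
  have sub (al be : bool) : exists n0, eventually_le n0
      (fun n => rect_sum n (cauchy_form h) p
         (x.1 + al%:R * (l / sz i.+1)) (x.1 + al%:R * (l / sz i.+1) + l / sz i.+1)
         (x.2 + be%:R * (m / sz i.+1)) (x.2 + be%:R * (m / sz i.+1) + m / sz i.+1))
      (eta / 4 ^+ i.+1).
    apply: contrapT => B'; apply: nex.
    exists (x.1 + al%:R * (l / sz i.+1), x.2 + be%:R * (m / sz i.+1)); split => //=.
    have := q0 _ l0; have := q0 _ m0; rewrite !half.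
    by case: al {B'}; case: be => /=; rewrite ?mul0r ?mul1r ?addr0; split; split; lra.
  have [n1 H1] := sub false false; have [n2 H2] := sub true false.
  have [n3 H3] := sub false true; have [n4 H4] := sub true true.
  (* A subdivision of order [n.+1] of the rectangle restricts to one of order [n] on each
     quarter. *)
  exists (maxn (maxn n1 n2) (maxn n3 n4)).+1 => -[//|n].
  rewrite ltnS !geq_max => /andP[/andP[/H1 h1 /H2 h2] /andP[/H3 h3 /H4 h4]].
  rewrite rect_sum_split.
  have mid q r : (q + (q + r / sz i)) / 2 = q + r / sz i.+1.
    by rewrite szS; field; rewrite gt_eqF.
  rewrite !mid.
  have -> : eta / 4 ^+ i = eta / 4 ^+ i.+1 + eta / 4 ^+ i.+1 + eta / 4 ^+ i.+1 +
      eta / 4 ^+ i.+1 by rewrite exprS; field; rewrite expf_neq0.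
  rewrite !mul0r ?mul1r !addr0 in h1 h2 h3.
  rewrite !mul1r in h2 h3 h4.
  rewrite -!addrA -!half in h2 h3 h4; rewrite ?addrA in h2 h3 h4.
  apply: le_trans (normcD _ _) _; apply: lerD; last exact: h4.
  apply: le_trans (normcD _ _) _; apply: lerD; last exact: h3.
  apply: le_trans (normcD _ _) _; apply: lerD; last exact: h2.
  exact: h1.
have [F HF] : exists F : nat -> R * R -> R * R, forall i x, Bad i x -> Bad i.+1 (F i x) /\
    (x.1 <= (F i x).1 /\ (F i x).1 + l / sz i.+1 <= x.1 + l / sz i) /\
    (x.2 <= (F i x).2 /\ (F i x).2 + m / sz i.+1 <= x.2 + m / sz i).
  have /choice[F HF] (ix : nat * (R * R)) : exists y, Bad ix.1 ix.2 -> Bad ix.1.+1 y /\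
    (ix.2.1 <= y.1 /\ y.1 + l / sz ix.1.+1 <= ix.2.1 + l / sz ix.1) /\
    (ix.2.2 <= y.2 /\ y.2 + m / sz ix.1.+1 <= ix.2.2 + m / sz ix.1).
    have [/step[y hy]|nb] := pselect (Bad ix.1 ix.2); first by exists y.
    by exists ix.2 => /nb.
  by exists (fun i x => F (i, x)) => i x; exact: (HF (i, x)).
pose X := fix X i := if i is j.+1 then F j (X j) else (a, c).
have XB i : Bad i (X i).
  elim: i => [|i ih]; last exact: (HF i (X i) ih).1.
  by rewrite /Bad /X /sz /= !expr0 !divr1.
have [s Hs] : exists s, forall i, (X i).1 <= s <= (X i).1 + l / 2 ^+ i.
  by apply: dyadic_nested => // i; exact: (HF i (X i) (XB i)).2.1.
have [t Ht] : exists t, forall i, (X i).2 <= t <= (X i).2 + m / 2 ^+ i.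
  by apply: dyadic_nested => // i; exact: (HF i (X i) (XB i)).2.2.
have X1 i : a <= (X i).1 /\ (X i).1 + l / sz i <= a + l.
  elim: i => [|i [ih1 ih2]]; first by rewrite /sz expr0 divr1.
  have [h1 h2] := (HF i (X i) (XB i)).2.1.
  by split; [exact: le_trans ih1 h1|exact: le_trans h2 ih2].
have X2 i : c <= (X i).2 /\ (X i).2 + m / sz i <= c + m.
  elim: i => [|i [ih1 ih2]]; first by rewrite /sz expr0 divr1.
  have [h1 h2] := (HF i (X i) (XB i)).2.2.
  by split; [exact: le_trans ih1 h1|exact: le_trans h2 ih2].
have in1 i x : (X i).1 <= x <= (X i).1 + l / sz i -> a <= x <= a + l.
  move=> /andP[h1 h2]; have [k1 k2] := X1 i.
  by rewrite (le_trans k1)// (le_trans h2).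
have in2 i x : (X i).2 <= x <= (X i).2 + m / sz i -> c <= x <= c + m.
  move=> /andP[h1 h2]; have [k1 k2] := X2 i.
  by rewrite (le_trans k1)// (le_trans h2).
have [D hD] := hd s t (in1 _ _ (Hs 0%N)) (in2 _ _ (Ht 0%N)).
(* [M - 1] is the factor given by [rect_sum_local] on the whole rectangle; on a quarter of
   generation [i] it shrinks by [4 ^+ i], exactly as the bound to be contradicted. The 1 keeps [M]
   positive in [e]. *)
pose M := 4 * (K * (l + m)) ^+ 2 + 1.
have M0 : 0 < M by rewrite ltr_wpDl// mulr_ge0// sqr_ge0.
pose e := eta / (2 * M).
have e0 : 0 < e by rewrite divr_gt0// mulr_gt0.
have [d0 d00 Hd] := hD e e0.
have [N1 HN1] := expr2_small (K * (l + m)) (divr_gt0 d00 (ltr0Sn _ 1)).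
have [N2 HN2] := expr2_small (normc D) e0.
apply: (XB N1); exists N2 => n nN2.
have szi : ((X N1).1 + l / sz N1 - (X N1).1 + ((X N1).2 + m / sz N1 - (X N1).2)) =
   (l + m) / sz N1 by ring.
apply: le_trans (@rect_sum_local h p D K e d0 _ _ _ _ s t K0 (ltW e0)
  (Hs N1) (Ht N1) _ Hd _ n) _.
- move=> x y x' y' hx hy hx' hy'.
  by apply: lip; [exact: in1 hx|exact: in2 hy|exact: in1 hx'|exact: in2 hy'].
- rewrite szi mulrA; apply: le_lt_trans (HN1 N1 (leqnn _)) _.
  by rewrite ltr_pdivrMr// ltr_pMr// ltr1n.
rewrite szi.
have -> : 4 * (K * ((l + m) / sz N1)) ^+ 2 * (normc D / 2 ^+ n + e) =
    (M - 1) * (normc D / 2 ^+ n + e) / 4 ^+ N1.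
  have -> : (4 : R) ^+ N1 = sz N1 ^+ 2.
    by rewrite /sz -exprM mulnC exprM; congr (_ ^+ _); rewrite -natrX.
  by rewrite /M; field; rewrite gt_eqF//= gt_eqF// exprn_gt0.
rewrite ler_wpM2r// ?invr_ge0 ?exprn_ge0//.
apply: (@le_trans _ _ (M * (e + e))).
  apply: ler_pM.
  - by rewrite /M addrK mulr_ge0// sqr_ge0.
  - by rewrite addr_ge0 ?(ltW e0)// divr_ge0 ?normc_ge0// exprn_ge0.
  - by rewrite gerBl.
  - by rewrite lerD2r; exact: HN2.
rewrite le_eqVlt; apply/orP; left; apply/eqP.
by rewrite /e; field; rewrite gt_eqF.
Qed.

End Goursat.

(** * Cauchy's formula as a limit of means over roots of unity *)

Section CauchyFormula.
Variable R : realType.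
Local Notation C := (R[i]).

Definition clim (u : nat -> C) (l : C) := forall e : R, 0 < e ->
  exists N, forall n, (N <= n)%N -> normc (u n - l) <= e.

Lemma exprn2_small (x e : R) : 0 <= x < 1 -> 0 < e ->
  exists N, forall n, (N <= n)%N -> x ^+ (2 ^ n) <= e.
Proof.
move=> /andP[x0 x1] e0.
have xn : `|x| < 1 by rewrite ger0_norm.
have /cvgrPdist_le/(_ e e0)[N _ HN] := cvg_expr xn.
exists N => n Nn; have := HN (2 ^ n)%N.
rewrite /= sub0r normrN ger0_norm ?exprn_ge0//; apply.
by apply: (leq_trans Nn); exact/ltnW/ltn_expl.
Qed.

Lemma disk_convex (r : R) (w z : C) (l : R) : 0 <= l <= 1 -> normc w <= r ->
  normc z <= r -> normc (w + l%:C * (z - w)) <= r.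
Proof.
move=> /andP[l0 l1] wr zr.
have -> : w + l%:C * (z - w) = (1 - l)%:C * w + l%:C * z by rewrite rmorphB rmorph1; ring.
apply: le_trans (normcD _ _) _; rewrite !normcM !normc_real !ger0_norm ?subr_ge0//.
have -> : r = (1 - l) * r + l * r by ring.
by rewrite lerD// ler_wpM2l// subr_ge0.
Qed.

Section CauchyProof.
Variables (f : C -> C) (rho : R) (x : C).
Hypotheses (af : analytic f) (rho0 : 0 < rho) (rho1 : rho < 1) (x1 : normc x < 1).
Let w0 := rho%:C * x.
Let h (z : C) := f z * (z - w0)^-1.
(** A homotopy contracting the circle of radius [rho] to the point [w0]; Goursat's theorem is
    applied on the parameters [[l, 1]] and [[0, 1]], where the pole of [h] is avoided. *)
Let p (l t : R) := w0 + l%:C * (rho%:C * cis t - w0).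

Let nw0 : normc w0 <= rho.
Proof. by rewrite normcM normc_real gtr0_norm// ler_piMr// ltW. Qed.

Let ncis t : normc (rho%:C * cis t) = rho.
Proof. by rewrite normcM normc_cis mulr1 normc_real gtr0_norm. Qed.

Let circ_neq t : rho%:C * cis t - w0 != 0.
Proof.
rewrite /w0 -mulrBr mulf_neq0//; first by rewrite -normc_gt0 normc_real gtr0_norm.
rewrite subr_eq0; apply/eqP => xE; move: x1; rewrite -xE normc_cis.
by rewrite ltxx.
Qed.

Let p_disk l t : 0 <= l <= 1 -> disk (p l t).
Proof. by move=> l01; apply: le_lt_trans rho1; apply: disk_convex => //; rewrite ncis. Qed.

Let p_lip l t l' t' : 0 <= l' <= 1 ->
  normc (p l' t' - p l t) <= (2 + 4 * pi) * (`|l' - l| + `|t' - t|).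
Proof.
move=> /andP[l0 l1].
have -> : p l' t' - p l t =
    (l' - l)%:C * (rho%:C * cis t - w0) + l'%:C * (rho%:C * (cis t' - cis t)).
  by rewrite /p rmorphB; ring.
have pi0 : 0 <= pi :> R by exact: pi_ge0.
apply: le_trans (normcD _ _) _; rewrite !normcM !normc_real.
rewrite mulrDr; apply: lerD.
  rewrite mulrC ler_wpM2r//; apply: le_trans (normcB _ _) _; rewrite ncis.
  by have := nw0; have := rho1; lra.
apply: (@le_trans _ _ (1 * (1 * (4 * pi * `|t' - t|)))).
  apply: ler_pM => //; first by rewrite mulr_ge0 ?normc_ge0.
    by rewrite ger0_norm.
  by apply: ler_pM => //; [exact: normc_ge0|rewrite gtr0_norm// ltW|exact: cis_lipschitz].
by rewrite !mul1r ler_wpM2r// lerDr.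
Qed.

Let mean_at n (l : R) :=
  cmean n (fun z => f (w0 + l%:C * (rho%:C * z - w0)) * (1 / (1 - conjc z * x))).

(** The increment of the curve and the denominator [z - w0] both carry the factor [l rho]. After it
    cancels, [z / (z - x)] is [1 / (1 - conjc z * x)] on the unit circle. *)
Let path_circle n l : 0 < l -> path_sum n (cauchy_form h) (p l) 0 1 =
  (2 ^+ n)%:C * (root2 R n 1 - 1) * mean_at n l.
Proof.
move=> l0; rewrite /path_sum /mean_at /cmean [RHS]mulrAC mulrA -rmorphM.
rewrite divff ?expf_neq0// rmorph1 mul1r mulr_suml.
apply: eq_bigr => k _; rewrite subr0 !add0r !mul1r /cauchy_form /h /p.
have -> : cis (k.+1%:R / 2 ^+ n) = cis (k%:R / 2 ^+ n) * root2 R n 1.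
  by rewrite /root2 -cisD -mulrDl natr1.
rewrite -/(root2 R n k).
have := circ_neq (k%:R / 2 ^+ n); rewrite -/(root2 R n k).
set z := root2 R n k; set xi := root2 R n 1 => cn.
have z0 : z != 0 by exact: cis_neq0.
have zx : z - x != 0 by move: cn; rewrite /w0 -mulrBr mulf_eq0 negb_or => /andP[].
have l0' : l%:C != 0 by rewrite -normc_gt0 normc_real gtr0_norm.
have r0' : rho%:C != 0 by rewrite -normc_gt0 normc_real gtr0_norm.
have -> : conjc z = z^-1 by exact: cis_conj.
rewrite /w0; field.
by rewrite z0 zx addrAC subrr add0r -mulrBr !mulf_neq0.
Qed.

(** The sides [t = 0] and [t = 1] of the curved rectangle coincide and cancel, which leaves the two
    closed curves. Their common factor [2 ^+ n * (root2 n 1 - 1)] is bounded below through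
    [root2_separated], so it can be divided out. *)
Let mean_at_diff l : 0 < l <= 1 -> clim (fun n => mean_at n 1 - mean_at n l) 0.
Proof.
move=> /andP[l0 l1] e e0.
have lipp : forall s y s' y', l <= s <= l + (1 - l) -> 0 <= y <= 0 + 1 ->
    l <= s' <= l + (1 - l) -> 0 <= y' <= 0 + 1 ->
    normc (p s' y' - p s y) <= (2 + 4 * pi) * (`|s' - s| + `|y' - y|).
  move=> s y s' y' _ _ /andP[s0 s1] _; apply: p_lip.
  by rewrite (le_trans (ltW l0) s0); move: s1; rewrite addrC subrK.
have hder : forall s y, l <= s <= l + (1 - l) -> 0 <= y <= 0 + 1 ->
    exists D, cderiv h (p s y) D.
  move=> s y /andP[s0]; rewrite addrC subrK => s1 _.
  have sp : 0 < s by exact: lt_le_trans s0.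
  exists (derive1 h (p s y)); apply: cderivP.
  apply: (@derivableM _ _ f (fun z => (z - w0)^-1)).
    by apply/af/p_disk; rewrite (ltW sp).
  apply: (@derivableV _ _ (fun z => z - w0)).
    rewrite /p addrC addKr mulf_neq0//.
    by rewrite -normc_gt0 normc_real gtr0_norm.
  by apply: derivableB; [exact: derivable_id|exact: derivable_cst].
have pi0 : 0 <= pi :> R by exact: pi_ge0.
have K0 : 0 <= 2 + 4 * pi :> R by lra.
have l1' : 0 <= 1 - l by rewrite subr_ge0.
have [n0 H] := goursat K0 l1' ler01 lipp hder e0.
exists n0.+1 => -[//|n]; rewrite ltnS => nn; rewrite subr0.
have := H n.+1 (leqW nn); rewrite /rect_sum add0r [l + _]addrC subrK.
have -> : (fun x0 => p x0 1) = p^~ 0.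
  by apply/funext => s; rewrite /p cis0 cis1.
rewrite subrK !path_circle// -mulrBr normcM normcM normc_real.
rewrite ger0_norm ?exprn_ge0//; apply: le_trans.
rewrite ler_peMl ?normc_ge0//.
have m1 : (0 < 1 < 2 ^ n.+1)%N by rewrite /= -{1}(expn0 2) ltn_exp2l.
have := @root2_separated R n.+1 1 m1; rewrite ler_pdivrMr ?exprn_gt0// mulrC.
by apply: le_trans; rewrite ler1n.
Qed.

Let mean_at_near e : 0 < e -> exists2 l : R, 0 < l <= 1 & forall n,
  normc (mean_at n l - f w0 * cmean n (fun z => 1 / (1 - conjc z * x))) <= e.
Proof.
move=> e0; have d0 : disk w0 by exact: le_lt_trans rho1.
have x1' : 0 < 1 - normc x by rewrite subr_gt0.
have [d dp Hd] := cderiv_cont (analytic_cderiv af d0) (mulr_gt0 e0 x1').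
pose l := Num.min 1 (d / 4).
have l0 : 0 < l by rewrite lt_min ltr01 divr_gt0.
have l1 : l <= 1 by rewrite ge_min lexx.
have ld : l * 4 <= d by rewrite -ler_pdivlMr// ge_min lexx orbT.
exists l; first by rewrite l0.
move=> n; rewrite /mean_at -cmeanZ -cmeanB; apply: le_trans (normc_cmean _ _) _.
apply: le_trans (rmean_le _ (G := fun=> e) _) _; last by rewrite rmean_cst.
move=> z z1; rewrite -mulrBl normcM normc_div1.
have zx : normc (conjc z * x) = normc x by rewrite normcM normcJE z1 mul1r.
rewrite ler_pdivrMr ?normc_sub1_gt0 ?zx//.
apply: (@le_trans _ _ (e * (1 - normc x))); last first.
  by rewrite ler_pM2l// -zx normc_sub1_ge.
apply: Hd; rewrite normcM normc_real gtr0_norm//.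
apply: lt_le_trans ld; rewrite ltr_pM2l//.
apply: le_lt_trans (normcB _ _) _; rewrite normcM z1 normc_real gtr0_norm//.
by have := nw0; have := rho1; lra.
Qed.

(** Three errors: contracting the circle (Goursat), replacing [f] by [f w0] on the small curve
    (continuity), and the deviation of the mean of the Cauchy kernel from 1, of order
    [x ^+ (2 ^ n)]. *)
Lemma cauchy_formula :
  clim (fun n => cmean n (fun z => f (rho%:C * z) * (1 / (1 - conjc z * x)))) (f w0).
Proof.
move=> e e0; have e3 : 0 < e / 3 by rewrite divr_gt0.
have [l l01 Hl] := mean_at_near e3; have [N1 H1] := mean_at_diff l01 e3.
have x1' : 0 < 1 - normc x by rewrite subr_gt0.
have fw0 : 0 < normc (f w0) + 1 by rewrite ltr_wpDl ?normc_ge0.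
have e4 : 0 < e / 3 * (1 - normc x) / (normc (f w0) + 1) by rewrite divr_gt0 ?mulr_gt0.
have [N2 H2] := @exprn2_small (normc x) _ (introT andP (conj (normc_ge0 x) x1)) e4.
exists (maxn N1 N2) => n; rewrite geq_max => /andP[/H1 h1 /H2 h2].
have -> : cmean n (fun z => f (rho%:C * z) * (1 / (1 - conjc z * x))) = mean_at n 1.
  by apply: eq_cmean => z _; rewrite rmorph1 (mul1r (_ - w0)) (addrC w0) subrK.
rewrite subr0 in h1; have := Hl n; rewrite cmean_cauchy_kernel// => h3.
have -> : mean_at n 1 - f w0 = (mean_at n 1 - mean_at n l) +
  (mean_at n l - f w0 * (1 / (1 - x ^+ (2 ^ n)))) +
  f w0 * (1 / (1 - x ^+ (2 ^ n)) - 1) by ring.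
have -> : e = e / 3 + e / 3 + e / 3 by field.
apply: le_trans (normcD _ _) _; apply: lerD.
  by apply: le_trans (normcD _ _) _; apply: lerD.
have xn : normc (x ^+ (2 ^ n)) <= normc x.
  by rewrite normcX ler_iXnr ?expn_gt0 ?normc_ge0// ltW.
have dn : 1 - x ^+ (2 ^ n) != 0 by rewrite sub1_neq0// (le_lt_trans xn).
have -> : 1 / (1 - x ^+ (2 ^ n)) - 1 = x ^+ (2 ^ n) / (1 - x ^+ (2 ^ n)) by field.
rewrite normcM normcM normcV normcX.
rewrite mulrA ler_pdivrMr ?normc_gt0//.
apply: (@le_trans _ _ (e / 3 * (1 - normc x))); last first.
  rewrite ler_pM2l//; apply: le_trans (normc_sub1_ge _); rewrite lerD2l lerN2.
  exact: xn.
rewrite ler_pdivlMr// in h2; apply: le_trans h2.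
by rewrite mulrC ler_wpM2l ?exprn_ge0 ?normc_ge0// lerDl.
Qed.

End CauchyProof.
End CauchyFormula.

(** * Cauchy estimates and continuity of the derivative *)

Section CauchyEstimates.
Variable R : realType.
Local Notation C := (R[i]).

Lemma climB (u v : nat -> C) l m : clim u l -> clim v m -> clim (fun n => u n - v n) (l - m).
Proof.
move=> ul vm e e0; have e2 : 0 < e / 2 by rewrite divr_gt0.
have [N1 H1] := ul _ e2; have [N2 H2] := vm _ e2.
exists (maxn N1 N2) => n; rewrite geq_max => /andP[/H1 h1 /H2 h2].
rewrite (_ : u n - v n - (l - m) = (u n - l) - (v n - m)); last by ring.
by apply: le_trans (normcB _ _) _; rewrite [e]splitr lerD.
Qed.

Lemma climD (u v : nat -> C) l m : clim u l -> clim v m -> clim (fun n => u n + v n) (l + m).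
Proof.
move=> ul vm e e0; have e2 : 0 < e / 2 by rewrite divr_gt0.
have [N1 H1] := ul _ e2; have [N2 H2] := vm _ e2.
exists (maxn N1 N2) => n; rewrite geq_max => /andP[/H1 h1 /H2 h2].
rewrite (_ : u n + v n - (l + m) = (u n - l) + (v n - m)); last by ring.
by apply: le_trans (normcD _ _) _; rewrite [e]splitr lerD.
Qed.

Lemma climZ (u : nat -> C) l a : clim u l -> clim (fun n => a * u n) (a * l).
Proof.
move=> ul e e0; have a1 : 0 < normc a + 1 by rewrite ltr_wpDl ?normc_ge0.
have [N H] := ul _ (divr_gt0 e0 a1); exists N => n /H; rewrite -mulrBr normcM.
rewrite ler_pdivlMr// mulrC; apply: le_trans.
by rewrite ler_wpM2r ?normc_ge0// lerDl.
Qed.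

Lemma clim_cst (a : C) : clim (fun=> a) a.
Proof. by move=> e e0; exists 0%N => n _; rewrite subrr normc0 ltW. Qed.

Lemma clim_sum (I : Type) (s : seq I) (u : I -> nat -> C) (l : I -> C) :
  (forall i, clim (u i) (l i)) -> clim (fun n => \sum_(i <- s) u i n) (\sum_(i <- s) l i).
Proof.
move=> ul; elim: s => [|i s ih].
  rewrite big_nil (_ : (fun n => _) = fun=> 0); first exact: clim_cst.
  by apply/funext => n; rewrite big_nil.
rewrite big_cons (_ : (fun n => _) = fun n => u i n + \sum_(k <- s) u k n).
  exact: climD.
by apply/funext => n; rewrite big_cons.
Qed.

Lemma eq_clim (u v : nat -> C) l : u =1 v -> clim v l -> clim u l.
Proof. by move=> /funext ->. Qed.

Lemma clim_le (u : nat -> C) l c : clim u l ->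
  (exists N, forall n, (N <= n)%N -> normc (u n) <= c) -> normc l <= c.
Proof.
move=> ul [N H]; apply/ler_addgt0Pr => e e0; have [M HM] := ul _ e0.
have h1 := HM _ (leq_maxr N M); have h2 := H _ (leq_maxl N M).
rewrite -(subrK (u (maxn N M)) l); apply: le_trans (normcD _ _) _.
by rewrite addrC lerD// normc_distC.
Qed.

Lemma cderiv_le (f : C -> C) z D (K d : R) : 0 < d -> cderiv f z D ->
  (forall h, normc h < d -> normc (f (z + h) - f z) <= K * normc h) -> normc D <= K.
Proof.
move=> d0 hf H; apply/ler_addgt0Pr => e e0; have [d' d'0 Hd] := hf _ e0.
pose m := Num.min d d' / 2.
have m0 : 0 < m by rewrite divr_gt0// lt_min d0.
have [md md'] : m < d /\ m < d'.
  have : Num.min d d' <= d by rewrite ge_min lexx.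
  have : Num.min d d' <= d' by rewrite ge_min lexx orbT.
  by rewrite /m; move: m0; rewrite /m; split; lra.
have nm : normc m%:C = m by rewrite normc_real gtr0_norm.
have h1 : normc (f (z + m%:C) - f z) <= K * m by rewrite -{2}nm H ?nm.
have h2 : normc (f (z + m%:C) - f z - m%:C * D) <= e * m by rewrite -{3}nm Hd ?nm.
rewrite -(ler_pM2l m0) -{1}nm -normcM.
rewrite (_ : m%:C * D = (f (z + m%:C) - f z) - (f (z + m%:C) - f z - m%:C * D)); last by ring.
apply: le_trans (normcB _ _) _; apply: le_trans (lerD h1 h2) _.
by rewrite -mulrDl mulrC.
Qed.

Lemma analytic_bounded (f : C -> C) (r : R) : analytic f -> r < 1 ->
  exists2 K, 0 <= K & forall z, normc z <= r -> normc (f z) <= K.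
Proof.
move=> af r1; have w1 : radial_weight (fun=> 1 : R).
  by split => [z _|z _|z _|z w _ _ _] //; exact: cst_continuous.
have [M HM] := closed_disk_bounded w1 af r1.
exists (Num.max 0 M); first by rewrite le_max lexx.
by move=> z /HM; rewrite mul1r le_max => ->; rewrite orbT.
Qed.

Lemma kernel_ge (z x : C) r : normc z = 1 -> normc x <= r -> 1 - r <= normc (1 - conjc z * x).
Proof.
move=> z1 xr; apply: le_trans (normc_sub1_ge _).
by rewrite lerD2l lerN2 normcM normcJE z1 mul1r.
Qed.

(** The difference of the Cauchy kernels at [x] and [y] is [x - y] times a product of two kernels.
    The inequality between geometric and arithmetic means splits the product into two squares, whose
    means are Poisson means; this gives one power of [1 / (1 - r)] where a pointwise bound would
    give two. *)
Lemma lipschitz_of_circle (f : C -> C) (rho K r : R) x y : analytic f ->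
  0 < rho < 1 -> 0 <= K -> (forall z, normc z = 1 -> normc (f (rho%:C * z)) <= K) ->
  r < 1 -> normc x <= r -> normc y <= r ->
  normc (f (rho%:C * x) - f (rho%:C * y)) <= 4 * K / (1 - r) * normc (x - y).
Proof.
move=> af /andP[rho0 rho1] K0 fK r1 xr yr.
have x1 := le_lt_trans xr r1; have y1 := le_lt_trans yr r1.
have r0 : 0 <= r by exact: le_trans (normc_ge0 _) xr.
apply: (clim_le (climB (cauchy_formula af rho0 rho1 x1) (cauchy_formula af rho0 rho1 y1))).
have h2 : 0 < 1 / 2 :> R by [].
have [N HN] := @exprn2_small _ r (1 / 2) (introT andP (conj r0 r1)) h2.
exists N => n nN; rewrite -cmeanB; apply: le_trans (normc_cmean _ _) _.
have r1' : 0 < 1 - r by rewrite subr_gt0.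
have P w : normc w <= r ->
    rmean n (fun z => (normc (1 - conjc z * w) ^+ 2)^-1) <= 4 / (1 - r).
  move=> wr; apply: le_trans (rmean_poisson _ (le_lt_trans wr r1)) _.
  have wn : normc w ^+ (2 ^ n) <= 1 / 2.
    by apply: le_trans (HN n nN); rewrite lerXn2r ?nnegrE ?normc_ge0.
  have w2 : normc w ^+ 2 <= r.
    apply: (@le_trans _ _ (normc w)) => //.
    by rewrite expr2 ler_piMl ?normc_ge0// (le_trans wr)// ltW.
  have g1 : 0 < (1 - r) * (1 / 2) by rewrite mulr_gt0.
  rewrite (_ : 4 / (1 - r) = 2 / ((1 - r) * (1 / 2))); last by field; rewrite gt_eqF.
  rewrite ler_wpM2l// lef_pV2 ?posrE//.
    apply: ler_pM => //; [by rewrite ltW|by move: w2; lra|by move: wn; lra].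
  by rewrite mulr_gt0//; move: w2 wn; lra.
pose k := fun w z : C => (normc (1 - conjc z * w) ^+ 2)^-1.
apply: (@le_trans _ _ (rmean n (fun z => K * normc (x - y) / 2 * (k x z + k y z)))).
  apply: rmean_le => z z1.
  have X0 : 0 < normc (1 - conjc z * x) by apply: lt_le_trans (kernel_ge z1 xr).
  have Y0 : 0 < normc (1 - conjc z * y) by apply: lt_le_trans (kernel_ge z1 yr).
  have -> : f (rho%:C * z) * (1 / (1 - conjc z * x)) - f (rho%:C * z) * (1 / (1 - conjc z * y)) =
     f (rho%:C * z) * (conjc z * (x - y) * ((1 - conjc z * x)^-1 * (1 - conjc z * y)^-1)).
    by field; rewrite -!normc_gt0 X0 Y0.
  rewrite !normcM normcJE z1 mul1r !normcV /k -mulrA -mulrA; apply: ler_pM => //.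
  - exact: normc_ge0.
  - by rewrite !mulr_ge0 ?normc_ge0// invr_ge0 normc_ge0.
  - exact: fK.
  rewrite ler_wpM2l ?normc_ge0// -!exprVn.
  set a := _^-1; set b := _^-1.
  by have := sqr_ge0 (a - b); rewrite sqrrB; lra.
rewrite rmeanZ rmeanD; have := P x xr; have := P y yr; rewrite -/(k x) -/(k y).
set A := rmean n (k x); set B := rmean n (k y) => hB hA.
apply: (@le_trans _ _ (K * normc (x - y) / 2 * (4 / (1 - r) + 4 / (1 - r)))).
  by rewrite ler_wpM2l ?lerD// divr_ge0// mulr_ge0 ?normc_ge0.
by rewrite le_eqVlt; apply/orP; left; apply/eqP; field; rewrite gt_eqF.
Qed.

(** Both sides are compared with the difference quotient for one fixed step [h]: [f] by
    differentiability, the means by the second order remainder of the Cauchy kernel, which is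
    uniform in [n]. *)
Lemma cauchy_derivative (f : C -> C) (rho : R) x : analytic f ->
  0 < rho < 1 -> normc x < 1 ->
  clim (fun n => cmean n (fun z => f (rho%:C * z) * (conjc z / (1 - conjc z * x) ^+ 2)))
    (rho%:C * derive1 f (rho%:C * x)).
Proof.
move=> af /andP[rho0 rho1] x1 e e0.
have [K K0 HK] := analytic_bounded af rho1.
pose r := (1 + normc x) / 2.
have [r1 xr] : r < 1 /\ normc x <= r by rewrite /r; split; lra.
have r1' : 0 < 1 - r by rewrite subr_gt0.
have wd : disk (rho%:C * x).
  rewrite /disk /= normcM normc_real gtr0_norm// mulr_ilt1 ?normc_ge0// ltW//.
have [d d0 Hd] := analytic_cderiv af wd (divr_gt0 e0 (ltr0Sn R 2)).
have M0 : 0 < K / (1 - r) ^+ 3 + 1 by rewrite ltr_wpDl// divr_ge0// exprn_ge0// ltW.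
(* The three bounds serve the remainder of [f], keep [x + h] within radius [r], and make the kernel
   remainder [h * K / (1 - r) ^+ 3] at most [e / 3]. *)
pose h := Num.min (Num.min (d / 2) (r - normc x)) (e / (3 * (K / (1 - r) ^+ 3 + 1))).
have h0 : 0 < h.
  rewrite !lt_min !divr_gt0 ?mulr_gt0//= andbT /r; lra.
have hd : h <= d / 2 by rewrite /h !ge_min lexx.
have hr : h <= r - normc x by rewrite /h !ge_min lexx orbT.
have he : h * (K / (1 - r) ^+ 3) <= e / 3.
  have : h <= e / (3 * (K / (1 - r) ^+ 3 + 1)) by rewrite /h !ge_min lexx orbT.
  rewrite invfM mulrA ler_pdivlMr// mulrDr mulr1; apply: le_trans.
  by rewrite lerDl ltW.
have nh : normc h%:C = h by rewrite normc_real gtr0_norm.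
have xhr : normc (x + h%:C) <= r.
  by apply: le_trans (normcD _ _) _; rewrite nh; lra.
have xh1 := le_lt_trans xhr r1.
have [N HN] := climB (cauchy_formula af rho0 rho1 xh1) (cauchy_formula af rho0 rho1 x1)
  (mulr_gt0 h0 (divr_gt0 e0 (ltr0Sn R 2))).
exists N => n nN; have := HN n nN; set m1 := cmean n _; set m0 := cmean n _ => hm.
set m' := cmean n _.
have hE : normc (m1 - m0 - h%:C * m') <= h * (e / 3).
  rewrite /m1 /m0 /m' -cmeanB -cmeanZ -cmeanB; apply: le_trans (normc_cmean _ _) _.
  apply: le_trans (rmean_le _ (G := fun=> h * (e / 3)) _) _; last by rewrite rmean_cst.
  move=> z z1.
  have X0 := lt_le_trans r1' (kernel_ge z1 xr).
  have Y0 := lt_le_trans r1' (kernel_ge z1 xhr).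
  have -> : f (rho%:C * z) * (1 / (1 - conjc z * (x + h%:C))) -
      f (rho%:C * z) * (1 / (1 - conjc z * x)) -
      h%:C * (f (rho%:C * z) * (conjc z / (1 - conjc z * x) ^+ 2)) =
      f (rho%:C * z) * (h%:C ^+ 2 * conjc z ^+ 2) /
        ((1 - conjc z * x) ^+ 2 * (1 - conjc z * (x + h%:C))).
    by field; rewrite -!normc_gt0 X0 Y0.
  rewrite normcM (normcM (f _)) (normcM (_ ^+ 2)) normcV (normcM (_ ^+ 2)) !normcX normcJE z1 expr1n mulr1 nh.
  apply: (@le_trans _ _ (K * h ^+ 2 / (1 - r) ^+ 3)).
    apply: ler_pM.
    - by rewrite mulr_ge0 ?normc_ge0 ?sqr_ge0.
    - by rewrite invr_ge0 mulr_ge0 ?exprn_ge0 ?normc_ge0.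
    - rewrite ler_wpM2r ?sqr_ge0//; apply: HK.
      by rewrite normcM z1 mulr1 normc_real gtr0_norm.
    rewrite lef_pV2 ?posrE ?mulr_gt0 ?exprn_gt0// exprSr.
    apply: ler_pM => //; [by rewrite exprn_ge0// ltW|exact: ltW| |exact: kernel_ge].
    by rewrite lerXn2r ?nnegrE ?normc_ge0 ?(ltW r1')//; exact: kernel_ge.
  rewrite (_ : K * h ^+ 2 / _ = h * (h * (K / (1 - r) ^+ 3))); last first.
    by field; rewrite gt_eqF.
  by rewrite ler_wpM2l// ltW.
have nrh : normc (rho%:C * h%:C) <= h.
  by rewrite normcM nh normc_real gtr0_norm// ler_piMl// ltW.
have hD := Hd (rho%:C * h%:C); rewrite -mulrDr in hD.
have {}hD : normc (f (rho%:C * (x + h%:C)) - f (rho%:C * x) - rho%:C * h%:C * derive1 f (rho%:C * x))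
    <= h * (e / 3).
  apply: le_trans (hD _) _; first by apply: le_lt_trans nrh _; lra.
  by rewrite mulrC ler_wpM2r// ltW// divr_gt0.
set D := derive1 f _ in hD *.
rewrite -(ler_pM2l h0) -{1}nh -normcM.
have -> : h%:C * (m' - rho%:C * D) = (m1 - m0 - (f (rho%:C * (x + h%:C)) - f (rho%:C * x)))
  - (m1 - m0 - h%:C * m')
  + (f (rho%:C * (x + h%:C)) - f (rho%:C * x) - rho%:C * h%:C * D) by ring.
rewrite (_ : h * e = h * (e / 3) + h * (e / 3) + h * (e / 3)); last by field.
apply: le_trans (normcD _ _) _; apply: lerD => //.
by apply: le_trans (normcB _ _) _; apply: lerD.
Qed.

(** On a circle of radius larger than [normc w], the kernel of the formula for the derivative is
    Lipschitz in the point, and a bound valid for all the means passes to the limit. *)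
Lemma derive1_continuous (f : C -> C) w : analytic f -> disk w -> forall e : R, 0 < e ->
  exists2 d, 0 < d & forall h, normc h < d ->
    normc (derive1 f (w + h) - derive1 f w) <= e.
Proof.
move=> af dw e e0.
pose rho := (1 + normc w) / 2; have w1 : normc w < 1 by [].
have w0 := normc_ge0 w.
have [rho0 rho1 wr] : [/\ 0 < rho, rho < 1 & normc w < rho] by rewrite /rho; split; lra.
have rhoC : rho%:C != 0 by rewrite -normc_gt0 normc_real gtr0_norm.
have [K K0 HK] := analytic_bounded af rho1.
pose x := w / rho%:C.
have nx : normc x = normc w / rho by rewrite normcM normcV normc_real gtr0_norm.
have x1 : normc x < 1 by rewrite nx ltr_pdivrMr// mul1r.
pose r := (1 + normc x) / 2.
have [r1 xr] : r < 1 /\ normc x < r by rewrite /r; split; lra.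
have r1' : 0 < 1 - r by rewrite subr_gt0.
have M0 : 0 < 2 * K / (1 - r) ^+ 3 + 1.
  by rewrite ltr_wpDl// divr_ge0//; [rewrite mulr_ge0|rewrite exprn_ge0// ltW].
pose M := 2 * K / (1 - r) ^+ 3 + 1.
have rx0 : 0 < r - normc x by rewrite subr_gt0.
exists (Num.min (rho * (r - normc x)) (rho ^+ 2 * e / M)).
  rewrite lt_min mulr_gt0//= divr_gt0//.
  by rewrite mulr_gt0// exprn_gt0.
move=> h; rewrite lt_min => /andP[hr he].
pose y := x + h / rho%:C.
have nhr : normc (h / rho%:C) = normc h / rho by rewrite normcM normcV normc_real gtr0_norm.
have yr : normc y <= r.
  apply: le_trans (normcD _ _) _; rewrite nhr -lerBrDl ler_pdivrMr// mulrC; exact: ltW.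
have -> : w + h = rho%:C * y by rewrite /y /x; field.
rewrite (_ : derive1 f w = derive1 f (rho%:C * x)); last first.
  by congr derive1; rewrite /x; field.
have rr : 0 < rho < 1 by rewrite rho0.
have L := climB (cauchy_derivative af rr (le_lt_trans yr r1)) (cauchy_derivative af rr x1).
rewrite -(ler_pM2l rho0).
have -> : rho * normc (derive1 f (rho%:C * y) - derive1 f (rho%:C * x)) =
   normc (rho%:C * derive1 f (rho%:C * y) - rho%:C * derive1 f (rho%:C * x)).
  by rewrite -mulrBr normcM normc_real gtr0_norm.
apply: (clim_le L); exists 0%N => n _; rewrite -cmeanB; apply: le_trans (normc_cmean _ _) _.
apply: le_trans (rmean_le _ (G := fun=> rho * e) _) _; last by rewrite rmean_cst.
move=> z z1.
have X1 := kernel_ge z1 (ltW xr); have Y1 := kernel_ge z1 yr.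
have X0 := lt_le_trans r1' X1; have Y0 := lt_le_trans r1' Y1.
set X := 1 - conjc z * x in X0 X1 *; set Y := 1 - conjc z * y in Y0 Y1 *.
have XY : X - Y = conjc z * (h / rho%:C) by rewrite /X /Y /y; ring.
have -> : f (rho%:C * z) * (conjc z / Y ^+ 2) - f (rho%:C * z) * (conjc z / X ^+ 2) =
   f (rho%:C * z) * conjc z * (X - Y) * (Y^-1 * X^-2 + Y^-2 * X^-1).
  by field; rewrite -!normc_gt0 X0 Y0.
rewrite XY !normcM normcJE z1 mulr1 mul1r -normcM nhr.
have inv2 a b : 1 - r <= normc a -> 1 - r <= normc b ->
    normc (a^-1 * b^-2) <= ((1 - r) ^+ 3)^-1.
  move=> ha hb; have a0 := lt_le_trans r1' ha; have b0 := lt_le_trans r1' hb.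
  rewrite normcM !normcV normcX -invfM lef_pV2 ?posrE ?mulr_gt0 ?exprn_gt0// exprS.
  apply: ler_pM => //; [exact: ltW|by rewrite exprn_ge0// ltW|].
  by rewrite lerXn2r ?nnegrE ?normc_ge0// ltW.
have S3 : normc (Y^-1 * X^-2 + Y^-2 * X^-1) <= 2 * ((1 - r) ^+ 3)^-1.
  apply: le_trans (normcD _ _) _; rewrite [Y ^- 2 * _]mulrC mulrDl mul1r.
  by rewrite lerD// inv2.
apply: (@le_trans _ _ (K * (normc h / rho) * (2 * ((1 - r) ^+ 3)^-1))).
  apply: ler_pM => //; rewrite ?mulr_ge0 ?normc_ge0 ?invr_ge0 ?(ltW rho0)//.
  rewrite ler_wpM2r ?mulr_ge0 ?normc_ge0 ?invr_ge0 ?(ltW rho0)//.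
  by apply: HK; rewrite normcM z1 mulr1 normc_real gtr0_norm.
rewrite ltr_pdivlMr// in he.
have -> : K * (normc h / rho) * (2 * ((1 - r) ^+ 3)^-1) = normc h * (M - 1) / rho.
  by rewrite /M; field; rewrite !gt_eqF.
rewrite ler_pdivrMr// mulrAC -expr2; apply: le_trans (ltW he).
by rewrite ler_wpM2l ?normc_ge0// gerBl.
Qed.

End CauchyEstimates.

(** * Nodes in the disk and normal weights *)

Section Lattice.
Variable R : realType.
Local Notation C := (R[i]).

Definition dy j : R := (2 ^+ j)^-1.
(** The exponential makes squaring exact, [rad j.+1 ^+ 2 = rad j], so that the dilations of
    consecutive layers are squares of one another, while [1 - rad j] stays between [dy j / 4] and
    [dy j / 2]. *)
Definition rad j : R := expR (- (dy j / 2)).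
Definition node j k : C := (rad j)%:C * root2 R j k.

Lemma dy_gt0 j : 0 < dy j. Proof. by rewrite invr_gt0 exprn_gt0. Qed.
Lemma dy_le1 j : dy j <= 1. Proof. by rewrite invf_le1 ?exprn_gt0// exprn_ege1// ler1n. Qed.
Lemma dyS j : dy j.+1 = dy j / 2. Proof. by rewrite /dy exprS invfM mulrC. Qed.
Lemma dy_le i j : (i <= j)%N -> dy j <= dy i.
Proof. by move=> ij; rewrite lef_pV2 ?posrE ?exprn_gt0// ler_weXn2l ?ler1n. Qed.

Lemma rad_gt0 j : 0 < rad j. Proof. exact: expR_gt0. Qed.

Lemma rad_sub_le j : 1 - rad j <= dy j / 2.
Proof. by have := expR_ge1Dx (- (dy j / 2)); rewrite /rad; lra. Qed.

Lemma rad_sub_ge j : dy j / 4 <= 1 - rad j.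
Proof.
have d0 := dy_gt0 j; have d1 := dy_le1 j.
have h := expR_ge1Dx (dy j / 2).
have : rad j * (1 + dy j / 2) <= 1.
  rewrite -[leRHS](@divff _ (expR (dy j / 2))) ?gt_eqF ?expR_gt0//.
  by rewrite mulrC /rad expRN ler_wpM2r// invr_ge0 expR_ge0.
have := rad_gt0 j; set r := rad j; set d := dy j in d0 d1 *.
move=> r0 h1; have : r * d <= d by rewrite ler_piMl ?(ltW d0)//; nra.
nra.
Qed.

Lemma rad_lt1 j : rad j < 1.
Proof. by have := rad_sub_ge j; have := dy_gt0 j; lra. Qed.

Lemma rad_ge j : 1 / 2 <= rad j.
Proof. by have := rad_sub_le j; have := dy_le1 j; lra. Qed.

Lemma rad_sqr j : rad j.+1 ^+ 2 = rad j.
Proof. by rewrite /rad -expRM_natl dyS; congr expR; field. Qed.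

Lemma rad_le i j : (i <= j)%N -> rad i <= rad j.
Proof. by move=> ij; rewrite ler_expR lerN2 ler_pM2r// dy_le. Qed.

Lemma rad_gap i j : (i < j)%N -> dy i / 16 <= rad j - rad i.
Proof.
move=> ij; have := rad_le ij; have := rad_sub_ge i.+1; have := rad_ge i.+1.
have := dy_gt0 i; rewrite -(rad_sqr i) dyS; set r := rad i.+1; set s := rad j.
by move=> d0 r2 h rs; nra.
Qed.

(** The power is [exp (-1/2)]: on the circle of radius [rad j], means over [2 ^ j] roots already
    behave like integrals, with a Poisson correction bounded away from 0. *)
Lemma rad_pow j : rad j ^+ (2 ^ j) <= 2 / 3.
Proof.
rewrite /rad -expRM_natl natrX (_ : _ * _ = - (1 / 2)); last first.
  by rewrite /dy; field; rewrite expf_neq0.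
have h := expR_ge1Dx (1 / 2 : R); rewrite expRN.
have -> : 2 / 3 = (3 / 2)^-1 :> R by rewrite invf_div.
by rewrite lef_pV2 ?posrE ?expR_gt0//; lra.
Qed.

Lemma normc_node j k : normc (node j k) = rad j.
Proof. by rewrite normcM normc_root2 mulr1 normc_real gtr0_norm ?rad_gt0. Qed.

Lemma node_disk j k : disk (node j k).
Proof. by have := rad_lt1 j; rewrite -(normc_node j k). Qed.

Lemma conj_node j k : conjc (node j k) = (rad j)%:C * conjc (root2 R j k).
Proof. by rewrite conjcM conjcR. Qed.

Lemma node_kernel_ge j k w : disk w -> dy j / 4 <= normc (1 - conjc (node j k) * w).
Proof.
move=> dw; apply: le_trans (normc_sub1_ge _); apply: le_trans (rad_sub_ge j) _.
rewrite lerD2l lerN2 normcM normcJE normc_node ler_piMr ?(ltW (rad_gt0 _))//.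
exact: ltW.
Qed.

Lemma powR_le_base (x y p : R) : 0 <= p -> 0 <= x -> x <= y -> x `^ p <= y `^ p.
Proof. by move=> p0 x0 xy; rewrite ge0_ler_powR// nnegrE// (le_trans x0). Qed.

Lemma powR2 (x : R) : 0 <= x -> x `^ 2 = x ^+ 2.
Proof. by move=> x0; rewrite -[2]/(2%:R) powR_mulrn. Qed.

(** Of the exponent [p], the part [p - 2] is spent on the pointwise lower bound [eta] of the kernel
    denominator; the remaining square is a Poisson mean. *)
Lemma ring_sum j (p : R) w : 2 <= p -> disk w ->
  \sum_(k < 2 ^ j) (normc (1 - conjc (node j k) * w) `^ p)^-1 <=
  6 * 2 ^+ j / (1 - rad j * normc w) `^ (p - 1).
Proof.
move=> p2 dw; set eta := 1 - _.
have w1 : normc w < 1 by [].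
have r0 := rad_gt0 j; have r1 := rad_lt1 j; have w0 := normc_ge0 w.
have eta0 : 0 < eta by rewrite /eta; nra.
pose x := (rad j)%:C * w.
have nx : normc x = rad j * normc w by rewrite normcM normc_real gtr0_norm.
have x1 : normc x < 1 by rewrite nx; nra.
have xr : normc x <= rad j by rewrite nx; nra.
have kE k : conjc (node j k) * w = conjc (root2 R j k) * x.
  by rewrite conj_node /x; ring.
have pt k : (normc (1 - conjc (node j k) * w) `^ p)^-1 <=
    (eta `^ (p - 2))^-1 * (normc (1 - conjc (root2 R j k) * x) ^+ 2)^-1.
  have ge : eta <= normc (1 - conjc (root2 R j k) * x).
    by rewrite /eta -nx; apply: kernel_ge => //; exact: normc_root2.
  have kp := lt_le_trans eta0 ge.
  rewrite kE; move: ge kp; set y := normc _ => ge kp.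
  rewrite -invfM lef_pV2 ?posrE ?mulr_gt0 ?powR_gt0 ?exprn_gt0//.
  rewrite [leRHS](_ : _ = y `^ (p - 2) * y ^+ 2); last first.
    by rewrite -powR2 ?(ltW kp)// -powRD ?subrK// (gt_eqF kp) implybT.
  rewrite ler_wpM2r ?sqr_ge0//; apply: powR_le_base => //; last exact: ltW.
  by rewrite subr_ge0.
apply: le_trans (ler_sum _ (fun (k : 'I_(2 ^ j)) _ => pt k)) _.
rewrite -mulr_sumr.
have -> : \sum_(k < 2 ^ j) (normc (1 - conjc (root2 R j k) * x) ^+ 2)^-1 =
   2 ^+ j * rmean j (fun z => (normc (1 - conjc z * x) ^+ 2)^-1).
  by rewrite /rmean mulrA divff ?expf_neq0// mul1r.
have h1 : 1 - normc x ^+ (2 ^ j) >= 1 / 3.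
  have : normc x ^+ (2 ^ j) <= rad j ^+ (2 ^ j).
    by rewrite lerXn2r ?nnegrE ?normc_ge0 ?(ltW r0).
  by have := rad_pow j; lra.
have h2 : eta <= 1 - normc x ^+ 2.
  by rewrite /eta -nx; have := normc_ge0 x; nra.
have h3 : rmean j (fun z => (normc (1 - conjc z * x) ^+ 2)^-1) <= 6 / eta.
  apply: le_trans (rmean_poisson _ x1) _.
  have -> : 6 / eta = 2 / (eta * (1 / 3)) by field; rewrite gt_eqF.
  have h3 : 0 < 1 / 3 :> R by [].
  rewrite ler_wpM2l// lef_pV2 ?posrE ?mulr_gt0//.
  - by apply: ler_pM => //; exact: ltW.
  - exact: lt_le_trans h2.
  - exact: lt_le_trans h1.
have -> : 6 * 2 ^+ j / eta `^ (p - 1) = (eta `^ (p - 2))^-1 * (2 ^+ j * (6 / eta)).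
  have -> : eta `^ (p - 1) = eta `^ (p - 2) * eta.
    rewrite -{3}(powRr1 (ltW eta0)) -powRD; first by congr powR; ring.
    by rewrite (gt_eqF eta0) implybT.
  by field; rewrite !gt_eqF// powR_gt0.
by rewrite ler_wpM2l ?invr_ge0 ?powR_ge0// ler_wpM2l// exprn_ge0.
Qed.

Section Geometric.
Variables (k : R) (k0 : 0 < k).
Let q : R := 2 `^ (- k).
Let G : R := (1 - q)^-1.

Let q0 : 0 < q. Proof. by rewrite powR_gt0. Qed.

Let q1 : q < 1.
Proof.
rewrite /q powRN invf_lt1 ?powR_gt0// -[ltLHS](powRr0 2).
by rewrite /powR gt_eqF// ltr_expR mul0r mulr_gt0// ln_gt0// ltr1n.
Qed.

Let G0 : 0 < G. Proof. by rewrite invr_gt0 subr_gt0. Qed.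

Let GE : G * q + 1 = G.
Proof. by rewrite /G; field; rewrite subr_eq0 gt_eqF. Qed.

Let scale2 x : 0 <= x -> (x * 2) `^ k * q = x `^ k.
Proof. by move=> x0; rewrite powRM// -mulrA /q powRN divff ?mulr1// gt_eqF ?powR_gt0. Qed.

(** The induction also bounds the sum by [G] times the power belonging to the index [J - 1]; the cap
    at 1 then turns this into a bound uniform in [t] and [J]. *)
Lemma geometric_up t J : 0 < t ->
  \sum_(j < J) (if t * 2 ^+ j <= 1 then (t * 2 ^+ j) `^ k else 0) <= G.
Proof.
move=> t0; suff [] : \sum_(j < J) (if t * 2 ^+ j <= 1 then (t * 2 ^+ j) `^ k else 0) <= G /\
   \sum_(j < J) (if t * 2 ^+ j <= 1 then (t * 2 ^+ j) `^ k else 0) <= G * ((t * 2 ^+ J) `^ k * q) by [].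
elim: J => [|J [ih1 ih2]].
  by rewrite big_ord0 (ltW G0)/= !mulr_ge0 ?powR_ge0 ?(ltW G0) ?(ltW q0).
have p0 : 0 <= t * 2 ^+ J by rewrite mulr_ge0 ?exprn_ge0// ltW.
have E : (t * 2 ^+ J.+1) `^ k * q = (t * 2 ^+ J) `^ k by rewrite exprSr mulrA scale2.
rewrite big_ord_recr /= E; set S := \sum_(i < J) _ in ih1 ih2 *.
set u := (t * 2 ^+ J) `^ k in ih2 *.
have u0 : 0 <= u by exact: powR_ge0.
case: ifP => tJ.
  have u1 : u <= 1.
    by rewrite /u -[leRHS](powRr0 (t * 2 ^+ J)) ger_powR ?tJ ?(ltW k0)// andbT mulr_gt0// exprn_gt0.
  have h : S + u <= G * u.
    apply: le_trans (lerD ih2 (lexx u)) _.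
    by rewrite -{2}GE; rewrite (_ : G * (u * q) + u = (G * q + 1) * u)//; ring.
  split => //; apply: le_trans h _; by rewrite ler_piMr// ltW.
rewrite addr0; split => //; apply: le_trans ih2 _.
by rewrite ler_wpM2l ?(ltW G0)// ler_piMr// ltW.
Qed.

(** Removing the term of index 0 and doubling [s] reproduces the same sum, since
    [dy j.+1 / s = dy j / (2 * s)]. *)
Lemma geometric_down s J : 0 < s ->
  \sum_(j < J) (if dy j <= s then (dy j / s) `^ k else 0) <= G.
Proof.
suff : forall s, 0 < s -> \sum_(j < J) (if dy j <= s then (dy j / s) `^ k else 0) <= G /\
  \sum_(j < J) (if dy j <= s then (dy j / s) `^ k else 0) <= G * (s^-1 `^ k).
  by move=> h /h[].
elim: J => [|J ih] {}s s0.
  by rewrite big_ord0 (ltW G0)/= mulr_ge0 ?powR_ge0// (ltW G0).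
have s20 : 0 < 2 * s by rewrite mulr_gt0.
have [ih1 ih2] := ih _ s20; rewrite big_ord_recl /=.
have -> : \sum_(i < J) (if dy (bump 0 i) <= s then (dy (bump 0 i) / s) `^ k else 0) =
    \sum_(j < J) (if dy j <= 2 * s then (dy j / (2 * s)) `^ k else 0).
  apply: eq_bigr => i _; rewrite /bump /= add1n dyS ler_pdivrMr// [s * 2]mulrC.
  by rewrite (_ : dy i / 2 / s = dy i / (2 * s))//; field; rewrite gt_eqF.
set S := \sum_(i < J) _ in ih1 ih2 *.
have sV0 : 0 <= s^-1 by rewrite invr_ge0 ltW.
have E : (2 * s)^-1 `^ k = s^-1 `^ k * q.
  by rewrite invfM powRM ?invr_ge0 ?(ltW s0)// mulrC -(@powR_inv1 _ 2)// -powRrM mulN1r.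
rewrite E in ih2; set u := s^-1 `^ k in ih2 *.
have u0 : 0 <= u by exact: powR_ge0.
have d0 : dy 0 = 1 by rewrite /dy expr0 invr1.
rewrite d0 div1r; case: ifP => s1.
  have u1 : u <= 1.
    rewrite /u -[leRHS](powRr0 s^-1) ger_powR ?(ltW k0)// invr_gt0 s0/=.
    by rewrite invf_le1.
  have h : u + S <= G * u.
    apply: le_trans (lerD (lexx u) ih2) _.
    by rewrite -{2}GE; rewrite (_ : u + G * (u * q) = (G * q + 1) * u)//; ring.
  by split => //; apply: le_trans h _; rewrite ler_piMr// ltW.
rewrite add0r; split => //; apply: le_trans ih2 _.
by rewrite ler_wpM2l ?(ltW G0)// ler_piMr// ltW.
Qed.

Lemma geometric_bounds : exists2 B, 0 < B & forall J t, 0 < t ->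
  \sum_(j < J) (if t * 2 ^+ j <= 1 then (t * 2 ^+ j) `^ k else 0) <= B /\
  \sum_(j < J) (if dy j <= t then (dy j / t) `^ k else 0) <= B.
Proof.
by exists G => // J t t0; split; [exact: geometric_up|exact: geometric_down].
Qed.

End Geometric.
End Lattice.

(** * Normal weights and Forelli-Rudin sums over the lattice *)

Section WeightEstimates.
Variables (R : realType) (nu : R[i] -> R).
Local Notation C := (R[i]).
Hypothesis nunorm : normal nu.

Lemma normal_radial z : disk z -> nu z = nu (normc z)%:C.
Proof. by case: nunorm => -[_ _ h _] _ _ _; exact: h. Qed.

Lemma normal_decreasing z w : disk z -> disk w -> normc z <= normc w -> nu w <= nu z.
Proof. by case: nunorm => -[_ _ _ h] _ _ _; exact: h. Qed.

Lemma normal_nodeE j k : nu (node R j k) = nu (rad R j)%:C.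
Proof. by rewrite normal_radial ?normc_node//; exact: node_disk. Qed.

Lemma one_minus_sqr_bounds (r p : R) : 0 <= r < 1 -> 0 <= p ->
  (1 - r) `^ p <= (1 - r ^+ 2) `^ p <= 2 `^ p * (1 - r) `^ p.
Proof.
move=> /andP[r0 r1] p0; have r1' : 0 <= 1 - r by rewrite subr_ge0 ltW.
rewrite -powRM//; apply/andP; split; apply: powR_le_base => //; nra.
Qed.

(** Cross-multiplied form of the growth condition; the factor [2 ^ be] pays for replacing [1 - r^2]
    by [1 - r]. *)
Lemma normalI_ratio be : normalI nu be -> exists2 c, 0 < c &
  forall z w, disk z -> disk w -> normc z <= normc w ->
    nu z * (1 - normc w) `^ be <= c * nu w * (1 - normc z) `^ be.
Proof.
move=> [be0 [c c0 H]]; exists (c * 2 `^ be); first by rewrite mulr_gt0// powR_gt0.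
move=> z w dz dw zw; have := H _ _ (normc_ge0 z) zw dw.
rewrite -!normal_radial//.
have z01 : 0 <= normc z < 1 by rewrite normc_ge0.
have w01 : 0 <= normc w < 1 by rewrite normc_ge0.
have [/andP[za zb] /andP[wa wb]] :=
  (one_minus_sqr_bounds z01 (ltW be0), one_minus_sqr_bounds w01 (ltW be0)).
have z2 : 0 < (1 - normc z ^+ 2) `^ be.
  by rewrite powR_gt0// subr_gt0 exprn_ilt1// normc_ge0.
have w2 : 0 < (1 - normc w ^+ 2) `^ be.
  by rewrite powR_gt0// subr_gt0 exprn_ilt1// normc_ge0.
have nz := normal_gt0 nunorm dz; have nw := normal_gt0 nunorm dw.
rewrite ler_pdivrMr// mulrA mulrAC ler_pdivlMr// => h.
apply: le_trans (_ : nu z * (1 - normc w ^+ 2) `^ be <= _).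
  by rewrite ler_wpM2l// ltW.
apply: le_trans h _.
rewrite -!mulrA ler_wpM2l ?(ltW c0)// [leRHS]mulrCA ler_wpM2l// ltW//.
Qed.

Lemma normalII_ratio ga : normalII nu ga -> exists2 c, 0 < c &
  forall z w, disk z -> disk w -> normc z <= normc w ->
    nu w * (1 - normc z) `^ ga <= c * nu z * (1 - normc w) `^ ga.
Proof.
move=> [ga0 [c c0 H]]; exists (c * 2 `^ ga); first by rewrite mulr_gt0// powR_gt0.
move=> z w dz dw zw; have := H _ _ (normc_ge0 z) zw dw.
rewrite -!normal_radial//.
have z01 : 0 <= normc z < 1 by rewrite normc_ge0.
have w01 : 0 <= normc w < 1 by rewrite normc_ge0.
have [/andP[za zb] /andP[wa wb]] :=
  (one_minus_sqr_bounds z01 (ltW ga0), one_minus_sqr_bounds w01 (ltW ga0)).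
have z2 : 0 < (1 - normc z ^+ 2) `^ ga.
  by rewrite powR_gt0// subr_gt0 exprn_ilt1// normc_ge0.
have w2 : 0 < (1 - normc w ^+ 2) `^ ga.
  by rewrite powR_gt0// subr_gt0 exprn_ilt1// normc_ge0.
have nz := normal_gt0 nunorm dz; have nw := normal_gt0 nunorm dw.
rewrite ler_pdivrMr// mulrA mulrAC ler_pdivlMr// => h.
apply: le_trans (_ : nu w * (1 - normc z ^+ 2) `^ ga <= _).
  by rewrite ler_wpM2l// ltW.
apply: le_trans h _.
rewrite -!mulrA ler_wpM2l ?(ltW c0)// [leRHS]mulrCA ler_wpM2l// ltW//.
Qed.

Lemma pos_expR (x : R) : 0 < x -> exists u, x = expR u.
Proof. by move=> x0; exists (ln x); rewrite lnK. Qed.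

Lemma normc_radC j : normc (rad R j)%:C = rad R j.
Proof. by rewrite normc_real gtr0_norm ?rad_gt0. Qed.

Lemma rad_disk j : disk (rad R j)%:C.
Proof. by have := rad_lt1 R j; rewrite -{1}normc_radC. Qed.

Lemma nu_rad_gt0 j : 0 < nu (rad R j)%:C.
Proof. by apply: normal_gt0 => //; exact: rad_disk. Qed.

(** For identities between products of real powers: once every base is written as an exponential,
    [ring] compares the exponents. *)
Ltac monomial :=
  do ![rewrite -mulrA|rewrite -expRN|rewrite -expRD|rewrite -expRM];
  congr (_ * _); congr expR; ring.

Section ForelliRudin.
Variables (be ga a p : R).
Hypotheses (hI : normalI nu be) (hII : normalII nu ga).
Hypotheses (abe : 1 + be < a) (p2 : 2 <= p) (ap : a <= p).

Let p1 : 0 <= p - 1.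
Proof. by rewrite subr_ge0 (le_trans _ p2)// ler1n. Qed.

Let ga0 : 0 < ga. Proof. by case: hII. Qed.
Let be0 : 0 < be. Proof. by case: hI. Qed.

Let term j w := dy R j `^ a / nu (rad R j)%:C *
  (6 * 2 ^+ j / (1 - rad R j * normc w) `^ (p - 1)).

Let eta_ge j w : disk w ->
  1 - rad R j <= 1 - rad R j * normc w /\ 1 - normc w <= 1 - rad R j * normc w.
Proof.
move=> dw; have w1 : normc w < 1 by [].
have r0 := rad_gt0 R j; have r1 := rad_lt1 R j; have w0 := normc_ge0 w.
by split; nra.
Qed.

(** Rings inside the circle through [w]. Here the denominator is at least of order [dy j], and
    condition (II) leaves the power [ga] of the ratio [(1 - normc w) * 2 ^+ j], which is at most 1
    and geometric in [j]. *)
Let term_far : exists2 K, 0 < K & forall j w, disk w -> rad R j <= normc w ->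
  (1 - normc w) * 2 ^+ j <= 1 /\
  term j w <= K * ((1 - normc w) * 2 ^+ j) `^ ga *
    (nu w * (1 - normc w) `^ (p - a))^-1.
Proof.
have [c c0 H] := normalII_ratio hII.
exists (6 * c * 4 `^ (p - 1 + ga)); first by rewrite !mulr_gt0// powR_gt0.
move=> j w dw jw; have w1 : normc w < 1 by [].
set t := 1 - normc w; have t0 : 0 < t by rewrite subr_gt0.
have d0 := dy_gt0 R j; have rl := rad_sub_le R j; have rg := rad_sub_ge R j.
have td : t <= dy R j by rewrite /t; lra.
split; first by rewrite -ler_pdivlMr ?exprn_gt0// div1r.
have N0 := normal_gt0 nunorm (rad_disk j).
have V0 := normal_gt0 nunorm dw.
have d40 : 0 < dy R j / 4 by rewrite divr_gt0.
have h1 : ((1 - rad R j * normc w) `^ (p - 1))^-1 <= ((dy R j / 4) `^ (p - 1))^-1.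
  have [e1 _] := eta_ge j dw.
  have e0 : 0 < 1 - rad R j * normc w by lra.
  rewrite lef_pV2 ?posrE ?powR_gt0// powR_le_base ?(ltW d40)//.
  exact: le_trans e1.
have h2 : (nu (rad R j)%:C)^-1 <= c * t `^ ga / (nu w * (dy R j / 4) `^ ga).
  have := H _ _ (rad_disk j) dw; rewrite normc_radC => /(_ jw) h.
  rewrite ler_pdivlMr ?mulr_gt0 ?powR_gt0// mulrC ler_pdivrMr// mulrAC.
  apply: le_trans h; rewrite ler_wpM2l ?(ltW V0)// powR_le_base ?(ltW ga0)//.
  exact: ltW.
have P0 : 0 <= dy R j `^ a * 2 ^+ j by rewrite mulr_ge0 ?powR_ge0 ?exprn_ge0.
apply: (@le_trans _ _ (6 * (dy R j `^ a * 2 ^+ j) * (((dy R j / 4) `^ (p - 1))^-1 *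
    (c * t `^ ga / (nu w * (dy R j / 4) `^ ga))))).
  rewrite /term (_ : _ / _ * _ = 6 * (dy R j `^ a * 2 ^+ j) *
     (((1 - rad R j * normc w) `^ (p - 1))^-1 * (nu (rad R j)%:C)^-1)); last by ring.
  have P6 : 0 <= 6 * (dy R j `^ a * 2 ^+ j) by rewrite mulr_ge0.
  apply: (ler_wpM2l P6); apply: ler_pM => //.
    by rewrite invr_ge0 powR_ge0.
  by rewrite invr_ge0 ltW.
apply: (@le_trans _ _ (6 * c * 4 `^ (p - 1 + ga) * (t * 2 ^+ j) `^ ga *
   (nu w * dy R j `^ (p - a))^-1)).
  rewrite le_eqVlt; apply/orP; left; apply/eqP.
  have [u uE] := pos_expR d0; have [v vE] := pos_expR t0.
  have [f fE] := @pos_expR 4 (ltr0Sn _ _).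
  have -> : 2 ^+ j = expR (- u) :> R by rewrite expRN -uE invrK.
  have [n nE] := pos_expR V0; have [c' cE] := pos_expR c0.
  rewrite uE vE fE nE cE; monomial.
apply: (@le_trans _ _ (6 * c * 4 `^ (p - 1 + ga) * (t * 2 ^+ j) `^ ga *
   (nu w * t `^ (p - a))^-1)) => //.
have P : 0 <= 6 * c * 4 `^ (p - 1 + ga) * (t * 2 ^+ j) `^ ga.
  by rewrite !mulr_ge0 ?powR_ge0 ?(ltW c0).
apply: (ler_wpM2l P).
rewrite lef_pV2 ?posrE ?mulr_gt0 ?powR_gt0// ler_wpM2l ?(ltW V0)//.
apply: powR_le_base; [by rewrite subr_ge0|exact: ltW|exact: td].
Qed.

(** Rings outside the circle through [w]. Here the denominator is at least of order [1 - normc w],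
    and condition (I) costs the power [be] of [dy j]; what remains is the positive power
    [a - 1 - be], again geometric in [j]. *)
Let term_near : exists2 K, 0 < K & forall j w, disk w -> normc w <= rad R j ->
  dy R j <= 4 * (1 - normc w) /\
  term j w <= K * (dy R j / (4 * (1 - normc w))) `^ (a - 1 - be) *
    (nu w * (1 - normc w) `^ (p - a))^-1.
Proof.
have [c c0 H] := normalI_ratio hI.
exists (6 * c * 4 `^ be * 4 `^ (a - 1 - be)); first by rewrite !mulr_gt0// powR_gt0.
move=> j w dw jw; have w1 : normc w < 1 by [].
set t := 1 - normc w; have t0 : 0 < t by rewrite subr_gt0.
have d0 := dy_gt0 R j; have rl := rad_sub_le R j; have rg := rad_sub_ge R j.
have td : dy R j <= 4 * t by rewrite /t; lra.
split => //.
have N0 := normal_gt0 nunorm (rad_disk j).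
have V0 := normal_gt0 nunorm dw.
have d40 : 0 < dy R j / 4 by rewrite divr_gt0.
have h1 : ((1 - rad R j * normc w) `^ (p - 1))^-1 <= (t `^ (p - 1))^-1.
  have [_ e1] := eta_ge j dw.
  have e0 : 0 < 1 - rad R j * normc w by exact: lt_le_trans e1.
  by rewrite lef_pV2 ?posrE ?powR_gt0// powR_le_base ?(ltW t0).
have h2 : (nu (rad R j)%:C)^-1 <= c * t `^ be / (nu w * (dy R j / 4) `^ be).
  have := H _ _ dw (rad_disk j); rewrite normc_radC => /(_ jw) h.
  rewrite ler_pdivlMr ?mulr_gt0 ?powR_gt0// mulrC ler_pdivrMr// mulrAC.
  apply: le_trans h; rewrite ler_wpM2l ?(ltW V0)// powR_le_base ?(ltW be0)//.
  exact: ltW.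
apply: (@le_trans _ _ (6 * (dy R j `^ a * 2 ^+ j) * ((t `^ (p - 1))^-1 *
    (c * t `^ be / (nu w * (dy R j / 4) `^ be))))).
  rewrite /term (_ : _ / _ * _ = 6 * (dy R j `^ a * 2 ^+ j) *
     (((1 - rad R j * normc w) `^ (p - 1))^-1 * (nu (rad R j)%:C)^-1)); last by ring.
  have P0 : 0 <= dy R j `^ a * 2 ^+ j by rewrite mulr_ge0 ?powR_ge0 ?exprn_ge0.
  have P6 : 0 <= 6 * (dy R j `^ a * 2 ^+ j) by rewrite mulr_ge0.
  apply: (ler_wpM2l P6); apply: ler_pM => //.
    by rewrite invr_ge0 powR_ge0.
  by rewrite invr_ge0 ltW.
rewrite le_eqVlt; apply/orP; left; apply/eqP.
have [u uE] := pos_expR d0; have [v vE] := pos_expR t0.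
have [f fE] := @pos_expR 4 (ltr0Sn _ _).
have -> : 2 ^+ j = expR (- u) :> R by rewrite expRN -uE invrK.
have [n nE] := pos_expR V0; have [c' cE] := pos_expR c0.
rewrite uE vE fE nE cE; monomial.
Qed.

(** Discrete form of the Forelli-Rudin estimate for the density [(1 - |z|)^(a - 2) / nu z], since a
    node of level [j] stands for an area of order [dy j ^+ 2]. *)
Lemma forelli_rudin : exists2 K, 0 < K & forall J w, disk w ->
  \sum_(j < J) \sum_(k < 2 ^ j)
     dy R j `^ a / (nu (rad R j)%:C * normc (1 - conjc (node R j k) * w) `^ p)
  <= K / (nu w * (1 - normc w) `^ (p - a)).
Proof.
have [K1 K10 H1] := term_far; have [K2 K20 H2] := term_near.
have [B1 B10 G1] := geometric_bounds ga0.
have kap : 0 < a - 1 - be by have := abe; lra.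
have [B2 B20 G2] := geometric_bounds kap.
exists (K1 * B1 + K2 * B2); first by rewrite addr_gt0// mulr_gt0.
move=> J w dw; have w1 : normc w < 1 by [].
set t := 1 - normc w; have t0 : 0 < t by rewrite subr_gt0.
have t40 : 0 < 4 * t by rewrite mulr_gt0.
have V0 := normal_gt0 nunorm dw.
pose g1 (j : nat) := if t * 2 ^+ j <= 1 then (t * 2 ^+ j) `^ ga else 0.
pose g2 (j : nat) := if dy R j <= 4 * t then (dy R j / (4 * t)) `^ (a - 1 - be) else 0.
set W := (nu w * t `^ (p - a))^-1.
have W0 : 0 <= W by rewrite invr_ge0 mulr_ge0 ?powR_ge0// ltW.
have g10 j : 0 <= g1 j by rewrite /g1; case: ifP => // _; exact: powR_ge0.
have g20 j : 0 <= g2 j by rewrite /g2; case: ifP => // _; exact: powR_ge0.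
apply: (@le_trans _ _ (\sum_(j < J) (K1 * g1 j + K2 * g2 j) * W)); last first.
  rewrite -mulr_suml ler_wpM2r// big_split -!mulr_sumr.
  have [h1 _] := G1 J t t0; have [_ h2] := G2 J _ t40.
  by rewrite lerD// ler_pM2l.
apply: ler_sum => j _.
apply: (@le_trans _ _ (term j w)).
  rewrite /term (eq_bigr (fun k : 'I_(2 ^ j) => dy R j `^ a / nu (rad R j)%:C *
    (normc (1 - conjc (node R j k) * w) `^ p)^-1)); last by move=> k _; rewrite invfM mulrA.
  rewrite -mulr_sumr ler_wpM2l ?ring_sum// divr_ge0 ?powR_ge0// ltW//.
  by apply: normal_gt0 => //; exact: rad_disk.
have [jw|/ltW jw] := leP (rad R j) (normc w).
  have [tj h] := H1 _ _ dw jw; apply: le_trans h _; rewrite -/t -/W ler_wpM2r//.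
  by rewrite /g1 tj lerDl mulr_ge0// ltW.
have [tj h] := H2 _ _ dw jw; apply: le_trans h _; rewrite -/t -/W ler_wpM2r//.
by rewrite /g2 tj lerDr mulr_ge0// ltW.
Qed.
End ForelliRudin.
End WeightEstimates.

(** * Integration along rays *)

Section SegmentIntegral.
Variable R : realType.
Local Notation C := (R[i]).

(** The primitive is taken on a slightly larger interval, so that 0 and 1 are interior points and it
    has two-sided derivatives there. *)
Lemma dilation_primitive (k : R -> R) (c : R) : 0 < c ->
  (forall x, - c < x < 1 + c -> {for x, continuous k}) ->
  exists K : R -> R, (forall x, - (c / 2) < x < 1 + c / 2 -> is_derive x 1 K (k x)) /\
    (forall t : R, 0 < t < 1 + c / 2 ->
      \int[lebesgue_measure]_(s in `[0, 1]) (t * k (t * s)) = K t - K 0).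
Proof.
move=> c0 kc; pose K x := \int[lebesgue_measure]_(s in `[- (c / 2), x]) k s.
have intk : lebesgue_measure.-integrable `[- (c / 2), 1 + c / 2] (EFin \o k).
  apply: continuous_compact_integrable; first exact: segment_compact.
  apply: continuous_in_subspaceT => x; rewrite inE/= in_itv/= => /andP[x1 x2].
  by apply: kc; apply/andP; split; lra.
have Kd x : - (c / 2) < x < 1 + c / 2 -> is_derive x 1 K (k x).
  move=> /andP[x1 x2].
  have [] := @continuous_FTC1 R k (BLeft (- (c / 2))) x (1 + c / 2) x2 intk x1.
    by apply: kc; apply/andP; split; lra.
  rewrite derive1E => dK <-; exact: DeriveDef.
exists K; split => // t /andP[t0 t1].
have Kt s : - (c / 2) < t * s < 1 + c / 2 -> is_derive s 1 (fun s => K (t * s)) (t * k (t * s)).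
  move=> /Kd h.
  have h2 : is_derive s 1 (fun s => t * s) (t *: 1 : R).
    by apply: is_deriveZ.
  have := is_derive1_comp h h2; rewrite mulrC.
  by rewrite (_ : t *: 1 = t) ?mulr1// -[LHS]/(t * 1) mulr1.
have ts s : 0 <= s <= 1 -> - (c / 2) < t * s < 1 + c / 2.
  by move=> /andP[s0 s1]; apply/andP; split; nra.
have cts s : 0 <= s <= 1 -> {for s, continuous (fun s => K (t * s))}.
  by move=> /ts /Kt h; apply: differentiable_continuous; apply/derivable1_diffP; case: h.
rewrite /Rintegral (@continuous_FTC2 R (fun s => t * k (t * s)) (fun s => K (t * s)) 0 1 ltr01).
- by rewrite mulr1 mulr0.
- apply: continuous_in_subspaceT => s; rewrite inE/= in_itv/= => /ts h.
  apply: (@continuousM R R (fun=> t) (fun s => k (t * s))); first exact: cst_continuous.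
  apply: (@continuous_comp _ _ _ (fun s => t * s) k).
    by apply: (@continuousM R R (fun=> t) id); [exact: cst_continuous|exact: cvg_id].
  by apply: kc; move: h => /andP[? ?]; apply/andP; split; lra.
- split.
  + move=> s; rewrite in_itv/= => /andP[/ltW s0 /ltW s1].
    have s01 : 0 <= s <= 1 by rewrite s0.
    by case: (Kt s (ts _ s01)).
  + by apply: cvg_at_right_filter; apply: cts; rewrite lexx ler01.
  + by apply: cvg_at_left_filter; apply: cts; rewrite lexx ler01.
- move=> s; rewrite in_itv/= => /andP[/ltW s0 /ltW s1].
  have s01 : 0 <= s <= 1 by rewrite s0.
  by have h := Kt s (ts _ s01); rewrite derive1E (@derive_val _ _ _ _ _ _ _ h).
Qed.

Definition ccont (h : C -> C) z := forall e : R, 0 < e ->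
  exists2 d : R, 0 < d & forall k, normc k < d -> normc (h (z + k) - h z) <= e.

Lemma ccont_cderiv h z D : cderiv h z D -> ccont h z.
Proof. exact: cderiv_cont. Qed.

Lemma ccontM f g z : ccont f z -> ccont g z -> ccont (fun w => f w * g w) z.
Proof.
move=> hf hg e e0.
pose M := normc (f z) + normc (g z) + 1.
have M0 : 0 < M by rewrite ltr_wpDl// addr_ge0// normc_ge0.
pose e1 := Num.min 1 (e / M).
have e10 : 0 < e1 by rewrite lt_min ltr01 divr_gt0.
have e11 : e1 <= 1 by rewrite ge_min lexx.
have e1M : e1 * M <= e by rewrite -ler_pdivlMr// ge_min lexx orbT.
have [d1 d10 H1] := hf _ e10; have [d2 d20 H2] := hg _ e10.
exists (Num.min d1 d2); first by rewrite lt_min d10.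
move=> k; rewrite lt_min => /andP[/H1 h1 /H2 h2]; apply: le_trans e1M.
have -> : f (z + k) * g (z + k) - f z * g z = (f (z + k) - f z) * (g (z + k) - g z) +
  (f (z + k) - f z) * g z + f z * (g (z + k) - g z) by ring.
have -> : e1 * M = e1 * 1 + e1 * normc (g z) + normc (f z) * e1 by rewrite /M; ring.
apply: le_trans (normcD _ _) _; apply: lerD; last by rewrite normcM ler_wpM2l ?normc_ge0.
apply: le_trans (normcD _ _) _; apply: lerD; last by rewrite normcM ler_wpM2r ?normc_ge0.
by rewrite normcM ler_pM ?normc_ge0// (le_trans h2).
Qed.

Lemma ccont_comp f g z : ccont f z -> ccont g (f z) -> ccont (g \o f) z.
Proof.
move=> hf hg e /hg[d1 d10 H1].
have [d d0 H] := hf _ (divr_gt0 d10 (ltr0Sn R 1)).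
exists d => // k /H hk; have := H1 (f (z + k) - f z).
rewrite [f z + _]addrC subrK; apply; apply: le_lt_trans hk _.
by rewrite ltr_pdivrMr// ltr_pMr// ltr1n.
Qed.

Lemma ray_disk (z : C) (c x : R) : 0 < c -> (1 + c) * normc z < 1 -> - c < x < 1 + c ->
  disk (x%:C * z).
Proof.
move=> c0 cz /andP[x1 x2]; rewrite -[disk _]/(is_true (normc _ < 1)) normcM normc_real.
apply: le_lt_trans cz; rewrite ler_wpM2r ?normc_ge0// ler_norml.
by apply/andP; split; lra.
Qed.

Lemma ray_continuous (h : C -> C) (z : C) (L : C -> R) (x : R) :
  (forall u v, L (u - v) = L u - L v) -> (forall u, `|L u| <= normc u) ->
  ccont h (x%:C * z) -> normc z < 1 -> {for x, continuous (fun s : R => L (z * h (s%:C * z)))}.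
Proof.
move=> LB Ln hc z1.
apply/(@cvgrPdist_le R R R (nbhs x)) => e e0.
have [d d0 H] := hc _ e0.
exists d => // s /= xs.
rewrite -LB -mulrBr; apply: le_trans (Ln _) _; rewrite normcM.
have -> : s%:C * z = x%:C * z + (s - x)%:C * z by rewrite rmorphB; ring.
apply: (@le_trans _ _ (1 * e)); last by rewrite mul1r.
apply: ler_pM; rewrite ?normc_ge0 ?(ltW z1)// normc_distC H//.
rewrite normcM normc_real distrC; apply: le_lt_trans xs.
by rewrite ler_piMr// ltW.
Qed.

Lemma ray_room (z : C) : disk z -> exists2 c, 0 < c & (1 + c) * normc z < 1.
Proof.
move=> dz; have z1 : normc z < 1 by [].
exists ((1 - normc z) / 2); first by rewrite divr_gt0// subr_gt0.
by have := normc_ge0 z; nra.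
Qed.

(* The primitive along the ray through [z] of a real-linear functional [L] of [z h]. *)
Lemma ray_primitive (h : C -> C) (z : C) (L : C -> R) : disk z ->
  (forall u v, L (u - v) = L u - L v) -> (forall u, `|L u| <= normc u) ->
  (forall w, disk w -> ccont h w) ->
  exists c, exists K : R -> R, [/\ 0 < c, (1 + c) * normc z < 1,
    forall x, - c < x < 1 + c -> is_derive x 1 K (L (z * h (x%:C * z))) &
    forall t : R, 0 < t < 1 + c ->
      \int[lebesgue_measure]_(s in `[0, 1]) (t * L (z * h ((t * s)%:C * z))) = K t - K 0].
Proof.
move=> dz LB Ln hc; have [c c0 cz] := ray_room dz.
have [|K [K1 K2]] := @dilation_primitive (fun s : R => L (z * h (s%:C * z))) c c0.
  by move=> x xc; exact: (@ray_continuous h z L x LB Ln (hc _ (ray_disk c0 cz xc)) dz).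
exists (c / 2), K; split => //; first by rewrite divr_gt0.
by apply: le_lt_trans cz; rewrite ler_wpM2r ?normc_ge0//; lra.
Qed.

Lemma is_derive_le (f : R -> R) (x D e : R) : is_derive x 1 f D -> 0 < e ->
  exists2 d : R, 0 < d & forall s, `|s| < d -> `|f (x + s) - f x - s * D| <= e * `|s|.
Proof.
move=> [df fD] e0.
have Hc : (fun s : R => s^-1 *: ((f \o shift x) (s *: 1) - f x)) @ 0^' --> D.
  by rewrite -fD; exact: df.
move/cvgrPdist_le : Hc => /(_ e e0) [d d0 H].
exists d => // s sd; have [->|s0] := eqVneq s 0.
  by rewrite addr0 mul0r subr0 subrr normr0 mulr0.
have := H s; rewrite /= sub0r normrN => /(_ sd s0) /(ler_wpM2l (normr_ge0 s)).
rewrite -normrM mulrC [e * _]mulrC mulrC; apply: le_trans.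
rewrite distrC le_eqVlt; apply/orP; left; apply/eqP; congr Num.norm.
have -> : s%:A = s by rewrite -[LHS]/(s * 1) mulr1.
rewrite (_ : s^-1 *: _ = s^-1 * (f (s + x) - f x))// [s + x]addrC.
by field.
Qed.

(** Rescaling the segment shows that along the ray [L (G (t z))] is a primitive [K] of the integrand
    up to a constant. Its derivative at [t = 1] is computed once from [GD] and once from [K]. *)
Lemma ray_derivative (G h : C -> C) (z : C) (D : C) (L : C -> R) : disk z ->
  (forall u v, L (u - v) = L u - L v) -> (forall u, `|L u| <= normc u) ->
  (forall (a : R) u, L (a%:C * u) = a * L u) ->
  (forall w, disk w -> ccont h w) ->
  (forall w, disk w -> L (G w) = \int[lebesgue_measure]_(t in `[0, 1]) L (w * h (t%:C * w))) ->
  cderiv G z D -> L (z * D) = L (z * h z).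
Proof.
move=> dz LB Ln LZ hc GE GD.
have [c [K [c0 cz K1 K2]]] := ray_primitive dz LB Ln hc.
have GK (t : R) : 0 < t < 1 + c -> L (G (t%:C * z)) = K t - K 0.
  move=> /andP[t0 t1]; rewrite -K2 ?t0// GE; last first.
    by apply: (ray_disk c0 cz); apply/andP; split => //; lra.
  congr Rintegral; apply/funext => s; rewrite -mulrA LZ; congr (_ * L (_ * h _)).
  by rewrite mulrA -rmorphM mulrC [s * t]mulrC mulrC.
have K1' : is_derive (1 : R) 1 K (L (z * h z)).
  have := K1 1; rewrite mul1r; apply; apply/andP; split; lra.
suff small (e : R) : 0 < e -> `|L (z * D) - L (z * h z)| <= e.
  apply/eqP; rewrite -subr_eq0 -normr_le0; apply/ler_addgt0Pr => e e0.
  by rewrite add0r small.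
move=> e0; have z1 : normc z < 1 by [].
have e2 : 0 < e / 2 by rewrite divr_gt0.
have [d1 d10 H1] := GD _ e2; have [d2 d20 H2] := is_derive_le K1' e2.
pose s := Num.min (Num.min d1 d2) c / 2.
have s0 : 0 < s by rewrite divr_gt0// !lt_min d10 d20.
have [sd1 sd2 sc] : [/\ s < d1, s < d2 & s < c].
  have h1 : Num.min (Num.min d1 d2) c <= d1 by rewrite !ge_min lexx.
  have h2 : Num.min (Num.min d1 d2) c <= d2 by rewrite !ge_min lexx !orbT.
  have h3 : Num.min (Num.min d1 d2) c <= c by rewrite !ge_min lexx !orbT.
  by move: s0; rewrite /s; split; lra.
have nsz : normc (s%:C * z) <= s.
  by rewrite normcM normc_real gtr0_norm// ler_piMr ?(ltW s0)// ltW.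
have h1 := H1 (s%:C * z) (le_lt_trans nsz sd1).
have ns : `|s| = s by rewrite gtr0_norm.
have h2 := H2 s; rewrite ns in h2; have {}h2 := h2 sd2.
have zE : z + s%:C * z = (1 + s)%:C * z by rewrite rmorphD rmorph1; ring.
have h3 : `|L (G (z + s%:C * z) - G z - s%:C * z * D)| <= e / 2 * s.
  by apply: le_trans (Ln _) _; apply: le_trans h1 _; rewrite ler_wpM2l// ltW.
rewrite !LB zE GK in h3; last by apply/andP; split; lra.
have G1 : L (G z) = K 1 - K 0.
  by have := GK 1; rewrite mul1r => -> //; apply/andP; split; lra.
rewrite G1 -mulrA LZ in h3.
rewrite -(ler_pM2l s0) -{1}ns -normrM.
have -> : s * (L (z * D) - L (z * h z)) = (K (1 + s) - K 1 - s * L (z * h z)) -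
   (K (1 + s) - K 0 - (K 1 - K 0) - s * L (z * D)) by ring.
rewrite (_ : s * e = e / 2 * s + e / 2 * s); last by field.
by apply: le_trans (ler_normB _ _) _; rewrite lerD.
Qed.

Lemma complex_ext (x y : C) : complex.Re x = complex.Re y -> complex.Im x = complex.Im y -> x = y.
Proof. by case: x => a b; case: y => c d /= -> ->. Qed.

(** Differentiability of [G] is assumed, so its derivative along the ray through [z] determines it,
    and continuity of [h] suffices. Dividing by the direction [z] excludes the origin. *)
Lemma segment_integral_cderiv (G h : C -> C) z D : disk z -> z != 0 ->
  (forall w, disk w -> ccont h w) ->
  (forall w, disk w -> G w = segment_integral h w) ->
  cderiv G z D -> D = h z.
Proof.
move=> dz z0 hc GE GD; apply: (mulfI z0); apply: complex_ext.
  apply: (ray_derivative (G := G)) => //.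
  - exact: ReB.
  - exact: Re_le_normc.
  - exact: ReZ.
  - by move=> w /GE ->.
apply: (ray_derivative (G := G)) => //.
- exact: ImB.
- exact: Im_le_normc.
- exact: ImZ.
- by move=> w /GE ->.
Qed.

(** The mean value theorem applied to [K - B] and [- K - B], where [K] is the primitive along the
    ray, turns the pointwise majorant [B'] into a bound of the integral. *)
Lemma ray_integral_le (h : C -> C) (z : C) (L : C -> R) (B B' : R -> R) : disk z ->
  (forall u v, L (u - v) = L u - L v) -> (forall u, `|L u| <= normc u) ->
  (forall w, disk w -> ccont h w) ->
  (forall t : R, 0 <= t <= 1 -> is_derive t 1 B (B' t)) ->
  (forall t : R, 0 <= t <= 1 -> normc (z * h (t%:C * z)) <= B' t) ->
  `|\int[lebesgue_measure]_(t in `[0, 1]) L (z * h (t%:C * z))| <= B 1 - B 0.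
Proof.
move=> dz LB Ln hc Bd hB.
have [c [K [c0 cz K1 K2]]] := ray_primitive dz LB Ln hc.
have IE : \int[lebesgue_measure]_(t in `[0, 1]) L (z * h (t%:C * z)) = K 1 - K 0.
  rewrite -K2; last by apply/andP; split; lra.
  by congr Rintegral; apply/funext => s; rewrite !mul1r.
have mvt (e : R) : `|e| = 1 -> e * (K 1 - K 0) <= B 1 - B 0.
  move=> e1; pose F t := e * K t - B t; pose dF t := e * L (z * h (t%:C * z)) - B' t.
  have dFF (t : R) : 0 <= t <= 1 -> is_derive t 1 F (dF t).
    move=> /[dup] /Bd hb /andP[t0 t1].
    have hk : is_derive t 1 K (L (z * h (t%:C * z))) by apply: K1; apply/andP; split; lra.
    by apply: is_deriveB; rewrite -[e * L _]/(e *: L _); apply: is_deriveZ.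
  have [||x x01 xE] := @MVT_segment R F dF 0 1 ler01.
  - by move=> x /andP[/= x0 x1]; apply: dFF; rewrite !bnd_simp in x0 x1; rewrite !ltW.
  - apply: derivable_within_continuous => x; rewrite in_itv/= => /dFF hx.
    by case: hx.
  have dF0 : dF x <= 0.
    rewrite subr_le0; move: x01; rewrite in_itv/= => x01.
    apply: le_trans (hB _ x01); apply: le_trans (ler_norm _) _.
    by rewrite normrM e1 mul1r Ln.
  rewrite subr0 mulr1 in xE; move: dF0; rewrite -xE /F.
  by move=> h1; lra.
rewrite IE ler_norml; apply/andP; split.
  by have := mvt (-1); rewrite normrN1 mulN1r => /(_ erefl) ?; lra.
by have := mvt 1; rewrite normr1 mul1r => /(_ erefl).
Qed.

Lemma segment_integral_le (h : C -> C) (z : C) (B B' : R -> R) : disk z ->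
  (forall w, disk w -> ccont h w) ->
  (forall t : R, 0 <= t <= 1 -> is_derive t 1 B (B' t)) ->
  (forall t : R, 0 <= t <= 1 -> normc (z * h (t%:C * z)) <= B' t) ->
  normc (segment_integral h z) <= 2 * (B 1 - B 0).
Proof.
move=> dz hc Bd hB; apply: le_trans (normc_le_ReIm _) _.
rewrite (_ : 2 * _ = (B 1 - B 0) + (B 1 - B 0)); last by ring.
apply: lerD; apply: (ray_integral_le dz _ _ hc Bd hB).
- exact: ReB.
- exact: Re_le_normc.
- exact: ImB.
- exact: Im_le_normc.
Qed.

End SegmentIntegral.

(** * Reproducing kernels *)

Section TameKernels.
Variable R : realType.
Local Notation C := (R[i]).

(* The size and smoothness bounds of [c (1 - y)^-p] and its derivative, [T] being
   an upper bound of [1 / |1 - y|]. *)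
Definition tame_with (K K' : C -> C) p (c : R) := forall (T : R) (y x : C), 0 < T ->
  normc y <= 1 -> normc x <= 1 -> 1 <= T * normc (1 - y) -> 1 <= T * normc (1 - x) ->
  [/\ normc (K y) <= c * T ^+ p, normc (K' y) <= c * T ^+ p.+1,
      normc (K x - K y) <= c * normc (x - y) * T ^+ p.+1,
      normc (K' x - K' y) <= c * normc (x - y) * T ^+ p.+2 &
      normc (K x - K y - (x - y) * K' y) <= c * normc (x - y) ^+ 2 * T ^+ p.+2].

Definition tame K p c := exists K', tame_with K K' p c.

Lemma tame_cderiv K K' p c y : tame_with K K' p c -> normc y < 1 -> cderiv K y (K' y).
Proof.
move=> hK y1 e e0.
pose d := (1 - normc y) / 2; have d0 : 0 < d by rewrite divr_gt0// subr_gt0.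
have c1 : 0 < `|c| * d^-1 ^+ p.+2 + 1 by rewrite ltr_wpDl// mulr_ge0// exprn_ge0// invr_ge0 ltW.
exists (Num.min d (e / (`|c| * d^-1 ^+ p.+2 + 1))); first by rewrite lt_min d0 divr_gt0.
move=> h; rewrite lt_min => /andP[hd he].
have yh : normc (y + h) <= 1 - d.
  by apply: le_trans (normcD _ _) _; rewrite /d in hd *; lra.
have [|||||_ _ _ _] := hK d^-1 y (y + h); rewrite ?invr_gt0// ?(ltW y1)//.
- by apply: le_trans yh _; rewrite gerBl ltW.
- rewrite mulrC ler_pdivlMr// mul1r; apply: le_trans (normc_sub1_ge _).
  by rewrite /d; lra.
- rewrite mulrC ler_pdivlMr// mul1r; apply: le_trans (normc_sub1_ge _).
  by move: yh; lra.
rewrite [y + h]addrC addrK [h + y]addrC => /le_trans; apply.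
rewrite ltr_pdivlMr// in he.
apply: (@le_trans _ _ (`|c| * normc h ^+ 2 * d^-1 ^+ p.+2)).
  rewrite ler_wpM2r ?exprn_ge0 ?invr_ge0 ?(ltW d0)// ler_wpM2r ?sqr_ge0//.
  exact: ler_norm.
rewrite (_ : _ * _ * _ = normc h * (`|c| * d^-1 ^+ p.+2) * normc h); last by ring.
rewrite ler_wpM2r ?normc_ge0//; apply: le_trans (ltW he).
by rewrite ler_wpM2l ?normc_ge0// lerDl.
Qed.

Lemma tame_ge0 K p c : tame K p c -> 0 <= c.
Proof.
move=> [K' h]; have [|||||h1 _ _ _ _] := h 1 0 0; rewrite ?normc0 ?subr0 ?normc1 ?mul1r//.
by apply: le_trans (normc_ge0 _) _; rewrite expr1n mulr1 in h1; exact: h1.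
Qed.

Lemma tame_with_cauchy :
  tame_with (fun y => 1 / (1 - y)) (fun y => (1 / (1 - y)) ^+ 2) 1 2.
Proof.
move=> T y x T0 _ _ Ty Tx.
have inv z : 1 <= T * normc (1 - z) -> 1 - z != 0 /\ normc (1 / (1 - z)) <= T.
  move=> Tz; have z0 : 0 < normc (1 - z).
    by rewrite -(pmulr_rgt0 _ T0); exact: lt_le_trans Tz.
  by split; [rewrite -normc_gt0|rewrite normc_div1 -div1r ler_pdivrMr].
have [y0 ay] := inv y Ty; have [x0 ax] := inv x Tx.
have d1 : 1 / (1 - x) - 1 / (1 - y) = (x - y) * (1 / (1 - x) * (1 / (1 - y))).
  by field; rewrite ?x0 ?y0.
have d2 : 1 / (1 - x) - 1 / (1 - y) - (x - y) * (1 / (1 - y)) ^+ 2 =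
    (x - y) ^+ 2 * ((1 / (1 - x)) * (1 / (1 - y)) * (1 / (1 - y))) by field; rewrite ?x0 ?y0.
have d3 : (1 / (1 - x)) ^+ 2 - (1 / (1 - y)) ^+ 2 =
  (x - y) * (1 / (1 - x) * (1 / (1 - y)) * (1 / (1 - x) + 1 / (1 - y))) by field; rewrite ?x0 ?y0.
rewrite d2 d1 d3; move: ax ay; set a := 1 / (1 - x); set b := 1 / (1 - y) => ax ay.
have a0 := normc_ge0 a; have b0 := normc_ge0 b.
have ab : normc (a * b) <= T ^+ 2 by rewrite normcM expr2 ler_pM.
have T2 : 0 <= T ^+ 2 by rewrite sqr_ge0.
have n0 := normc_ge0 (x - y).
split.
- by rewrite expr1; lra.
- by rewrite normcX; apply: (@le_trans _ _ (T ^+ 2)); [rewrite lerXn2r ?nnegrE// ltW|lra].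
- by rewrite normcM (_ : 2 * _ * _ = normc (x - y) * (2 * T ^+ 2)); [apply: ler_wpM2l => //; lra|ring].
- rewrite normcM (_ : 2 * _ * _ = normc (x - y) * (2 * T ^+ 3)); last by ring.
  apply: ler_wpM2l => //; rewrite normcM (_ : 2 * T ^+ 3 = T ^+ 2 * (T + T)); last by ring.
  apply: ler_pM => //; try exact: normc_ge0.
  by apply: le_trans (normcD _ _) _; rewrite lerD.
- rewrite normcM normcX (_ : 2 * _ * _ = normc (x - y) ^+ 2 * (2 * T ^+ 3)); last by ring.
  apply: ler_wpM2l; first exact: sqr_ge0.
  rewrite normcM; apply: (@le_trans _ _ (T ^+ 2 * T)).
    by apply: ler_pM => //; exact: normc_ge0.
  rewrite -exprSr; have : 0 <= T ^+ 3 by rewrite exprn_ge0// ltW.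
  by lra.
Qed.

Lemma tame_cauchy : tame (fun y => 1 / (1 - y)) 1 2.
Proof. by eexists; exact: tame_with_cauchy. Qed.

Lemma tame_le K p c c' : c <= c' -> tame K p c -> tame K p c'.
Proof.
move=> cc [K' h]; exists K' => T y x T0 y1 x1 Ty Tx.
have T' n : 0 <= T ^+ n by rewrite exprn_ge0// ltW.
have [h1 h2 h3 h4 h5] := h T y x T0 y1 x1 Ty Tx; split.
- by apply: le_trans h1 _; rewrite ler_wpM2r.
- by apply: le_trans h2 _; rewrite ler_wpM2r.
- by apply: le_trans h3 _; rewrite ler_wpM2r// ler_wpM2r ?normc_ge0.
- by apply: le_trans h4 _; rewrite ler_wpM2r// ler_wpM2r ?normc_ge0.
- by apply: le_trans h5 _; rewrite ler_wpM2r// ler_wpM2r// sqr_ge0.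
Qed.

Lemma tameD K L p c c' : tame K p c -> tame L p c' -> tame (fun y => K y + L y) p (c + c').
Proof.
move=> [K' h] [L' h']; exists (fun y => K' y + L' y) => T y x T0 y1 x1 Ty Tx.
have [h1 h2 h3 h4 h5] := h T y x T0 y1 x1 Ty Tx.
have [k1 k2 k3 k4 k5] := h' T y x T0 y1 x1 Ty Tx.
rewrite !mulrDl; split.
- by apply: le_trans (normcD _ _) _; rewrite lerD.
- by apply: le_trans (normcD _ _) _; rewrite lerD.
- rewrite (_ : _ - _ = (K x - K y) + (L x - L y)); last by ring.
  by apply: le_trans (normcD _ _) _; rewrite lerD.
- rewrite (_ : _ - _ = (K' x - K' y) + (L' x - L' y)); last by ring.
  by apply: le_trans (normcD _ _) _; rewrite lerD.
- rewrite (_ : _ - _ - _ = (K x - K y - (x - y) * K' y) + (L x - L y - (x - y) * L' y)); last by ring.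
  by apply: le_trans (normcD _ _) _; rewrite lerD.
Qed.

Lemma tameZ K p c a : tame K p c -> tame (fun y => a * K y) p (normc a * c).
Proof.
move=> [K' h]; exists (fun y => a * K' y) => T y x T0 y1 x1 Ty Tx.
have [h1 h2 h3 h4 h5] := h T y x T0 y1 x1 Ty Tx.
have a0 := normc_ge0 a.
rewrite -!mulrA; split.
- by rewrite normcM; apply: (ler_wpM2l a0).
- by rewrite normcM; apply: (ler_wpM2l a0).
- by rewrite -mulrBr normcM; apply: (ler_wpM2l a0); rewrite mulrA.
- by rewrite -mulrBr normcM; apply: (ler_wpM2l a0); rewrite mulrA.
- rewrite (_ : _ - _ - _ = a * (K x - K y - (x - y) * K' y)); last by ring.
  by rewrite normcM; apply: (ler_wpM2l a0); rewrite mulrA mulrA -(mulrA c).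
Qed.

(** The 4 is the number of products in the difference of the two derivatives, the worst of the five
    bounds. *)
Lemma tameM K L p r c c' : tame K p c -> tame L r c' ->
  tame (fun y => K y * L y) (p + r) (4 * (c * c')).
Proof.
move=> tK tL; have c0 := tame_ge0 tK; have c'0 := tame_ge0 tL.
move: tK tL => [K' h] [L' h'].
exists (fun y => K' y * L y + K y * L' y) => T y x T0 y1 x1 Ty Tx.
have [h1 h2 h3 h4 h5] := h T y x T0 y1 x1 Ty Tx.
have [k1 k2 k3 k4 k5] := h' T y x T0 y1 x1 Ty Tx.
have [hx1 hx2 _ _ _] := h T x y T0 x1 y1 Tx Ty.
have [kx1 kx2 _ _ _] := h' T x y T0 x1 y1 Tx Ty.
have T' n : 0 <= T ^+ n by rewrite exprn_ge0// ltW.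
have cc : 0 <= c * c' by rewrite mulr_ge0.
set d := normc (x - y) in h3 h4 h5 k3 k4 k5 *.
have d0 : 0 <= d by exact: normc_ge0.
have P (u v : C) a b : normc u <= a -> normc v <= b -> normc (u * v) <= a * b.
  by move=> ua vb; rewrite normcM ler_pM ?normc_ge0.
have X1 : 0 <= c * c' * T ^+ (p + r).+1 by rewrite mulr_ge0.
have X2 : 0 <= c * c' * d * T ^+ (p + r).+1 by rewrite !mulr_ge0.
have X3 : 0 <= c * c' * d ^+ 2 * T ^+ (p + r).+2.
  by apply: mulr_ge0 => //; apply: mulr_ge0 => //; exact: sqr_ge0.
have eS n : T ^+ n.+1 = T * T ^+ n by exact: exprS.
have tri (u v : C) a b e : normc u <= a -> normc v <= b -> a + b <= e -> normc (u + v) <= e.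
  by move=> ua vb; apply: le_trans; apply: le_trans (normcD _ _) _; rewrite lerD.
split.
- apply: le_trans (P _ _ _ _ h1 k1) _.
  rewrite exprD [X in X <= _](_ : _ = c * c' * (T ^+ p * T ^+ r)); last by ring.
  have : 0 <= c * c' * (T ^+ p * T ^+ r) by rewrite !mulr_ge0.
  by lra.
- apply: tri (P _ _ _ _ h2 k1) (P _ _ _ _ h1 k2) _.
  move: X1; rewrite !eS exprD => X1.
  rewrite [X in X <= _](_ : _ = 2 * (c * c' * (T * (T ^+ p * T ^+ r)))); last by ring.
  by lra.
- rewrite (_ : _ - _ = (K x - K y) * L x + K y * (L x - L y)); last by ring.
  apply: tri (P _ _ _ _ h3 kx1) (P _ _ _ _ h1 k3) _.
  move: X2; rewrite !eS exprD => X2.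
  rewrite [X in X <= _](_ : _ = 2 * (c * c' * d * (T * (T ^+ p * T ^+ r)))); last by ring.
  by lra.
- rewrite (_ : _ - _ = ((K' x - K' y) * L x + K' y * (L x - L y)) +
    ((K x - K y) * L' x + K y * (L' x - L' y))); last by ring.
  apply: tri (tri _ _ _ _ _ (P _ _ _ _ h4 kx1) (P _ _ _ _ h2 k3) (lexx _))
    (tri _ _ _ _ _ (P _ _ _ _ h3 kx2) (P _ _ _ _ h1 k4) (lexx _)) _.
  rewrite le_eqVlt; apply/orP; left; apply/eqP.
  by rewrite !eS exprD; ring.
- rewrite (_ : _ - _ - _ = ((K x - K y - (x - y) * K' y) * L x +
    (x - y) * (K' y * (L x - L y))) + K y * (L x - L y - (x - y) * L' y)); last by ring.
  apply: tri (tri _ _ _ _ _ (P _ _ _ _ h5 kx1) (P _ _ _ _ (lexx d) (P _ _ _ _ h2 k3)) (lexx _))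
    (P _ _ _ _ h1 k5) _.
  move: X3; rewrite !eS exprD => X3.
  rewrite [X in X <= _](_ : _ = 3 * (c * c' * d ^+ 2 * (T * (T * (T ^+ p * T ^+ r))))); last by ring.
  by lra.
Qed.

(** On the closed disk [|1 - z| <= 2 |1 - s z|], so the dilated kernel obeys the bounds with [2 * T]
    in place of [T]; at most [p.+2] factors 2 result. *)
Lemma tame_dilation K p c s : 0 <= s <= 1 -> tame K p c ->
  tame (fun y => K (s%:C * y)) p (c * 2 ^+ p.+2).
Proof.
move=> /andP[s0 s1] tK; have c0 := tame_ge0 tK; move: tK => [K' h].
exists (fun y => s%:C * K' (s%:C * y)) => T y x T0 y1 x1 Ty Tx.
have ns z : normc (s%:C * z) = s * normc z by rewrite normcM normc_real ger0_norm.
have dom z : normc z <= 1 -> normc (s%:C * z) <= 1.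
  by move=> z1; rewrite ns mulr_ile1 ?normc_ge0.
have low z : normc z <= 1 -> 1 <= T * normc (1 - z) -> 1 <= 2 * T * normc (1 - s%:C * z).
  move=> z1 Tz; have : normc (1 - z) <= 2 * normc (1 - s%:C * z).
    rewrite (_ : 1 - z = (1 - s%:C * z) - (1 - s)%:C * z); last first.
      by rewrite rmorphB rmorph1; ring.
    apply: le_trans (normcB _ _) _; rewrite mulrDl mul1r lerD2l.
    rewrite normcM normc_real ger0_norm ?subr_ge0//.
    apply: le_trans (normc_sub1_ge _); rewrite ns.
    by have := normc_ge0 z; nra.
  by move: Tz; nra.
have T20 : 0 < 2 * T by rewrite mulr_gt0.
have [h1 h2 h3 h4 h5] := h (2 * T) _ _ T20 (dom _ y1) (dom _ x1) (low _ y1 Ty) (low _ x1 Tx).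
rewrite -mulrBr ns !exprMn in h3 h4 h5; rewrite !exprMn in h1 h2.
set d := normc (x - y) in h3 h4 h5 *.
have d0 : 0 <= d by exact: normc_ge0.
have T' n : 0 <= T ^+ n by rewrite exprn_ge0// ltW.
have pw m n (X Y : R) : (m <= n)%N -> 0 <= Y -> X <= c * Y * 2 ^+ m -> X <= c * 2 ^+ n * Y.
  move=> mn Y0 /le_trans; apply; rewrite mulrAC ler_wpM2r// ler_wpM2l//.
  by rewrite ler_weXn2l// ler1n.
have sd (n : nat) : 0 <= d * T ^+ n by rewrite mulr_ge0.
have sm (u : C) : normc (s%:C * u) <= normc u by rewrite ns ler_piMl ?normc_ge0.
split.
- by apply: (pw p) => //; [exact/leqW/leqW|rewrite -mulrA [T ^+ p * _]mulrC].
- apply: le_trans (sm _) _.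
  by apply: (pw p.+1) => //; rewrite -mulrA [T ^+ _ * _]mulrC.
- rewrite -mulrA; apply: (pw p.+1) => //; apply: le_trans h3 _.
  rewrite [X in X <= _](_ : _ = s * (c * (d * T ^+ p.+1) * 2 ^+ p.+1)); last by ring.
  by apply: ler_piMl => //; apply: mulr_ge0; [exact: mulr_ge0|exact: exprn_ge0].
- rewrite -mulrBr; apply: le_trans (sm _) _.
  rewrite -mulrA; apply: (pw p.+2) => //; apply: le_trans h4 _.
  rewrite [X in X <= _](_ : _ = s * (c * (d * T ^+ p.+2) * 2 ^+ p.+2)); last by ring.
  by apply: ler_piMl => //; apply: mulr_ge0; [exact: mulr_ge0|exact: exprn_ge0].
- rewrite -mulrA; apply: (pw p.+2) => //; first by rewrite mulr_ge0// sqr_ge0.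
  rewrite (_ : (x - y) * _ = s%:C * (x - y) * K' (s%:C * y)); last by ring.
  apply: le_trans h5 _.
  rewrite [X in X <= _](_ : _ = s ^+ 2 * (c * (d ^+ 2 * T ^+ p.+2) * 2 ^+ p.+2)); last by ring.
  apply: ler_piMl; last exact: exprn_ile1.
  apply: mulr_ge0; last exact: exprn_ge0.
  by apply: mulr_ge0 => //; apply: mulr_ge0 => //; exact: sqr_ge0.
Qed.

(** Since [|1 - y|] is at most 2, [2 * T] is at least 1, and each unit of exponent costs a factor
    2. *)
Lemma tame_weaken K p r c : (p <= r)%N -> tame K p c -> tame K r (c * 2 ^+ (r - p)).
Proof.
move=> pr tK; have c0 := tame_ge0 tK; move: tK => [K' h].
exists K' => T y x T0 y1 x1 Ty Tx.
have [h1 h2 h3 h4 h5] := h T y x T0 y1 x1 Ty Tx.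
have T2 : 1 <= 2 * T.
  have : normc (1 - y) <= 2.
    by apply: le_trans (normcB _ _) _; rewrite normc1; lra.
  by move: Ty; nra.
have T' n : 0 <= T ^+ n by rewrite exprn_ge0// ltW.
have pw (X Y : R) k : 0 <= Y -> X <= Y * T ^+ (k + p) -> X <= Y * 2 ^+ (r - p) * T ^+ (k + r).
  move=> Y0 /le_trans; apply; rewrite -mulrA ler_wpM2l//.
  have -> : (k + r = (r - p) + (k + p))%N by rewrite addnCA subnK// addnC.
  by rewrite (exprD T (r - p)) mulrA -exprMn ler_peMl// exprn_ege1.
have cd : 0 <= c * normc (x - y) by rewrite mulr_ge0 ?normc_ge0.
have cd2 : 0 <= c * normc (x - y) ^+ 2 by rewrite mulr_ge0 ?sqr_ge0.
split.
- exact: (pw _ _ 0%N).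
- exact: (pw _ _ 1%N).
- by rewrite (mulrAC c); apply: (pw _ _ 1%N).
- by rewrite (mulrAC c); apply: (pw _ _ 2%N).
- by rewrite (mulrAC c); apply: (pw _ _ 2%N).
Qed.

End TameKernels.

(** * Products of q-differences applied to the Cauchy kernel *)

Section DilationOperators.
Variable R : realType.
Local Notation C := (R[i]).

Definition cauchyk (y : C) : C := 1 / (1 - y).

(* Writing [D F w = F (q w)], this is [(1 - q D) (1 - q^2 D) ... (1 - q^M D) F]. *)
Fixpoint qdiff (q : R) M (F : C -> C) : C -> C :=
  if M is M'.+1 then fun w => qdiff q M' F w - (q ^+ M)%:C * qdiff q M' F (q%:C * w)
  else F.

(* [D (usum q M G)] is [((1 + q D) ... (1 + q^M D) - 1) G]. *)
Fixpoint usum (q : R) M (G : C -> C) : C -> C :=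
  if M is M'.+1 then fun w => usum q M' G w + (q ^+ M)%:C * usum q M' G (q%:C * w) +
    (q ^+ M)%:C * G w
  else fun=> 0.

(** With [D] as above, [D (vsum q M F)] is [F - qdiff q M F], obtained by removing the factors of
    the product one at a time. *)
Fixpoint vsum (q : R) M (F : C -> C) : C -> C :=
  if M is M'.+1 then fun w => vsum q M' F w + (q ^+ M)%:C * qdiff q M' F w
  else fun=> 0.

Lemma vsumE q M F w : F w - qdiff q M F w = vsum q M F (q%:C * w).
Proof. by elim: M => [|M ih] /=; rewrite ?subrr// -ih; ring. Qed.

Lemma usum_lin q M H (c : C) w :
  usum q M (fun w => H w - c * H (q%:C * w)) w = usum q M H w - c * usum q M H (q%:C * w).
Proof. by elim: M w => [|M ih] w /=; rewrite ?mulr0 ?subr0// !ih; ring. Qed.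

(** Replacing [q] by its square replaces [D] by its square, and
    [1 - q^(2i) D^2 = (1 - q^i D) (1 + q^i D)]; [usum] collects the second factors, less the
    identity. *)
Lemma qdiff_sqr q M F w :
  qdiff (q ^+ 2) M F w = qdiff q M F w + usum q M (qdiff q M F) (q%:C * w).
Proof.
elim: M w => [|M ih] w /=; first by rewrite addr0.
rewrite !ih !usum_lin.
have -> : ((q ^+ 2) ^+ M.+1)%:C = (q ^+ M.+1)%:C * (q ^+ M.+1)%:C :> C.
  by rewrite -rmorphM -expr2 -!exprM mulnC.
have -> : (q ^+ 2)%:C * w = q%:C * (q%:C * w) by rewrite rmorphXn expr2 mulrA.
by ring.
Qed.

Definition qconst (q : R) M : R := \prod_(i < M) (1 - q ^+ i.+1).
Definition qkernel (q : R) n (y : C) : C := \prod_(i < n) cauchyk ((q ^+ i)%:C * y).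

Lemma dilation_neq1 (q : R) i (y : C) : 0 <= q < 1 -> normc y <= 1 -> y != 1 ->
  1 - (q ^+ i)%:C * y != 0.
Proof.
move=> /andP[q0 q1] y1 yn1; case: i => [|i].
  by rewrite expr0 rmorph1 mul1r subr_eq0 eq_sym.
apply: sub1_neq0; rewrite normcM normc_real ger0_norm ?exprn_ge0//.
have : q ^+ i.+1 < 1 by rewrite exprn_ilt1.
have : 0 <= q ^+ i.+1 by rewrite exprn_ge0.
by have := normc_ge0 y; nra.
Qed.

(* The q-binomial theorem. *)
Lemma qdiff_cauchy (q : R) M y : 0 <= q < 1 -> normc y <= 1 -> y != 1 ->
  qdiff q M cauchyk y = (qconst q M)%:C * qkernel q M.+1 y.
Proof.
move=> q01; have /andP[q0 q1] := q01; elim: M y => [|M ih] y y1 yn1.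
  transitivity (cauchyk ((q ^+ 0)%:C * y)); first by rewrite expr0 rmorph1 mul1r.
  by rewrite /qconst /qkernel big_ord0 big_ord1 rmorph1 !mul1r.
have qy1 : normc (q%:C * y) <= 1.
  by rewrite normcM normc_real ger0_norm// mulr_ile1 ?normc_ge0// ltW.
have qyn1 : q%:C * y != 1.
  apply/eqP => h; have := dilation_neq1 1 q01 y1 yn1.
  by rewrite expr1 h subrr eqxx.
rewrite /= ih// ih//.
have -> : qconst q M.+1 = qconst q M * (1 - q ^+ M.+1) by rewrite /qconst big_ord_recr.
have e1 : qkernel q M.+2 y = qkernel q M.+1 y * cauchyk ((q ^+ M.+1)%:C * y).
  by rewrite /qkernel big_ord_recr.
have e2 : qkernel q M.+2 y = cauchyk y * qkernel q M.+1 (q%:C * y).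
  rewrite /qkernel big_ord_recl; congr (_ * _).
    by congr cauchyk; rewrite -[RHS]mul1r -(rmorph1 (real_complex R)) -(expr0 q).
  apply: eq_bigr => i _; congr cauchyk.
  by rewrite (_ : nat_of_ord (lift ord0 i) = i.+1)// exprSr rmorphM mulrA.
have d0 : 1 - y != 0 by rewrite subr_eq0 eq_sym.
have dM := dilation_neq1 M.+1 q01 y1 yn1.
have -> : qkernel q M.+1 y = qkernel q M.+2 y * (1 - (q ^+ M.+1)%:C * y).
  by rewrite e1 /cauchyk; field.
have -> : qkernel q M.+1 (q%:C * y) = qkernel q M.+2 y * (1 - y).
  by rewrite e2 /cauchyk; field.
by rewrite !rmorphM rmorphB rmorph1; ring.
Qed.

Lemma sub1_expr_le (q : R) n : 0 <= q <= 1 -> 0 <= 1 - q ^+ n <= n%:R * (1 - q).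
Proof.
move=> /andP[q0 q1]; rewrite subr_ge0 exprn_ile1//=.
elim: n => [|n ih]; first by rewrite expr0 subrr mul0r.
rewrite exprS -natr1 mulrDl mul1r.
have : 0 <= q ^+ n by rewrite exprn_ge0.
have : q ^+ n <= 1 by rewrite exprn_ile1.
by move: ih; set a := q ^+ n; nra.
Qed.

Lemma qconst_le (q : R) M : 0 <= q <= 1 ->
  0 <= qconst q M <= (M%:R * (1 - q)) ^+ M.
Proof.
move=> q01; have /andP[q0 q1] := q01; rewrite /qconst.
suff h n : (n <= M)%N -> 0 <= \prod_(i < n) (1 - q ^+ i.+1) <= (M%:R * (1 - q)) ^+ n by exact: h.
elim: n => [|n ih] nM; first by rewrite big_ord0 expr0 ler01 lexx.
have /andP[h1 h2] := ih (ltnW nM).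
have /andP[k1 k2] := sub1_expr_le n.+1 q01.
rewrite big_ord_recr (exprSr (M%:R * _)) /=; apply/andP; split; first exact: (mulr_ge0 h1 k1).
apply: (ler_pM h1 k1 h2); apply: le_trans k2 _.
by rewrite ler_wpM2r ?subr_ge0// ler_nat.
Qed.

(** The hypothesis [1 <= T * normc (1 - y)] of the bounds excludes [y = 1], so the values there are
    irrelevant. *)
Lemma tame_ext (K L : C -> C) p (c : R) : (forall y, normc y <= 1 -> y != 1 -> K y = L y) ->
  tame K p c -> tame L p c.
Proof.
move=> KL [K' h]; exists K' => T y x T0 y1 x1 Ty Tx.
have n1 z : 1 <= T * normc (1 - z) -> z != 1.
  by move=> Tz; apply/eqP => zE; move: Tz; rewrite zE subrr normc0 mulr0 ler10.
by rewrite -!KL ?n1//; exact: h.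
Qed.

Lemma tame_cst (a : C) : tame (fun=> a) 0 (normc a).
Proof.
exists (fun=> 0) => T y x T0 _ _ _ _.
have T' n : 0 <= T ^+ n by rewrite exprn_ge0// ltW.
have a0 := normc_ge0 a; have d0 := normc_ge0 (x - y).
rewrite !subrr mulr0 subrr normc0 expr0 mulr1; split=> //.
- exact: (mulr_ge0 a0 (T' _)).
- exact: (mulr_ge0 (mulr_ge0 a0 d0) (T' _)).
- exact: (mulr_ge0 (mulr_ge0 a0 d0) (T' _)).
- by apply: mulr_ge0 => //; apply: mulr_ge0 => //; exact: sqr_ge0.
Qed.

Lemma tame_qkernel (n : nat) : exists2 c : R, 0 <= c & forall q : R, 0 <= q <= 1 ->
  tame (qkernel q n) n c.
Proof.
elim: n => [|n [c c0 ih]].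
  exists 1 => // q _; apply: tame_ext (_ : tame (fun=> 1) 0 1).
    by move=> y _ _; rewrite /qkernel big_ord0.
  by have := tame_cst 1; rewrite normc1.
exists (4 * (c * (2 * 2 ^+ 3))) => [|q q01]; first by rewrite !mulr_ge0// exprn_ge0.
have qn : 0 <= q ^+ n <= 1.
  by move/andP: q01 => [q0 q1]; rewrite exprn_ge0//= exprn_ile1.
have := tameM (ih q q01) (tame_dilation qn (tame_cauchy R)); rewrite addn1.
by apply: tame_ext => y _ _; rewrite /qkernel big_ord_recr.
Qed.

(** The power of [1 - q] comes from the constant of the q-binomial theorem, a product of [M] numbers
    [1 - q^i], each at most [M (1 - q)]. It is what makes the outer layers small. *)
Lemma tame_qdiff M : exists2 c : R, 0 <= c & forall q : R, 0 <= q < 1 ->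
  tame (qdiff q M cauchyk) M.+1 (c * (1 - q) ^+ M).
Proof.
have [c c0 H] := tame_qkernel M.+1; exists (M%:R ^+ M * c); first by rewrite mulr_ge0// exprn_ge0.
move=> q q01; have q01' : 0 <= q <= 1 by move/andP: q01 => [-> /ltW ->].
have := tameZ (qconst q M)%:C (H q q01'); move=> h.
apply: (tame_ext (K := fun y => (qconst q M)%:C * qkernel q M.+1 y)).
  by move=> y y1 yn1; rewrite qdiff_cauchy.
apply: tame_le h; have /andP[h0 h1] := qconst_le M q01'.
rewrite normc_real ger0_norm// mulrAC ler_wpM2r//.
by rewrite -exprMn.
Qed.

Lemma tame0 p : tame (fun=> 0 : C) p (0 : R).
Proof.
exists (fun=> 0) => T y x _ _ _ _ _.
by rewrite !subrr mulr0 subrr normc0 !mul0r; split.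
Qed.

Lemma tameZ_le1 (K : C -> C) p (c a : R) : 0 <= a <= 1 -> tame K p c -> tame (fun y => a%:C * K y) p c.
Proof.
move=> /andP[a0 a1] tK; apply: tame_le (tameZ a%:C tK).
by rewrite normc_real ger0_norm// ler_piMl// (tame_ge0 tK).
Qed.

Lemma tame_usum M p : exists2 B : R, 0 <= B & forall (q : R) K c, 0 <= q <= 1 ->
  tame K p c -> tame (usum q M K) p (c * B).
Proof.
elim: M => [|M [B B0 ih]].
  by exists 0 => // q K c _ _; rewrite mulr0; exact: tame0.
exists (B + B * 2 ^+ p.+2 + 1) => [|q K c q01 tK].
  by rewrite !addr_ge0// mulr_ge0// exprn_ge0.
have qM : 0 <= q ^+ M.+1 <= 1.
  by move/andP: q01 => [q0 q1]; rewrite exprn_ge0//= exprn_ile1.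
have tU := ih q K c q01 tK.
rewrite !mulrDr mulr1 mulrA; apply: tameD; last exact: tameZ_le1.
by apply: tameD => //; apply: tameZ_le1 => //; exact: tame_dilation.
Qed.

Lemma tame_vsum (q : R) M : 0 <= q < 1 -> exists c : R, tame (vsum q M cauchyk) M.+1 c.
Proof.
move=> q01; suff [c hc] : exists c : R, tame (vsum q M cauchyk) M c.
  by exists (c * 2 ^+ (M.+1 - M)); apply: tame_weaken.
elim: M => [|M [c tV]]; first by exists 0; exact: tame0.
have [c' _ /(_ q q01) tQ] := tame_qdiff M.
exists (c * 2 ^+ (M.+1 - M) + normc (q ^+ M.+1)%:C * (c' * (1 - q) ^+ M)) => /=.
by apply: tameD; [exact: tame_weaken|exact: tameZ].
Qed.

Lemma rad_cube j : rad R j ^+ 2 < rad R j.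
Proof. by rewrite expr2 gtr_pMl ?rad_gt0// rad_lt1. Qed.

(** Chosen to telescope: with [q_j = rad j ^+ 2], which is the square of [q_(j+1)], layer [j+1]
    evaluated at [q_(j+1) w] is the difference of the q-differences of parameters [q_j] and
    [q_(j+1)]; layer 0 is what the first q-difference removes from the function. *)
Definition layer_op M j (F : C -> C) : C -> C :=
  if j is j'.+1 then usum (rad R j ^+ 2) M (qdiff (rad R j ^+ 2) M F)
  else vsum (rad R 0 ^+ 2) M F.

Lemma sum_layers M f w J :
  \sum_(j < J.+1) layer_op M j f ((rad R j ^+ 2)%:C * w) = f w - qdiff (rad R J ^+ 2) M f w.
Proof.
elim: J => [|J ih]; first by rewrite big_ord1 /= -vsumE.
rewrite big_ord_recr ih /=.
have -> : qdiff (rad R J ^+ 2) M f w = qdiff ((rad R J.+1 ^+ 2) ^+ 2) M f w.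
  by rewrite -[in LHS](rad_sqr R J).
by rewrite qdiff_sqr; ring.
Qed.

Lemma rad2_bounds j : 0 <= rad R j ^+ 2 < 1.
Proof. by rewrite sqr_ge0 (lt_trans (rad_cube j))// rad_lt1. Qed.

Lemma rad2_sub_le j : 1 - rad R j ^+ 2 <= dy R j.
Proof. by have := rad_sub_le R j; have := rad_gt0 R j; have := rad_lt1 R j; nra. Qed.

Lemma tame_layers M : exists2 c : R, 0 <= c & forall j,
  tame (layer_op M j cauchyk) M.+1 (c * dy R j ^+ M).
Proof.
have [c0 tV] := tame_vsum M (rad2_bounds 0).
have [c1 c10 tQ] := tame_qdiff M; have [B B0 tU] := tame_usum M M.+1.
have c00 := tame_ge0 tV.
exists (c0 + c1 * B); first by rewrite addr_ge0// mulr_ge0.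
case=> [|j].
  by apply: tame_le tV; rewrite /dy expr0 invr1 expr1n mulr1 lerDl mulr_ge0.
have q01 := rad2_bounds j.+1.
have q01' : 0 <= rad R j.+1 ^+ 2 <= 1 by move/andP: q01 => [-> /ltW ->].
apply: tame_le (tU _ _ _ q01' (tQ _ q01)).
have /andP[q0 q1] := q01'.
rewrite mulrAC mulrDl; apply: ler_wpDl; first by rewrite mulr_ge0// exprn_ge0// ltW// dy_gt0.
rewrite ler_wpM2l ?mulr_ge0// lerXn2r ?nnegrE ?subr_ge0// ?(ltW (dy_gt0 _ _))//.
exact: rad2_sub_le.
Qed.

End DilationOperators.

(** * The layered reproducing formula *)

Section Reproducing.
Variable R : realType.
Local Notation C := (R[i]).

Definition circle_mean (f K : C -> C) (rho : R) n (w : C) : C :=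
  cmean n (fun z => f (rho%:C * z) * (conjc z / rho%:C * K (conjc z * w / rho%:C))).

(** The derivative of [F] is the limit of circle means of [f] against the derivative of [K]. As a
    relation it is preserved by linear combinations and dilations applied to [F] and [K] in
    parallel, so it passes from the Cauchy kernel to every layer. *)
Definition represents (f : C -> C) (rho : R) (F K : C -> C) := exists F' K' : C -> C,
  [/\ forall w, normc w < rho -> cderiv F w (F' w),
      forall y, normc y < 1 -> cderiv K y (K' y) &
      forall w, normc w < rho -> clim (fun n => circle_mean f K' rho n w) (F' w)].

Section Closure.
Variables (f : C -> C) (rho : R).
Hypotheses (rho0 : 0 < rho) (rho1 : rho < 1).

Lemma represents_zero : represents f rho (fun=> 0) (fun=> 0).
Proof.
exists (fun=> 0), (fun=> 0); split => [w _|y _|w _]; try exact: cderiv_cst.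
apply: (eq_clim (v := fun=> 0)) (clim_cst 0) => n.
by rewrite /circle_mean /cmean big1 ?mulr0// => k _; rewrite !mulr0.
Qed.

Lemma represents_comb F G K L a : represents f rho F K -> represents f rho G L ->
  represents f rho (fun w => F w + a * G w) (fun y => K y + a * L y).
Proof.
move=> [F' [K' [dF dK lF]]] [G' [L' [dG dL lG]]].
exists (fun w => F' w + a * G' w), (fun y => K' y + a * L' y); split => [w wr|y y1|w wr].
- by apply: cderivD; [exact: dF|apply: cderivZ; exact: dG].
- by apply: cderivD; [exact: dK|apply: cderivZ; exact: dL].
apply: (eq_clim (v := fun n => circle_mean f K' rho n w + a * circle_mean f L' rho n w)).
  by move=> n; rewrite /circle_mean -cmeanZ -cmeanD; apply: eq_cmean => z _; ring.
by apply: climD; [exact: lF|apply: climZ; exact: lG].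
Qed.

Lemma represents_dilation F K s : 0 <= s <= 1 -> represents f rho F K ->
  represents f rho (fun w => F (s%:C * w)) (fun y => K (s%:C * y)).
Proof.
move=> /andP[s0 s1] [F' [K' [dF dK lF]]].
have sm (x : C) e : normc x < e -> normc (s%:C * x) < e.
  by apply: le_lt_trans; rewrite normcM normc_real ger0_norm// ler_piMl// normc_ge0.
exists (fun w => s%:C * F' (s%:C * w)), (fun y => s%:C * K' (s%:C * y)).
split => [w wr|y y1|w wr].
- by apply: cderiv_scale; apply: dF; exact: sm.
- by apply: cderiv_scale; apply: dK; exact: sm.
apply: (eq_clim (v := fun n => s%:C * circle_mean f K' rho n (s%:C * w))).
  move=> n; rewrite /circle_mean -cmeanZ; apply: eq_cmean => z _.
  have -> : s%:C * (conjc z * w / rho%:C) = conjc z * (s%:C * w) / rho%:C by ring.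
  by ring.
by apply: climZ; apply: lF; exact: sm.
Qed.

Lemma represents_ext F K F2 K2 : F =1 F2 -> K =1 K2 -> represents f rho F K ->
  represents f rho F2 K2.
Proof. by move=> /funext -> /funext ->. Qed.

Lemma represents_cauchy : analytic f -> represents f rho f (@cauchyk R).
Proof.
move=> af; exists (derive1 f), (fun y => (1 / (1 - y)) ^+ 2); split => [w wr|y y1|w wr].
- by apply: analytic_cderiv => //; exact: lt_trans rho1.
- exact: (tame_cderiv (@tame_with_cauchy R) y1).
have rC : rho%:C != 0 by rewrite -normc_gt0 normc_real gtr0_norm.
have x1 : normc (w / rho%:C) < 1.
  by rewrite normcM normcV normc_real gtr0_norm// ltr_pdivrMr// mul1r.
have rr : 0 < rho < 1 by rewrite rho0.
have h := climZ (rho%:C)^-1 (cauchy_derivative af rr x1).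
have dE : rho%:C^-1 * (rho%:C * derive1 f (rho%:C * (w / rho%:C))) = derive1 f w.
  by rewrite (mulrC _ (w / _)) divfK// mulKf.
rewrite dE in h; apply: eq_clim h => n.
rewrite /circle_mean -cmeanZ; apply: eq_cmean => z _.
rewrite (_ : conjc z * w / rho%:C = conjc z * (w / rho%:C)); last by rewrite mulrA.
by rewrite expr_div_n expr1n; ring.
Qed.

Lemma represents_qdiff q M F K : 0 <= q <= 1 -> represents f rho F K ->
  represents f rho (qdiff q M F) (qdiff q M K).
Proof.
move=> q01 FK; elim: M => [//|M ih].
apply: represents_ext (represents_comb (- (q ^+ M.+1)%:C) ih (represents_dilation q01 ih)).
  by move=> w /=; rewrite mulNr.
by move=> w /=; rewrite mulNr.
Qed.

Lemma represents_usum q M F K : 0 <= q <= 1 -> represents f rho F K ->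
  represents f rho (usum q M F) (usum q M K).
Proof.
move=> q01 FK; elim: M => [|M ih]; first exact: represents_zero.
have h := represents_comb (q ^+ M.+1)%:C ih (represents_dilation q01 ih).
exact: represents_comb (q ^+ M.+1)%:C h FK.
Qed.

Lemma represents_vsum q M F K : 0 <= q <= 1 -> represents f rho F K ->
  represents f rho (vsum q M F) (vsum q M K).
Proof.
move=> q01 FK; elim: M => [|M ih]; first exact: represents_zero.
exact: represents_comb (q ^+ M.+1)%:C ih (represents_qdiff M q01 FK).
Qed.

End Closure.

Lemma represents_layer f M j : analytic f ->
  represents f (rad R j) (layer_op M j f) (layer_op M j (@cauchyk R)).
Proof.
move=> af; have r0 := rad_gt0 R j; have r1 := rad_lt1 R j.
have h := represents_cauchy r0 r1 af.
have b i : 0 <= rad R i ^+ 2 <= 1.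
  by have /andP[-> /ltW ->] := rad2_bounds R i.
case: j r0 r1 h => [|j] r0 r1 h; first exact: represents_vsum.
by apply: represents_usum => //; apply: represents_qdiff.
Qed.

Fixpoint qdiff' (q : R) M (F : C -> C) : C -> C :=
  if M is M'.+1 then fun w => qdiff' q M' F w - (q ^+ M)%:C * (q%:C * qdiff' q M' F (q%:C * w))
  else F.

Lemma qdiff_cderiv q M (F F' : C -> C) w : 0 <= q <= 1 ->
  (forall w, disk w -> cderiv F w (F' w)) -> disk w ->
  cderiv (qdiff q M F) w (qdiff' q M F' w).
Proof.
move=> /andP[q0 q1] FF'; elim: M w => [|M ih] w dw; first exact: FF'.
have qd : disk (q%:C * w).
  rewrite -[disk _]/(is_true (normc _ < 1)) normcM normc_real ger0_norm//.
  by apply: le_lt_trans dw; rewrite ler_piMl// normc_ge0.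
apply: cderivB; first exact: ih.
apply: (@cderivZ _ (fun w => qdiff q M F (q%:C * w))).
by apply: cderiv_scale; exact: ih.
Qed.

Lemma clim_mul1 (a u : nat -> C) l : clim a 1 -> clim u l -> clim (fun n => a n * u n) l.
Proof.
move=> al ul e e0; pose e1 := Num.min 1 (e / (normc l + 2)).
have l2 : 0 < normc l + 2 by rewrite ltr_wpDl ?normc_ge0.
have e10 : 0 < e1 by rewrite lt_min ltr01 divr_gt0.
have e11 : e1 <= 1 by rewrite ge_min lexx.
have eM : e1 * (normc l + 2) <= e by rewrite -ler_pdivlMr// ge_min lexx orbT.
have [N1 H1] := al _ e10; have [N2 H2] := ul _ e10.
exists (maxn N1 N2) => n; rewrite geq_max => /andP[/H1 h1 /H2 h2].
apply: le_trans eM.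
have -> : a n * u n - l = (a n - 1) * (u n - l) + (a n - 1) * l + (u n - l) by ring.
have -> : e1 * (normc l + 2) = e1 * 1 + e1 * normc l + e1 by ring.
apply: le_trans (normcD _ _) _; apply: lerD => //.
apply: le_trans (normcD _ _) _; rewrite !normcM; apply: lerD.
  by rewrite ler_pM ?normc_ge0// (le_trans h2).
by rewrite ler_wpM2r ?normc_ge0.
Qed.

Lemma clim_radX i : clim (fun j => (rad R j ^+ i)%:C) 1.
Proof.
elim: i => [|i ih]; first by apply: eq_clim (clim_cst 1) => j; rewrite expr0 rmorph1.
apply: eq_clim (clim_mul1 _ ih) => [j|]; first by rewrite exprS rmorphM.
move=> e e0; have [N HN] := @expr2_small R 1 e e0; exists N => n /HN.
apply: le_trans; rewrite normc_distC -(rmorph1 (real_complex R)) -rmorphB normc_real.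
rewrite ger0_norm ?subr_ge0 ?(ltW (rad_lt1 _ _))//.
apply: le_trans (rad_sub_le R n) _.
by rewrite div1r -/(dy R n) ler_pdivrMr// ler_peMr ?ler1n// ltW// dy_gt0.
Qed.

Lemma clim_ccont (h : C -> C) (u : nat -> C) l : ccont h l -> clim u l ->
  clim (fun n => h (u n)) (h l).
Proof.
move=> hl ul e /hl[d d0 H]; have [N HN] := ul _ (divr_gt0 d0 (ltr0Sn R 1)).
exists N => n /HN un; have := H (u n - l); rewrite [l + _]addrC subrK; apply.
by apply: le_lt_trans un _; rewrite ltr_pdivrMr// ltr_pMr// ltr1n.
Qed.

(** As the dilation tends to the identity, one factor [1 - q^i D] already makes the limit 0. The
    exponent [l] is there for the induction, which evaluates at the dilated point. *)
Lemma qdiff'_lim (F : C -> C) w M l : disk w -> ccont F w ->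
  clim (fun j => qdiff' (rad R j ^+ 2) M F ((rad R j ^+ l)%:C * w)) (if M is 0%N then F w else 0).
Proof.
move=> dw cF; elim: M l => [|M ih] l /=.
  apply: clim_ccont => //; have := climZ w (clim_radX l); rewrite mulr1.
  by apply: eq_clim => n; rewrite mulrC.
have h := ih l.+2.
have h2 := climB (ih l) (clim_mul1 (clim_radX (2 * M.+1)) (clim_mul1 (clim_radX 2) h)).
rewrite subrr in h2; apply: eq_clim h2 => j.
have -> : (rad R j ^+ 2)%:C * ((rad R j ^+ l)%:C * w) = (rad R j ^+ l.+2)%:C * w.
  by rewrite mulrA -rmorphM -exprD.
by rewrite exprM.
Qed.

Definition node_mean (f K : C -> C) j n w : C :=
  cmean n (fun z => f ((rad R j)%:C * z) *
    (conjc ((rad R j)%:C * z) * K (conjc ((rad R j)%:C * z) * w))).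

(** The partial sums of the layers differ from [f'] by the derivative of a q-difference whose
    parameter tends to 1; this vanishes in the limit as soon as there is one factor, hence
    [0 < M]. *)
Lemma reproducing M : (0 < M)%N -> exists Lam Lam' : nat -> C -> C, exists2 c : R, 0 <= c &
  (forall j, tame_with (Lam j) (Lam' j) M.+1 (c * dy R j ^+ M)) /\
  forall f w, analytic f -> disk w -> exists D : nat -> C,
    clim (fun J => \sum_(j < J) D j) (derive1 f w) /\
    forall j, clim (fun n => node_mean f (Lam' j) j n w) (D j).
Proof.
move=> M0; have [c c0 H] := tame_layers R M.
have [Lam' HL] := choice H.
exists (fun j => layer_op M j (@cauchyk R)), Lam', c => //; split => // f w af dw.
have rep j := represents_layer M j af.
have [F' HF] := choice rep; have [K' HK] := choice HF.
pose q j := rad R j ^+ 2.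
have qw j : normc ((q j)%:C * w) < rad R j.
  rewrite normcM normc_real ger0_norm ?sqr_ge0//; apply: le_lt_trans (rad_cube R j).
  by rewrite ler_piMr ?sqr_ge0// ltW.
exists (fun j => (q j)%:C * F' j ((q j)%:C * w)); split; last first.
  move=> j; have [_ dK lF] := HK j.
  have := climZ (q j)%:C (lF _ (qw j)); apply: eq_clim => n.
  rewrite /node_mean /circle_mean -cmeanZ; apply: eq_cmean => z z1.
  have r0 : (rad R j)%:C != 0 by rewrite -normc_gt0 normc_real gtr0_norm ?rad_gt0.
  have -> : conjc z * ((q j)%:C * w) / (rad R j)%:C = conjc ((rad R j)%:C * z) * w.
    by rewrite conjcM conjcR /q rmorphXn; field.
  (* [K'] was obtained for this [f], while [Lam'] comes with the tame bounds; uniqueness of the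
     derivative identifies them. *)
  have -> : Lam' j (conjc ((rad R j)%:C * z) * w) = K' j (conjc ((rad R j)%:C * z) * w).
    have y1 : normc (conjc ((rad R j)%:C * z) * w) < 1.
      apply: normcM_lt1; last exact: ltW.
      by rewrite normcJE normcM z1 mulr1 normc_radC rad_lt1.
    exact: cderiv_unique (tame_cderiv (HL j) y1) (dK _ y1).
  by rewrite conjcM conjcR /q rmorphXn; field.
have sumE J : \sum_(j < J.+1) (q j)%:C * F' j ((q j)%:C * w) =
    derive1 f w - qdiff' (q J) M (derive1 f) w.
  have dS : cderiv (fun w => \sum_(j < J.+1) layer_op M j f ((q j)%:C * w)) w
      (\sum_(j < J.+1) (q j)%:C * F' j ((q j)%:C * w)).
    apply: (@cderiv_sum R _ _ (fun (j : 'I_J.+1) w => layer_op M j f ((q j)%:C * w))) => j.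
    by apply: cderiv_scale; have [dF _ _] := HK j; exact: dF.
  apply: cderiv_unique dS _.
  rewrite (_ : (fun _ => _) = fun w => f w - qdiff (q J) M f w); last first.
    by apply/funext => v; exact: sum_layers.
  apply: cderivB; first exact: analytic_cderiv.
  apply: qdiff_cderiv => //; first by have /andP[-> /ltW ->] := rad2_bounds R J.
  by move=> v; exact: analytic_cderiv.
have lim0 : clim (fun J => qdiff' (q J) M (derive1 f) w) 0.
  have := @qdiff'_lim (derive1 f) w M 0 dw (derive1_continuous af dw).
  case: (M) M0 => // M' _; apply: eq_clim => J.
  by rewrite expr0 rmorph1 mul1r.
move=> e e0; have [N HN] := climB (clim_cst (derive1 f w)) lim0 e0.
exists N.+1 => -[//|n] nN; rewrite sumE; have := HN n nN; rewrite subr0; exact.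
Qed.

End Reproducing.

(** * Expansion into rank one terms *)

Section RankOneTerms.
Variable R : realType.
Local Notation C := (R[i]).
Variables (nu : C -> R) (be : R).
Hypotheses (nuN : normal nu) (hI : normalI nu be).
Variables (M : nat) (Lam Lam' : nat -> C -> C) (c : R).
Hypotheses (c0 : 0 <= c) (hLam : forall j, tame_with (Lam j) (Lam' j) M.+1 (c * dy R j ^+ M)).

Lemma Hinf_le f z : Hinf_set nu f -> disk z -> normc (f z) <= wnorm nu f / nu z.
Proof. by move=> hf dz; rewrite ler_pdivlMr ?normal_gt0// mulrC wnorm_ub. Qed.

Lemma wnorm_ge0 f : Hinf_set nu f -> 0 <= wnorm nu f.
Proof.
move=> hf; apply: le_trans (wnorm_ub hf (disk0 R)).
by rewrite mulr_ge0 ?normc_ge0// ltW// normal_gt0//; exact: disk0.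
Qed.

Lemma rad_circle_disk j (z : C) : normc z = rad R j -> disk z.
Proof. by move=> zr; rewrite -[disk _]/(is_true (normc _ < 1)) zr rad_lt1. Qed.

Lemma nu_circle j (z : C) : normc z = rad R j -> nu z = nu (rad R j)%:C.
Proof. by move=> zr; rewrite (normal_radial nuN) ?zr//; exact: rad_circle_disk zr. Qed.

(** The Cauchy estimate is taken on the next circle: as [rad j = rad j.+1 ^+ 2], points of modulus
    [rad j] correspond to arguments of modulus [rad j.+1] in [lipschitz_of_circle]. Condition (I)
    compares [nu] on the two circles. *)
Lemma Hinf_diff_le : exists2 K, 0 <= K & forall f j z z', Hinf_set nu f ->
  normc z = rad R j -> normc z' = rad R j ->
  normc (f z' - f z) <= K * normc (z' - z) / (dy R j * nu (rad R j)%:C) * wnorm nu f.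
Proof.
have [c1 c10 H] := normalI_ratio nuN hI; have [be0 _] := hI.
(* 64 is the product of the 4 of [lipschitz_of_circle], the 8 in [1 / (1 - r) <= 8 / dy j] and the 2
   in [1 / r <= 2]. *)
exists (64 * (c1 * 8 `^ be)); first by rewrite mulr_ge0// mulr_ge0 ?powR_ge0// ltW.
move=> f j z z' hf zr z'r.
have af : analytic f by case: hf => -[].
have W0 := wnorm_ge0 hf.
set r := rad R j.+1; have r0 : 0 < r := rad_gt0 R _; have r1 : r < 1 := rad_lt1 R _.
have r12 : 1 / 2 <= r := rad_ge R _.
have rC : r%:C != 0 by rewrite -normc_gt0 normc_real gtr0_norm.
have nur : 0 < nu r%:C by apply: normal_gt0 => //; exact: rad_disk.
have nuj := nu_rad_gt0 nuN j.
have circ v : normc v = 1 -> normc (f (r%:C * v)) <= wnorm nu f / nu r%:C.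
  move=> v1; have rv : normc (r%:C * v) = r by rewrite normcM v1 mulr1 normc_radC.
  by rewrite -(nu_circle rv); apply: Hinf_le => //; exact: rad_circle_disk rv.
have rr : 0 < r < 1 by rewrite r0.
have K0 : 0 <= wnorm nu f / nu r%:C by rewrite divr_ge0// ltW.
have xr v : normc v = rad R j -> normc (v / r%:C) <= r.
  move=> vr; rewrite normcM normcV normc_radC vr ler_pdivrMr//.
  by rewrite -expr2 rad_sqr.
have := lipschitz_of_circle af rr K0 circ r1 (xr _ z'r) (xr _ zr).
rewrite ![r%:C * _]mulrC !divfK// -mulrBl normcM normcV normc_radC -/r => h.
apply: le_trans h _.
have nuE : (nu r%:C)^-1 <= c1 * 8 `^ be / nu (rad R j)%:C.
  have h := H _ _ (rad_disk R j) (rad_disk R j.+1).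
  rewrite !normc_radC in h; have {}h := h (rad_le R (leqnSn j)).
  have s1 : dy R j / 8 <= 1 - r by have := rad_sub_ge R j.+1; rewrite dyS -/r; lra.
  have s2 : 1 - rad R j <= dy R j by have := rad_sub_le R j; have := dy_gt0 R j; lra.
  have d0 := dy_gt0 R j.
  rewrite ler_pdivlMr// mulrC ler_pdivrMr//.
  have p1 : 0 < (1 - r) `^ be by rewrite powR_gt0// subr_gt0.
  have : nu (rad R j)%:C * (1 - r) `^ be <= c1 * nu r%:C * (8 `^ be * (1 - r) `^ be).
    apply: le_trans h _; rewrite -/r; apply: ler_wpM2l; first by rewrite mulr_ge0// ltW.
    rewrite -powRM//; last by rewrite subr_ge0 ltW.
    apply: powR_le_base; [exact: ltW|by rewrite subr_ge0 ltW// rad_lt1|lra].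
  rewrite mulrA ler_pM2r//; by rewrite [c1 * _ * nu _]mulrAC.
have s1 : dy R j / 8 <= 1 - r by have := rad_sub_ge R j.+1; rewrite dyS -/r; lra.
have d0 := dy_gt0 R j; have n0 := normc_ge0 (z' - z).
have i1 : (1 - r)^-1 <= 8 / dy R j.
  by rewrite -[8 / _]invf_div lef_pV2 ?posrE ?divr_gt0// subr_gt0.
have i2 : r^-1 <= 2 by rewrite -[2]invrK lef_pV2 ?posrE ?invr_gt0//; lra.
have i0 : 0 <= (1 - r)^-1 by rewrite invr_ge0 subr_ge0 ltW.
rewrite (_ : _ * _ = 4 * wnorm nu f * normc (z' - z) * ((nu r%:C)^-1 * ((1 - r)^-1 * r^-1))); last by ring.
apply: (@le_trans _ _ (4 * wnorm nu f * normc (z' - z) *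
   (c1 * 8 `^ be / nu (rad R j)%:C * (8 / dy R j * 2)))).
  apply: ler_wpM2l; first by rewrite !mulr_ge0.
  apply: ler_pM => //; [by rewrite invr_ge0 ltW|by rewrite mulr_ge0// invr_ge0 ltW|].
  by apply: ler_pM => //; rewrite invr_ge0 ltW.
by rewrite le_eqVlt; apply/orP; left; apply/eqP; field; rewrite !gt_eqF.
Qed.

Definition hz j (z w : C) : C := Lam j (conjc z * w).
Definition hz' j (z w : C) : C := conjc z * Lam' j (conjc z * w).

Lemma hz_cderiv j z w : normc z = rad R j -> disk w -> cderiv (hz j z) w (hz' j z w).
Proof.
move=> zr dw; apply: cderiv_scale; apply: (tame_cderiv (hLam j)).
by apply: normcM_lt1; [rewrite normcJE zr rad_lt1|exact: ltW].
Qed.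

Lemma rad_kernel_ge j z w : normc z = rad R j -> disk w ->
  dy R j / 4 <= normc (1 - conjc z * w).
Proof.
move=> zr dw; apply: le_trans (normc_sub1_ge _); apply: le_trans (rad_sub_ge R j) _.
rewrite lerD2l lerN2 normcM normcJE zr ler_piMr ?(ltW (rad_gt0 _ _))//.
exact: ltW.
Qed.

Lemma hz_bounded j z : normc z = rad R j ->
  exists K, forall w, disk w -> normc (hz j z w) <= K.
Proof.
move=> zr; exists (c * dy R j ^+ M * (4 / dy R j) ^+ M.+1) => w dw.
have d0 := dy_gt0 R j.
have zw : normc (conjc z * w) <= 1.
  by apply: ltW; apply: normcM_lt1; [rewrite normcJE zr rad_lt1|exact: ltW].
have T1 : 1 <= 4 / dy R j * normc (1 - conjc z * w).
  by rewrite mulrAC ler_pdivlMr// mul1r mulrC -ler_pdivrMr// rad_kernel_ge.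
have T0 : 0 < 4 / dy R j by rewrite divr_gt0.
by have [] := hLam j T0 zw zw T1 T1.
Qed.

Variables (phi : C -> C) (A : C -> R) (al : R) (b : nat -> nat -> R).
Hypotheses (self : forall z, disk z -> disk (phi z)).
Hypotheses (A0 : forall z, disk z -> 0 <= A z).
Hypotheses (hb : forall j k z, (k < 2 ^ j)%N -> disk z ->
  A z <= b j k * normc (1 - conjc (node R j k) * phi z) `^ (al + 3)).
Hypotheses (al1 : -1 < al) (alM : al + 1 <= M%:R).

Lemma b_ge0 j k : (k < 2 ^ j)%N -> 0 <= b j k.
Proof.
move=> kj; have := le_trans (A0 (disk0 R)) (hb kj (disk0 R)).
rewrite pmulr_lge0// powR_gt0//; apply: lt_le_trans (node_kernel_ge _ _ (self (disk0 R))).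
by rewrite divr_gt0// dy_gt0.
Qed.

(** [T] is a multiple of [1 / X], [X] being the kernel denominator at the node, and serves all
    points of the circle near the node. The bound of [A z] contributes [X ^ (al + 3)]; the remaining
    negative power [M - 1 - al] of [X] is estimated by [X >= dy j / 4], which is where [alM]
    enters. *)
Lemma tame_transfer E : 0 <= E -> exists2 K, 0 <= K & forall j k z, (k < 2 ^ j)%N -> disk z ->
  exists T : R, [/\ 0 < T, T <= K / dy R j,
    forall x, normc x = rad R j -> normc (x - node R j k) <= E * dy R j ->
      1 <= T * normc (1 - conjc x * phi z) &
    A z * (c * dy R j ^+ M * T ^+ M.+2) <= K * dy R j `^ (al + 1) * b j k].
Proof.
move=> E0; pose L := 1 + 4 * E; have L0 : 0 < L by rewrite /L; lra.
have K20 : 0 <= c * L ^+ M.+2 * 4 `^ (M%:R - 1 - al).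
  by rewrite mulr_ge0 ?powR_ge0// mulr_ge0// exprn_ge0// ltW.
exists (4 * L + c * L ^+ M.+2 * 4 `^ (M%:R - 1 - al)).
  by rewrite addr_ge0// mulr_ge0// ltW.
move=> j k z kj dz; set w := phi z; have dw : disk w by exact: self.
set X := normc (1 - conjc (node R j k) * w).
have d0 := dy_gt0 R j.
have Xd : dy R j / 4 <= X by exact: node_kernel_ge.
have d40 : 0 < dy R j / 4 by rewrite divr_gt0.
have X0 : 0 < X by exact: lt_le_trans Xd.
exists (L / X); split.
- by rewrite divr_gt0.
- apply: (@le_trans _ _ (4 * L / dy R j)); last first.
    by rewrite ler_pM2r ?invr_gt0// lerDl.
  rewrite ler_pdivrMr// mulrAC ler_pdivlMr// [4 * L]mulrC -mulrA ler_pM2l//.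
  by move: Xd; lra.
- move=> x xr xn; rewrite mulrAC ler_pdivlMr// mul1r.
  have Yd := rad_kernel_ge xr dw; set Y := normc _ in Yd *.
  apply: (@le_trans _ _ (Y + E * dy R j)); last first.
    have : E * dy R j <= E * (4 * Y) by rewrite ler_wpM2l//; lra.
    by rewrite /L; lra.
  apply: le_trans (_ : Y + normc (x - node R j k) <= _); last by rewrite lerD2l.
  rewrite /X (_ : 1 - conjc (node R j k) * w = (1 - conjc x * w) +
    conjc (x - node R j k) * w); last by rewrite conjcB; ring.
  apply: le_trans (normcD _ _) _; rewrite lerD2l normcM normcJE ler_piMr ?normc_ge0//.
  exact: ltW.
have b0 := b_ge0 kj.
apply: (@le_trans _ _ (c * L ^+ M.+2 * 4 `^ (M%:R - 1 - al) * dy R j `^ (al + 1) * b j k)); last first.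
  rewrite ler_wpM2r// ler_wpM2r ?powR_ge0// lerDr mulr_ge0// ltW//.
apply: (@le_trans _ _ ((b j k * X `^ (al + 3)) * (c * dy R j ^+ M * (L / X) ^+ M.+2))).
  rewrite ler_wpM2r//; last exact: hb.
  by rewrite mulr_ge0 ?exprn_ge0 ?divr_ge0 ?(ltW L0) ?(ltW X0)// mulr_ge0// exprn_ge0// ltW.
have XE : X `^ (al + 3) * X^-1 ^+ M.+2 = (X `^ (M%:R - 1 - al))^-1.
  rewrite exprVn -powR_mulrn ?(ltW X0)// -!powRN -powRD; last by rewrite (gt_eqF X0) implybT.
  by congr powR; rewrite -natr1 -natr1; ring.
have dE : dy R j ^+ M = dy R j `^ (al + 1) * dy R j `^ (M%:R - 1 - al).
  rewrite -powR_mulrn ?(ltW d0)// -powRD; last by rewrite (gt_eqF d0) implybT.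
  by congr powR; ring.
have XV : (X `^ (M%:R - 1 - al))^-1 <= 4 `^ (M%:R - 1 - al) / dy R j `^ (M%:R - 1 - al).
  rewrite -[_ / dy R j `^ _]invf_div lef_pV2 ?posrE ?divr_gt0 ?powR_gt0//.
  rewrite ler_pdivrMr ?powR_gt0// -powRM ?(ltW X0)//.
  by apply: powR_le_base; [move: alM; lra|exact: ltW|move: Xd; lra].
rewrite (_ : _ * _ = (b j k * (c * L ^+ M.+2) * dy R j ^+ M) * (X `^ (al + 3) * X^-1 ^+ M.+2)); last first.
  by rewrite exprMn; ring.
rewrite XE (_ : c * L ^+ M.+2 * _ * _ * _ = (b j k * (c * L ^+ M.+2) * dy R j ^+ M) *
  (4 `^ (M%:R - 1 - al) / dy R j `^ (M%:R - 1 - al))); last first.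
  by rewrite dE; field; rewrite gt_eqF// powR_gt0.
apply: ler_wpM2l XV; rewrite mulr_ge0 ?exprn_ge0 ?(ltW d0)// mulr_ge0//.
by rewrite mulr_ge0// exprn_ge0// ltW.
Qed.

(** The Lipschitz bound is the size bound times [|y - x| / dy j]: the factor [conjc x] changes by at
    most [|y - x|], and [Lam'] loses one more power of [T], which is at most a constant over
    [dy j]. *)
Lemma hz_estimates E : 0 <= E -> exists2 K, 0 <= K & forall j k z, (k < 2 ^ j)%N -> disk z ->
  (forall x, normc x = rad R j -> normc (x - node R j k) <= E * dy R j ->
     A z * normc (hz' j x (phi z)) <= K * dy R j `^ (al + 1) * b j k) /\
  (forall x y, normc x = rad R j -> normc (x - node R j k) <= E * dy R j ->
     normc y = rad R j -> normc (y - node R j k) <= E * dy R j ->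
     A z * normc (hz' j y (phi z) - hz' j x (phi z)) <=
       K * (normc (y - x) / dy R j) * dy R j `^ (al + 1) * b j k).
Proof.
move=> E0; have [K K0 H] := tame_transfer E0.
exists (K * (1 + K)); first by rewrite mulr_ge0// addr_ge0.
move=> j k z kj dz; have [T [T0 TK hT hA]] := H j k z kj dz.
have dw := self dz; set w := phi z in dw hT *; have d0 := dy_gt0 R j; have d1 := dy_le1 R j.
have Az := A0 dz.
have sm x : normc x = rad R j -> normc (conjc x * w) <= 1.
  by move=> xr; apply: ltW; apply: normcM_lt1; [rewrite normcJE xr rad_lt1|exact: ltW].
have rad1 : rad R j <= 1 by exact/ltW/rad_lt1.
have b0 := b_ge0 kj.
have D0 : 0 <= dy R j `^ (al + 1) * b j k by rewrite mulr_ge0 ?powR_ge0.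
have P0 : 0 <= c * dy R j ^+ M * T ^+ M.+2.
  by rewrite mulr_ge0 ?exprn_ge0 ?(ltW T0)// mulr_ge0// exprn_ge0// ltW.
split.
  move=> x xr xn; have Tx := hT _ xr xn.
  have [_ h _ _ _] := hLam j T0 (sm _ xr) (sm _ xr) Tx Tx.
  apply: le_trans (_ : A z * (c * dy R j ^+ M * T ^+ M.+2) <= _).
    rewrite ler_wpM2l// normcM normcJE xr; apply: le_trans h.
    by rewrite ler_piMl ?normc_ge0.
  apply: le_trans hA _; rewrite -!mulrA; apply: (ler_wpM2l K0).
  by apply: ler_peMl => //; rewrite lerDl.
move=> x y xr xn yr yn; have Tx := hT _ xr xn; have Ty := hT _ yr yn.
have [_ h1 _ _ _] := hLam j T0 (sm _ yr) (sm _ yr) Ty Ty.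
have [_ _ _ h2 _] := hLam j T0 (sm _ xr) (sm _ yr) Tx Ty.
set s := normc (y - x).
have s0 : 0 <= s by exact: normc_ge0.
have yx : normc (conjc y * w - conjc x * w) <= s.
  by rewrite -mulrBl -conjcB normcM normcJE ler_piMr ?normc_ge0// ltW.
set Q := c * dy R j ^+ M * T ^+ M.+2 in P0 hA h1.
have key : normc (hz' j y w - hz' j x w) <= s / dy R j * (1 + K) * Q.
  have -> : hz' j y w - hz' j x w = conjc (y - x) * Lam' j (conjc y * w) +
     conjc x * (Lam' j (conjc y * w) - Lam' j (conjc x * w)).
    by rewrite /hz' conjcB; ring.
  rewrite [X in _ <= X](_ : _ = s / dy R j * Q + s / dy R j * K * Q); last by ring.
  apply: le_trans (normcD _ _) _; apply: lerD.
    rewrite normcM normcJE -/s; apply: ler_pM; rewrite ?normc_ge0//.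
    by rewrite ler_pdivlMr// ler_piMr.
  rewrite normcM normcJE xr; apply: (@le_trans _ _ (c * dy R j ^+ M * s * T ^+ M.+3)).
    apply: (@le_trans _ _ (1 * (c * dy R j ^+ M * s * T ^+ M.+3))); last by rewrite mul1r.
    apply: ler_pM; rewrite ?normc_ge0 ?(ltW (rad_gt0 _ _))//.
    apply: le_trans h2 _; rewrite ler_wpM2r ?exprn_ge0 ?(ltW T0)// ler_wpM2l//.
    by rewrite mulr_ge0// exprn_ge0// ltW.
  rewrite [X in X <= _](_ : _ = s * T * Q); last by rewrite /Q (exprS T); ring.
  rewrite ler_wpM2r// -mulrA ler_wpM2l// mulrC; exact: TK.
apply: le_trans (_ : A z * (s / dy R j * (1 + K) * Q) <= _); first by rewrite ler_wpM2l.
rewrite mulrCA [X in _ <= X](_ : _ = (s / dy R j * (1 + K)) * (K * dy R j `^ (al + 1) * b j k)); last by ring.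
by rewrite ler_wpM2l// mulr_ge0 ?addr_ge0// divr_ge0// ltW.
Qed.

End RankOneTerms.

(** * Telescoping in the number of sample points *)

Section Expansion.
Variable R : realType.
Local Notation C := (R[i]).

(** Dominated convergence along the diagonal: the same [n] truncates the sum over layers and sets
    the number of roots. The terms past [J] contribute at most [2 * B * dy J], uniformly in [n]. *)
Lemma clim_dominated (u : nat -> nat -> C) (D : nat -> C) l (B : R) : 0 <= B ->
  clim (fun J => \sum_(j < J) D j) l -> (forall j, clim (u j) (D j)) ->
  (forall j n, normc (u j n) <= B * dy R j) -> clim (fun n => \sum_(j < n) u j n) l.
Proof.
move=> B0 Dl uD uB e e0; have e3 : 0 < e / 3 by rewrite divr_gt0.
have [J1 HJ1] := Dl _ e3; have [J2 HJ2] := expr2_small (B * 2) e3.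
pose J := maxn J1 J2.
have [N HN] := clim_sum (index_enum 'I_J) (fun j : 'I_J => uD j) e3.
exists (maxn N J) => n; rewrite geq_max => /andP[nN nJ].
have tail m : normc (\sum_(j < J + m) u j n - \sum_(j < J) u j n) <= B * (2 * dy R J - 2 * dy R (J + m)).
  elim: m => [|m ih]; first by rewrite addn0 !subrr mulr0 normc0.
  rewrite addnS big_ord_recr /= addrAC; apply: le_trans (normcD _ _) _.
  apply: le_trans (lerD ih (uB _ _)) _.
  by rewrite -mulrDr dyS ler_wpM2l//; lra.
have := tail (n - J)%N; rewrite subnKC// => {}tail.
rewrite (_ : _ - l = (\sum_(j < n) u j n - \sum_(j < J) u j n) +
  (\sum_(j < J) u j n - \sum_(j < J) D j) + (\sum_(j < J) D j - l)); last by ring.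
have -> : e = e / 3 + e / 3 + e / 3 by field.
apply: le_trans (normcD _ _) _; apply: lerD; last by apply: HJ1; exact: leq_maxl.
apply: le_trans (normcD _ _) _; apply: lerD; last exact: HN.
apply: le_trans tail _; apply: le_trans (HJ2 J (leq_maxr _ _)).
rewrite -mulrA ler_wpM2l// -/(dy R J).
by have := dy_gt0 R n; lra.
Qed.

Lemma sum_divn (V : nmodType) (F : nat -> V) N m :
  \sum_(k < N * 2 ^ m) F (k %/ 2 ^ m)%N = (\sum_(k < N) F k) *+ (2 ^ m).
Proof.
elim: m => [|m ih].
  by rewrite expn0 muln1 mulr1n; apply: eq_bigr => k _; rewrite divn1.
rewrite expnS mulnCA mul2n (sum_double (fun k => F (k %/ (2 * 2 ^ m))%N)).
have E k : (k.*2 %/ (2 * 2 ^ m) = k %/ 2 ^ m)%N by rewrite -mul2n divnMl.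
have O k : (k.*2.+1 %/ (2 * 2 ^ m) = k %/ 2 ^ m)%N.
  by rewrite divnMA -addn1 -muln2 divnMDl// addn0.
rewrite (eq_bigr (fun k : 'I_(N * 2 ^ m) => F (k %/ 2 ^ m)%N)); last by move=> k _; rewrite E.
rewrite [X in _ + X](eq_bigr (fun k : 'I_(N * 2 ^ m) => F (k %/ 2 ^ m)%N)); last by move=> k _; rewrite O.
by rewrite ih -mulrnDr addnn -mul2n.
Qed.

(** The inner sums [U] satisfy [U n.+1 = U n / 2 + V n.+1]: a convolution with the sequence [2^-m],
    whose total mass is 2. *)
Lemma halving_sums (V : nat -> R) (W : R) : (forall j, 0 <= V j) ->
  (forall J, \sum_(j < J) V j <= W) ->
  forall N, \sum_(n < N) \sum_(j < n.+1) dy R (n - j) * V j <= 2 * W.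
Proof.
move=> V0 VW N; pose U n := \sum_(j < n.+1) dy R (n - j) * V j.
have U0 n : 0 <= U n by rewrite sumr_ge0// => j _; rewrite mulr_ge0// ltW// dy_gt0.
have US n : U n.+1 = U n / 2 + V n.+1.
  rewrite /U big_ord_recr /= subnn /dy expr0 invr1 mul1r; congr (_ + _).
  rewrite mulr_suml; apply: eq_bigr => j _.
  by rewrite subSn ?exprS ?invfM -1?ltnS//; ring.
have key m : \sum_(n < m.+1) U n + U m = 2 * \sum_(j < m.+1) V j.
  elim: m => [|m ih].
    by rewrite !big_ord1 /U big_ord1 subnn /dy expr0 invr1 mul1r; ring.
  by rewrite big_ord_recr [in RHS]big_ord_recr /= mulrDr -ih US; field.
case: N => [|m].
  by rewrite big_ord0; have := VW 0%N; rewrite big_ord0; lra.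
have := VW m.+1; have := key m; have := U0 m; rewrite /U; lra.
Qed.

(* The rank one operator [f |-> tc * (f ta - te * f tb) * th]; [th'] is the
   derivative of [th], and [td], [ts] are bounds for its two factors. *)
Record term := Term { tc : C; ta : C; te : C; tb : C; th : C -> C; th' : C -> C; td : R; ts : R }.

Definition tapp t (f : C -> C) : C := tc t * (f (ta t) - te t * f (tb t)).

Definition tvalid (nu A : C -> R) (phi : C -> C) t :=
  [/\ disk (ta t), disk (tb t), forall w, disk w -> cderiv (th t) w (th' t w) &
      exists K, forall w, disk w -> normc (th t w) <= K] /\
  [/\ 0 <= td t, 0 <= ts t,
    forall f, Hinf_set nu f -> normc (tapp t f) <= td t * wnorm nu f &
    forall z, disk z -> A z * normc (th' t (phi z)) <= ts t].

Section Blocks.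
Variables (nu : C -> R) (be : R).
Hypotheses (nuN : normal nu) (hI : normalI nu be).
Variables (M : nat) (Lam Lam' : nat -> C -> C) (c : R).
Hypotheses (c0 : 0 <= c) (hLam : forall j, tame_with (Lam j) (Lam' j) M.+1 (c * dy R j ^+ M)).
Hypothesis Mbe : be + 1 <= M%:R.

(** Condition (I) lets [f] grow at most like [dy j ^ (- be)] on circle [j], while the kernel
    contributes [dy j ^+ M]; by [Mbe] one factor [dy j] is left for the sum over [j]. *)
Lemma node_mean_dominated f w : Hinf_set nu f -> disk w -> exists2 B, 0 <= B &
  forall j n, normc (node_mean f (Lam' j) j n w) <= B * dy R j.
Proof.
move=> hf dw; have [c1 c10 H] := normalI_ratio nuN hI; have [be0 _] := hI.
have w1 : normc w < 1 by []. have W0 := wnorm_ge0 nuN hf.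
have nu0 : 0 < nu 0 by apply: normal_gt0 => //; exact: disk0.
pose T := (1 - normc w)^-1.
have T0 : 0 < T by rewrite invr_gt0 subr_gt0.
have TM : 0 <= T ^+ M.+2 by rewrite exprn_ge0// ltW.
have P0 : 0 <= wnorm nu f * (c1 * 4 `^ be / nu 0) * (c * T ^+ M.+2).
  apply: mulr_ge0; last exact: mulr_ge0.
  by apply: mulr_ge0 => //; rewrite divr_ge0 ?(ltW nu0)// mulr_ge0 ?powR_ge0// ltW.
exists (wnorm nu f * (c1 * 4 `^ be / nu 0) * (c * T ^+ M.+2)) => //.
move=> j n; apply: le_trans (normc_cmean _ _) _.
have d0 := dy_gt0 R j; have d1 := dy_le1 R j.
have nuj := nu_rad_gt0 nuN j.
have nuE : (nu (rad R j)%:C)^-1 <= c1 * 4 `^ be / nu 0 * (dy R j `^ be)^-1.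
  have h := H _ _ (disk0 R) (rad_disk R j).
  rewrite normc0 normc_radC subr0 powR1 mulr1 in h; have {}h := h (ltW (rad_gt0 R j)).
  have s1 := rad_sub_ge R j.
  have p1 : 0 < (dy R j / 4) `^ be by rewrite powR_gt0// divr_gt0.
  have E : dy R j `^ be = 4 `^ be * (dy R j / 4) `^ be.
    by rewrite -powRM ?divr_ge0 ?(ltW d0)// mulrC divfK.
  have -> : c1 * 4 `^ be / nu 0 * (dy R j `^ be)^-1 = c1 / (nu 0 * (dy R j / 4) `^ be).
    have p4 : 0 < 4 `^ be :> R by rewrite powR_gt0.
    by rewrite E; field; rewrite ?(gt_eqF nu0) ?(gt_eqF p1) ?(gt_eqF p4).
  rewrite ler_pdivlMr ?mulr_gt0// mulrC ler_pdivrMr//; apply: le_trans h.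
  rewrite ler_wpM2l ?(ltW nu0)//; apply: powR_le_base; [exact: ltW|by rewrite divr_ge0// ltW|lra].
apply: le_trans (rmean_le _ (G := fun=> wnorm nu f * (c1 * 4 `^ be / nu 0) * (c * T ^+ M.+2) * dy R j) _) _; last by rewrite rmean_cst.
move=> z z1; set x := (rad R j)%:C * z.
have xr : normc x = rad R j by rewrite normcM z1 mulr1 normc_radC.
have xw : normc (conjc x * w) <= normc w.
  by rewrite normcM normcJE xr ler_piMl ?normc_ge0// ltW// rad_lt1.
have T1 : 1 <= T * normc (1 - conjc x * w).
  rewrite mulrC ler_pdivlMr ?subr_gt0// mul1r.
  by apply: le_trans (normc_sub1_ge _); rewrite lerD2l lerN2.
have x1 : normc (conjc x * w) <= 1 by rewrite (le_trans xw)// ltW.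
have [_ h _ _ _] := hLam j T0 x1 x1 T1 T1.
have fx : normc (f x) <= wnorm nu f * (c1 * 4 `^ be / nu 0 * (dy R j `^ be)^-1).
  apply: le_trans (Hinf_le nuN hf (rad_circle_disk xr)) _.
  by rewrite (nu_circle nuN xr) ler_wpM2l.
rewrite !normcM normcJE xr.
have dM : dy R j ^+ M / dy R j `^ be <= dy R j.
  rewrite -powR_mulrn ?(ltW d0)// -powRN -powRD; last by rewrite (gt_eqF d0) implybT.
  rewrite -[leRHS](powRr1 (ltW d0)); apply: ger_powR; first by rewrite d0.
  by move: Mbe; lra.
apply: (@le_trans _ _ (wnorm nu f * (c1 * 4 `^ be / nu 0 * (dy R j `^ be)^-1) *
   (1 * (c * dy R j ^+ M * T ^+ M.+2)))).
  apply: ler_pM; rewrite ?mulr_ge0 ?normc_ge0 ?(ltW (rad_gt0 _ _))//.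
  by apply: ler_pM; rewrite ?normc_ge0 ?(ltW (rad_gt0 _ _)) ?(ltW (rad_lt1 _ _)).
rewrite [X in X <= _](_ : _ = wnorm nu f * (c1 * 4 `^ be / nu 0) * (c * T ^+ M.+2) *
  (dy R j ^+ M / dy R j `^ be)); last by ring.
exact: ler_wpM2l.
Qed.

Variables (phi : C -> C) (A : C -> R) (al : R) (b : nat -> nat -> R).
Hypotheses (self : forall z, disk z -> disk (phi z)).
Hypotheses (A0 : forall z, disk z -> 0 <= A z).
Hypotheses (hb : forall j k z, (k < 2 ^ j)%N -> disk z ->
  A z <= b j k * normc (1 - conjc (node R j k) * phi z) `^ (al + 3)).
Hypotheses (al1 : -1 < al) (alM : al + 1 <= M%:R).

(** Circle [j] sampled at [2 ^ n] roots, with [n] possibly much larger than [j]; the quotient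
    [k %/ 2 ^ (n - j)] is the index of the lattice node just before it on the circle. *)
Definition fine_node j n k : C := (rad R j)%:C * root2 R n k.

Lemma normc_fine_node j n k : normc (fine_node j n k) = rad R j.
Proof. by rewrite normcM normc_root2 mulr1 normc_radC. Qed.

Lemma fine_node_close j n k : (j <= n)%N ->
  normc (fine_node j n k - node R j (k %/ 2 ^ (n - j))) <= 4 * pi * dy R j.
Proof.
move=> jn; rewrite /fine_node /node -mulrBr normcM normc_radC.
have pi0 : 0 <= pi :> R by exact: pi_ge0.
have d0 := dy_gt0 R j.
have D : normc (root2 R n k - root2 R j (k %/ 2 ^ (n - j))) <= 4 * pi * dy R j.
  apply: le_trans (cis_lipschitz _ _) _; rewrite ler_wpM2l ?mulr_ge0//.
  have e2 : 0 < 2 ^+ (n - j) :> R by rewrite exprn_gt0.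
  have e1 : 0 < 2 ^+ j :> R by rewrite exprn_gt0.
  have nE : 2 ^+ n = 2 ^+ (n - j) * 2 ^+ j :> R by rewrite -exprD subnK.
  set q := (k %/ _)%N; set r := (k %% 2 ^ (n - j))%N.
  have kE : k%:R = q%:R * 2 ^+ (n - j) + r%:R :> R.
    by rewrite -natrX -natrM -natrD /q /r -divn_eq.
  have -> : k%:R / 2 ^+ n - q%:R / 2 ^+ j = r%:R / 2 ^+ n :> R.
    by rewrite nE kE; field; rewrite !gt_eqF.
  rewrite ger0_norm ?divr_ge0 ?exprn_ge0// nE invfM mulrA -/(dy R j).
  rewrite ler_piMl ?(ltW d0)// ler_pdivrMr// mul1r -natrX ler_nat ltnW//.
  by rewrite ltn_mod expn_gt0.
by apply: le_trans D; rewrite ler_piMl ?normc_ge0// ltW// rad_lt1.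
Qed.

Lemma fine_node_step j n k :
  normc (fine_node j n.+1 k.*2.+1 - fine_node j n k) <= 4 * pi * dy R n.+1.
Proof.
have pi0 : 0 <= pi :> R by exact: pi_ge0.
rewrite /fine_node -mulrBr normcM normc_radC.
have D : normc (root2 R n.+1 k.*2.+1 - root2 R n k) <= 4 * pi * dy R n.+1.
  rewrite -(root2S_even R n k); apply: le_trans (cis_lipschitz _ _) _.
  rewrite ler_wpM2l ?mulr_ge0// -mulrBl -natr1 addrAC subrr add0r div1r.
  by rewrite ger0_norm// invr_ge0 exprn_ge0.
by apply: le_trans D; rewrite ler_piMl ?normc_ge0// ltW// rad_lt1.
Qed.

Variables (K1 K2 : R).
Hypotheses (K10 : 0 <= K1) (K20 : 0 <= K2).
Hypothesis HK1 : forall f j z z', Hinf_set nu f -> normc z = rad R j -> normc z' = rad R j ->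
  normc (f z' - f z) <= K1 * normc (z' - z) / (dy R j * nu (rad R j)%:C) * wnorm nu f.
Hypothesis HK2 : forall j k z, (k < 2 ^ j)%N -> disk z ->
  (forall x, normc x = rad R j -> normc (x - node R j k) <= 8 * pi * dy R j ->
     A z * normc (hz' Lam' j x (phi z)) <= K2 * dy R j `^ (al + 1) * b j k) /\
  (forall x y, normc x = rad R j -> normc (x - node R j k) <= 8 * pi * dy R j ->
     normc y = rad R j -> normc (y - node R j k) <= 8 * pi * dy R j ->
     A z * normc (hz' Lam' j y (phi z) - hz' Lam' j x (phi z)) <=
       K2 * (normc (y - x) / dy R j) * dy R j `^ (al + 1) * b j k).

(* A variable, so that simplification does not unfold [pi]. *)
Variables (L : R) (LE : L = 4 * pi).

Let L0 : 0 <= L. Proof. by rewrite LE mulr_ge0// pi_ge0. Qed.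

Let base j n k := (k %/ 2 ^ (n - j))%N.
Let bw j k := dy R j `^ (al + 1) * b j k.

(** For neighbouring roots [x], [x'] the increment [f x' h x' - f x h x] is split as
    [(f x' - f x) h x' + f x (h x' - h x)]. [term_point] is the first part and [term_kernel] the
    second; each has one factor with the gain [dy n.+1 / dy j]. *)
Definition term_point n j k : term :=
  Term (dy R n.+1)%:C (fine_node j n.+1 k.*2.+1) 1 (fine_node j n k)
    (hz Lam j (fine_node j n.+1 k.*2.+1)) (hz' Lam' j (fine_node j n.+1 k.*2.+1))
    (dy R n.+1 * (K1 * (L * dy R n.+1) / (dy R j * nu (rad R j)%:C)))
    (K2 * dy R j `^ (al + 1) * b j (base j n k)).

Definition term_kernel n j k : term :=
  Term (dy R n.+1)%:C (fine_node j n k) 0 0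
    (fun w => hz Lam j (fine_node j n.+1 k.*2.+1) w - hz Lam j (fine_node j n k) w)
    (fun w => hz' Lam' j (fine_node j n.+1 k.*2.+1) w - hz' Lam' j (fine_node j n k) w)
    (dy R n.+1 / nu (rad R j)%:C)
    (K2 * (L * dy R n.+1 / dy R j) * dy R j `^ (al + 1) * b j (base j n k)).

(** Layer [n] enters in block [n], sampled at once at [2 ^ n.+1] roots. Here, as in [term_kernel],
    the second point carries the coefficient 0 and is set to the origin. *)
Definition term_new n k : term :=
  Term (dy R n.+1)%:C (fine_node n n.+1 k) 0 0
    (hz Lam n (fine_node n n.+1 k)) (hz' Lam' n (fine_node n n.+1 k))
    (dy R n.+1 / nu (rad R n)%:C) (K2 * dy R n `^ (al + 1) * b n (base n n.+1 k)).

Definition block n : seq term :=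
  [seq term_point n j k | j <- index_iota 0 n, k <- index_iota 0 (2 ^ n)] ++
  [seq term_kernel n j k | j <- index_iota 0 n, k <- index_iota 0 (2 ^ n)] ++
  [seq term_new n k | k <- index_iota 0 (2 ^ n.+1)].

Lemma sum_block (V : nmodType) (F : term -> V) n : \sum_(t <- block n) F t =
  \sum_(j < n) \sum_(k < 2 ^ n) F (term_point n j k) +
  (\sum_(j < n) \sum_(k < 2 ^ n) F (term_kernel n j k) + \sum_(k < 2 ^ n.+1) F (term_new n k)).
Proof.
rewrite !big_cat !big_allpairs_dep big_map /= !big_mkord.
by congr (_ + (_ + _)); apply: eq_bigr => j _; rewrite big_mkord.
Qed.

Lemma base_lt j n k : (j <= n)%N -> (k < 2 ^ n)%N -> (base j n k < 2 ^ j)%N.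
Proof. by move=> jn kn; rewrite ltn_divLR ?expn_gt0// -expnD subnKC. Qed.

Let nu_rad_pos j : 0 < nu (rad R j)%:C := nu_rad_gt0 nuN j.

Let fine_disk j n k : disk (fine_node j n k).
Proof. exact: rad_circle_disk (normc_fine_node j n k). Qed.

Let close1 j n k : (j <= n)%N ->
  normc (fine_node j n k - node R j (base j n k)) <= 8 * pi * dy R j.
Proof.
move=> jn; apply: le_trans (fine_node_close k jn) _.
by rewrite ler_wpM2r ?(ltW (dy_gt0 _ _))// ler_wpM2r ?pi_ge0// ler_nat.
Qed.

Let close2 j n k : (j <= n)%N ->
  normc (fine_node j n.+1 k.*2.+1 - node R j (base j n k)) <= 8 * pi * dy R j.
Proof.
move=> jn; apply: le_trans (normc_dist_tri (fine_node j n k) _ _) _.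
rewrite (_ : 8 * pi * _ = 4 * pi * dy R j + 4 * pi * dy R j); last by ring.
apply: lerD; last exact: fine_node_close.
apply: le_trans (fine_node_step j n k) _.
by rewrite ler_wpM2l ?mulr_ge0 ?pi_ge0// dy_le// (leq_trans jn).
Qed.

Let dy_norm n : normc (dy R n)%:C = dy R n.
Proof. by rewrite normc_real gtr0_norm// dy_gt0. Qed.

Let point_le f n x j : Hinf_set nu f -> normc x = rad R j ->
  normc ((dy R n)%:C * (f x - 0 * f 0)) <= dy R n / nu (rad R j)%:C * wnorm nu f.
Proof.
move=> hf xr; rewrite mul0r subr0 normcM dy_norm -mulrA ler_wpM2l ?(ltW (dy_gt0 _ _))//.
by rewrite mulrC -(nu_circle nuN xr); apply: Hinf_le => //; exact: rad_circle_disk xr.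
Qed.

Let b_base_ge0 j n k : (j <= n)%N -> (k < 2 ^ n)%N -> 0 <= b j (base j n k).
Proof. by move=> jn kn; apply: (b_ge0 self A0 hb); exact: base_lt. Qed.

Lemma term_point_valid n j k : (j < n)%N -> (k < 2 ^ n)%N -> tvalid nu A phi (term_point n j k).
Proof.
move=> jn kn; have d0 i : 0 < dy R i := dy_gt0 R i.
split; split => //=.
- by move=> w; apply: (hz_cderiv hLam); exact: normc_fine_node.
- exact: (hz_bounded hLam (normc_fine_node _ _ _)).
- apply: mulr_ge0; first exact: ltW.
  apply: divr_ge0; first by rewrite !mulr_ge0 ?(ltW (d0 _)).
  by rewrite mulr_ge0 ?(ltW (d0 _)) ?(ltW (nu_rad_gt0 nuN _)).
- by rewrite !mulr_ge0 ?powR_ge0// b_base_ge0// ltnW.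
- move=> f hf; rewrite /tapp /= mul1r normcM dy_norm -mulrA ler_wpM2l ?(ltW (d0 _))//.
  apply: le_trans (HK1 hf (normc_fine_node _ _ _) (normc_fine_node _ _ _)) _.
  rewrite ler_wpM2r ?(wnorm_ge0 nuN)// ler_wpM2r ?invr_ge0 ?mulr_ge0 ?(ltW (d0 _)) ?(ltW (nu_rad_gt0 nuN _))//.
  by rewrite ler_wpM2l// LE fine_node_step.
- move=> z dz; have [h _] := HK2 (base_lt (ltnW jn) kn) dz.
  by apply: h; [exact: normc_fine_node|exact/close2/ltnW].
Qed.

Lemma term_kernel_valid n j k : (j < n)%N -> (k < 2 ^ n)%N -> tvalid nu A phi (term_kernel n j k).
Proof.
move=> jn kn; have d0 i : 0 < dy R i := dy_gt0 R i.
have bp := b_base_ge0 (ltnW jn) kn.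
split; split => //=.
- exact: disk0.
- by move=> w dw; apply: cderivB; apply: (hz_cderiv hLam) => //; exact: normc_fine_node.
- have [B1 h1] := hz_bounded hLam (normc_fine_node j n.+1 k.*2.+1).
  have [B2 h2] := hz_bounded hLam (normc_fine_node j n k).
  by exists (B1 + B2) => w dw; apply: le_trans (normcB _ _) _; rewrite lerD ?h1 ?h2.
- by rewrite divr_ge0 ?(ltW (d0 _)) ?(ltW (nu_rad_gt0 nuN _)).
- by rewrite !mulr_ge0 ?powR_ge0 ?invr_ge0 ?(ltW (d0 _)).
- by move=> f hf; apply: point_le => //; exact: normc_fine_node.
- move=> z dz; have [_ h] := HK2 (base_lt (ltnW jn) kn) dz.
  have := h _ _ (normc_fine_node j n k) (close1 _ (ltnW jn))
    (normc_fine_node j n.+1 k.*2.+1) (close2 _ (ltnW jn)).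
  move=> /le_trans; apply; rewrite ler_wpM2r// ler_wpM2r ?powR_ge0// ler_wpM2l//.
  by rewrite ler_wpM2r ?invr_ge0 ?(ltW (d0 _))// LE fine_node_step.
Qed.

Lemma term_new_valid n k : (k < 2 ^ n.+1)%N -> tvalid nu A phi (term_new n k).
Proof.
move=> kn; have d0 i : 0 < dy R i := dy_gt0 R i.
have bp := b_base_ge0 (leqnSn n) kn.
split; split => //=.
- exact: disk0.
- by move=> w; apply: (hz_cderiv hLam); exact: normc_fine_node.
- exact: (hz_bounded hLam (normc_fine_node _ _ _)).
- by rewrite divr_ge0 ?(ltW (d0 _)) ?(ltW (nu_rad_gt0 nuN _)).
- by rewrite !mulr_ge0 ?powR_ge0.
- by move=> f hf; apply: point_le => //; exact: normc_fine_node.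
- move=> z dz; have [h _] := HK2 (base_lt (leqnSn n) kn) dz.
  by apply: h; [exact: normc_fine_node|exact: close1].
Qed.

Lemma block_valid n : all (fun t => `[< tvalid nu A phi t >]) (block n).
Proof.
rewrite !all_cat; apply/and3P; split.
- apply/all_allpairsP => j k; rewrite !mem_index_iota => /andP[_ jn] /andP[_ kn].
  by apply/asboolP; exact: term_point_valid.
- apply/all_allpairsP => j k; rewrite !mem_index_iota => /andP[_ jn] /andP[_ kn].
  by apply/asboolP; exact: term_kernel_valid.
- rewrite all_map; apply/allP => k; rewrite mem_index_iota => /andP[_ kn].
  by apply/asboolP; exact: term_new_valid.
Qed.

(** A Riemann sum over the nodes of level [j] for the integral defining N_alpha: [dy j ^ 2] for the
    area of a cell, [dy j ^ al / nu] for the density, [b j k] for the supremum. *)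
Definition layer_mass j := dy R j `^ (al + 2) / nu (rad R j)%:C * \sum_(k < 2 ^ j) b j k.

Lemma layer_massE j :
  layer_mass j = dy R j * (dy R j `^ (al + 1) / nu (rad R j)%:C * \sum_(k < 2 ^ j) b j k).
Proof.
have d0 := dy_gt0 R j; rewrite /layer_mass.
have -> : dy R j `^ (al + 2) = dy R j * dy R j `^ (al + 1).
  rewrite -{2}(powRr1 (ltW d0)) -powRD; last by rewrite (gt_eqF d0) implybT.
  by congr powR; ring.
by ring.
Qed.

Lemma layer_mass_ge0 j : 0 <= layer_mass j.
Proof.
rewrite /layer_mass mulr_ge0// ?divr_ge0 ?powR_ge0 ?(ltW (nu_rad_gt0 nuN _))//.
by rewrite sumr_ge0// => k _; apply: (b_ge0 self A0 hb).
Qed.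

(** Layer [j] has [2 ^ n] increments, each with weight [dy n.+1] and gain [dy n.+1 / dy j], and each
    [b j k] is used [2 ^ (n - j)] times; altogether [dy (n - j)] times the layer mass. *)
Lemma block_sum_le n : \sum_(t <- block n) td t * ts t <=
  K2 * ((K1 + 1) * L + 1) * \sum_(j < n.+1) dy R (n - j) * layer_mass j.
Proof.
have d0 i : 0 < dy R i := dy_gt0 R i.
rewrite sum_block addrA -big_split /=.
rewrite [in X in _ <= X]big_ord_recr /= subnn.
have -> : dy R 0 = 1 by rewrite /dy expr0 invr1.
rewrite mul1r [in X in _ <= X]mulrDr.
apply: lerD; last first.
  have -> : \sum_(k < 2 ^ n.+1) dy R n.+1 / nu (rad R n)%:C * (K2 * dy R n `^ (al + 1) * b n (base n n.+1 k)) =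
      dy R n.+1 / nu (rad R n)%:C * (K2 * dy R n `^ (al + 1)) * ((\sum_(k < 2 ^ n) b n k) *+ 2 ^ 1).
    rewrite -(sum_divn (fun k => b n k)).
    rewrite -expnD addn1 mulr_sumr; apply: eq_bigr => k _.
    by rewrite /base subSnn expn1; ring.
  rewrite (_ : _ * _ = K2 * layer_mass n).
    rewrite ler_wpM2r ?layer_mass_ge0// ler_peMr// lerDr mulr_ge0// addr_ge0//.
  by rewrite layer_massE dyS expn1 -(mulr_natr (\sum_(k < 2 ^ n) b n k)); field; rewrite gt_eqF.
rewrite mulr_sumr; apply: ler_sum => j _; rewrite -big_split /=.
have jn : (j <= n)%N by exact: ltnW.
have nuj := nu_rad_gt0 nuN j.
pose X := dy R n.+1 * (L * dy R n.+1) / (dy R j * nu (rad R j)%:C) * (K1 + 1) * K2 *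
  dy R j `^ (al + 1).
rewrite (eq_bigr (fun k : 'I_(2 ^ n) => X * b j (base j n k))); last first.
  by move=> k _; rewrite /X; field; rewrite !gt_eqF.
rewrite -mulr_sumr.
have -> : \sum_(k < 2 ^ n) b j (base j n k) = (\sum_(k < 2 ^ j) b j k) *+ (2 ^ (n - j)).
  by rewrite -(sum_divn (fun k => b j k)) -expnD subnKC.
have dn : dy R n = dy R (n - j) * dy R j.
  by rewrite /dy -invfM -exprD subnK.
have -> : X * ((\sum_(k < 2 ^ j) b j k) *+ 2 ^ (n - j)) =
    (K1 + 1) * (L / 4) * K2 * (dy R (n - j) * layer_mass j).
  rewrite layer_massE -(mulr_natr (\sum_(k < 2 ^ j) b j k)) natrX /X dyS dn.
  have -> : 2 ^+ (n - j) = (dy R (n - j))^-1 :> R by rewrite /dy invrK.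
  by field; rewrite !gt_eqF.
have Z0 : 0 <= dy R (n - j) * layer_mass j.
  by apply: mulr_ge0; [exact: ltW|exact: layer_mass_ge0].
apply: (ler_wpM2r Z0).
have Y0 : 0 <= (K1 + 1) * L * K2 by rewrite !mulr_ge0// addr_ge0.
rewrite (_ : (K1 + 1) * (L / 4) * K2 = (K1 + 1) * L * K2 / 4); last by field.
rewrite (_ : K2 * ((K1 + 1) * L + 1) = (K1 + 1) * L * K2 + K2); last by ring.
have K2' := K20; apply: (@le_trans _ _ ((K1 + 1) * L * K2)); last by rewrite lerDl.
by rewrite ler_pdivrMr// ler_peMr// ler1n.
Qed.

Let partial f n w := \sum_(j < n) node_mean f (Lam' j) j n w.

(** Doubling the number of roots halves their weights, so a mean changes by [dy n.+1] times the sum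
    of the differences between each new root and its old neighbour. *)
Lemma block_telescope f n w :
  \sum_(t <- block n) tapp t f * th' t w = partial f n.+1 w - partial f n w.
Proof.
pose G j m k := f (fine_node j m k) * hz' Lam' j (fine_node j m k) w.
have nmE j m : node_mean f (Lam' j) j m w = (dy R m)%:C * \sum_(k < 2 ^ m) G j m k by [].
have dC : (dy R n)%:C = (dy R n.+1)%:C * 2 :> C.
  have h2 : (2^-1 : R)%:C * 2 = 1 :> C.
    by rewrite -[X in _ * X](rmorph_nat (real_complex R)) -rmorphM mulVf ?rmorph1.
  by rewrite dyS rmorphM -mulrA h2 mulr1.
have nmS j : node_mean f (Lam' j) j n.+1 w = (dy R n.+1)%:C *
    (\sum_(k < 2 ^ n) G j n k + \sum_(k < 2 ^ n) G j n.+1 k.*2.+1).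
  rewrite nmE expnS mul2n (sum_double (G j n.+1)); congr (_ * (_ + _)).
  by apply: eq_bigr => k _; rewrite /G /fine_node root2S_even.
rewrite sum_block /partial big_ord_recr /= addrAC addrA -sumrB; congr (_ + _).
  rewrite -big_split; apply: eq_bigr => j _; rewrite nmS nmE dC.
  rewrite -mulrA -mulrBr mulr_natl mulr2n.
  rewrite (_ : _ - _ = \sum_(k < 2 ^ n) (G j n.+1 k.*2.+1 - G j n k)); last by rewrite sumrB; ring.
  rewrite mulr_sumr -big_split; apply: eq_bigr => k _; rewrite /tapp /G /=.
  by ring.
rewrite nmE mulr_sumr; apply: eq_bigr => k _; rewrite /tapp /G /=.
by ring.
Qed.

Hypothesis reprod : forall f w, analytic f -> disk w -> exists D : nat -> C,
    clim (fun J => \sum_(j < J) D j) (derive1 f w) /\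
    forall j, clim (fun n => node_mean f (Lam' j) j n w) (D j).

(** The blocks are concatenated into one sequence. The partial sums are identified only at the ends
    [N i] of blocks, which suffices because the terms are absolutely summable. *)
Lemma expansion_blocks (W : R) : (forall J, \sum_(j < J) layer_mass j <= W) ->
  exists (t : nat -> term) (N : nat -> nat) (W' : R),
  [/\ forall m, tvalid nu A phi (t m), forall m, \sum_(i < m) td (t i) * ts (t i) <= W',
    forall i, (i <= N i)%N &
    forall f w, Hinf_set nu f -> disk w ->
      clim (fun i => \sum_(m < N i) tapp (t m) f * th' (t m) w) (derive1 f w)].
Proof.
move=> HW; pose bl i := flatten [seq block n | n <- iota 0 i].
have LS i : bl i.+1 = bl i ++ block i.
  by rewrite /bl -addn1 iotaD map_cat flatten_cat /= cats0.
have bsz n : (0 < size (block n))%N.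
  by rewrite !size_cat size_map size_iota subn0 addnA addn_gt0 expn_gt0 orbT.
have Lsz i : (i <= size (bl i))%N.
  elim: i => [//|i ih]; rewrite LS size_cat -addn1.
  by apply: leq_add => //; exact: bsz.
(* Blocks are nonempty, so the first [m.+1] of them have more than [m] entries and the default [t0]
   is never reached. *)
pose t0 := term_new 0 0; pose t m := nth t0 (bl m.+1) m.
have Lnth i k m : (m < size (bl i))%N -> nth t0 (bl (i + k)%N) m = nth t0 (bl i) m.
  move=> mi; elim: k => [|k ih]; first by rewrite addn0.
  rewrite addnS LS nth_cat ih; case: ifP => // /negbT; rewrite -leqNgt => h.
  suff : (size (bl i) <= size (bl (i + k)%N))%N by rewrite leqNgt (leq_ltn_trans h mi).
  by elim: k {ih h} => [|k ih]; rewrite ?addn0// addnS LS size_cat (leq_trans ih)// leq_addr.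
have tE i m : (m < size (bl i))%N -> t m = nth t0 (bl i) m.
  move=> mi; have [im|mi2] := leqP i m.+1.
    by rewrite /t -{1}(subnKC im) Lnth.
  by rewrite /t -(subnKC (ltnW mi2)) Lnth.
have Lval i : all (fun t => `[< tvalid nu A phi t >]) (bl i).
  elim: i => [//|i ih]; by rewrite LS all_cat ih block_valid.
have tval m : tvalid nu A phi (t m).
  by apply/asboolP; apply: (all_nthP t0 (Lval m.+1)); exact: leq_trans (Lsz m.+1).
have sumL (V : nmodType) (F : term -> V) i : \sum_(m < size (bl i)) F (t m) = \sum_(x <- bl i) F x.
  rewrite (big_nth t0) big_mkord; apply: eq_bigr => m _.
  by rewrite (tE i).
have sumLb (V : nmodType) (F : term -> V) i : \sum_(x <- bl i) F x = \sum_(n < i) \sum_(x <- block n) F x.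
  by rewrite big_flatten big_map (_ : iota 0 i = index_iota 0 i) ?big_mkord// /index_iota subn0.
have nn m : 0 <= td (t m) * ts (t m) by have [_ [? ? _ _]] := tval m; rewrite mulr_ge0.
exists t, (fun i => size (bl i)), (K2 * ((K1 + 1) * L + 1) * (2 * W)); split => //.
  move=> m; apply: (@le_trans _ _ (\sum_(i < size (bl m)) td (t i) * ts (t i))).
    rewrite -(big_mkord xpredT (fun i => td (t i) * ts (t i))).
    rewrite -(big_mkord xpredT (fun i => td (t i) * ts (t i))).
    by rewrite (big_cat_nat (leq0n m) (Lsz m)) /= lerDl sumr_ge0.
  rewrite (sumL _ (fun x => td x * ts x)) (sumLb _ (fun x => td x * ts x)).
  apply: le_trans (ler_sum _ (fun (n : 'I_m) _ => block_sum_le n)) _.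
  rewrite -mulr_sumr ler_wpM2l// ?mulr_ge0 ?addr_ge0 ?mulr_ge0 ?addr_ge0//.
  by apply: halving_sums => //; exact: layer_mass_ge0.
move=> f w hf dw; have af : analytic f by case: hf => -[].
have [D [DS Dj]] := reprod af dw.
have [B B0 HB] := node_mean_dominated hf dw.
apply: eq_clim (clim_dominated B0 DS Dj HB) => i.
rewrite (sumL _ (fun x => tapp x f * th' x w)) (sumLb _ (fun x => tapp x f * th' x w)).
elim: i => [|i ih]; first by rewrite !big_ord0.
by rewrite big_ord_recr ih block_telescope /partial /=; ring.
Qed.

End Blocks.
End Expansion.

(** * Nuclear operators *)

Section AbsolutelySumming.
Variable R : realType.
Local Notation C := (R[i]).
Implicit Types X Y : normedModType C.

Lemma normed_rnorm (V : normedModType C) (v : V) : `|v| = (rnorm v)%:C.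
Proof.
have : 0 <= `|v| by exact: normr_ge0.
by rewrite /rnorm; case: `|v| => a b; rewrite lecE /= => /andP[/eqP -> _].
Qed.

Lemma rnorm_ge0 (V : normedModType C) (v : V) : 0 <= rnorm v.
Proof. by rewrite -lecR -normed_rnorm; exact: normr_ge0. Qed.

Lemma dual_norm_le X (x' : X -> C) (d : R) : 0 <= d ->
  (forall x, normc (x' x) <= d * rnorm x) -> dual_norm x' <= d.
Proof.
move=> d0 H; apply: ge_sup.
  exists (normc (x' 0)), 0 => //=.
  by rewrite /rnorm normr0 /=.
move=> _ [x x1 <-]; apply: le_trans (H x) _.
by rewrite ler_piMr.
Qed.

Lemma nneseries_le (u : nat -> R) W : (forall n, 0 <= u n) ->
  (forall n, \sum_(k < n) u k <= W) -> (\sum_(0 <= k <oo) (u k)%:E <= W%:E)%E.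
Proof.
move=> u0 uW; apply: lime_le; first by apply: is_cvg_nneseries => n _ _; rewrite lee_fin.
by near=> n; rewrite big_mkord sumEFin lee_fin.
Unshelve. all: by end_near. Qed.

Lemma rnormZ X (a : C) (x : X) : rnorm (a *: x) = normc a * rnorm x.
Proof. by apply: complexI; rewrite -normed_rnorm normrZ (normed_rnorm x) -[`|a|]/((normc a)%:C) -rmorphM. Qed.

Lemma rnormD X (x y : X) : rnorm (x + y) <= rnorm x + rnorm y.
Proof.
rewrite -lecR.
have -> : (rnorm x + rnorm y)%:C = (rnorm x)%:C + (rnorm y)%:C :> C by exact: rmorphD.
by rewrite -!normed_rnorm; exact: ler_normD.
Qed.

Lemma rnorm_sum X (I : Type) (r : seq I) (x : I -> X) :
  rnorm (\sum_(i <- r) x i) <= \sum_(i <- r) rnorm (x i).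
Proof.
elim: r => [|i r ih]; first by rewrite !big_nil /rnorm normr0.
by rewrite !big_cons; apply: le_trans (rnormD _ _) _; rewrite lerD2l.
Qed.

Lemma continuous_functional_bounded X (x' : {scalar X}) : continuous x' ->
  exists2 d, 0 <= d & forall x, normc (x' x) <= d * rnorm x.
Proof.
move=> xc; have /linear_boundedP[M [Mr HM]] := @continuous_linear_bounded _ _ _ 0 x' (xc 0).
have H := HM (M + 1) (ltr_pwDr ltr01 (lexx M)).
exists `|complex.Re (M + 1)| => // x.
apply: (@le_trans _ _ (complex.Re (M + 1) * rnorm x)); last first.
  by rewrite ler_wpM2r ?rnorm_ge0// ler_norm.
have := H x; rewrite (normed_rnorm x) -[`|x' x|]/((normc (x' x))%:C).
by case: (M + 1) => a b; simpc => /andP[_].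
Qed.

Lemma dual_norm_has_sup X (x' : {scalar X}) : continuous x' ->
  has_sup [set normc (x' x) | x in [set x | rnorm x <= 1]].
Proof.
move=> /continuous_functional_bounded[d d0 H]; split.
  by exists (normc (x' 0)), 0 => //=; rewrite /rnorm normr0 /=.
by exists d => _ [x /= x1 <-]; apply: le_trans (H x) _; rewrite ler_piMr.
Qed.

Lemma dual_norm_ge0 X (x' : {scalar X}) : continuous x' -> 0 <= dual_norm x'.
Proof.
move=> xc; apply: le_trans (normc_ge0 (x' 0)) _.
apply: ub_le_sup; first by case: (dual_norm_has_sup xc).
by exists 0 => //=; rewrite /rnorm normr0 /=.
Qed.

Lemma le_dual_norm X (x' : {scalar X}) x : continuous x' ->
  normc (x' x) <= dual_norm x' * rnorm x.
Proof.
move=> xc; have [d d0 H] := continuous_functional_bounded xc.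
have := rnorm_ge0 x; rewrite le_eqVlt => /orP[/eqP x0|x0].
  by have := H x; rewrite -x0 !mulr0.
rewrite -ler_pdivrMr//; apply: ub_le_sup; first by case: (dual_norm_has_sup xc).
have nx : normc ((rnorm x)^-1%:C : C) = (rnorm x)^-1 by rewrite normc_real gtr0_norm ?invr_gt0.
exists ((rnorm x)^-1%:C *: x) => /=; first by rewrite rnormZ nx mulVf// gt_eqF.
by rewrite linearZ normcM nx mulrC.
Qed.

Lemma unimodular (v : C) : exists2 c : C, normc c <= 1 & c * v = (normc v)%:C.
Proof.
have [->|v0] := eqVneq v 0; first by exists 0; rewrite ?mulr0 normc0.
have nv : 0 < normc v by rewrite normc_gt0.
exists ((normc v)%:C / v); last by rewrite divfK.
by rewrite normcM normcV normc_real gtr0_norm// divff// gt_eqF.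
Qed.

(** A nuclear operator is absolutely summing, with constant the sum of the nuclear representation.
    Bounding all sums with coefficients of modulus at most 1 bounds the weak l1 norm of the family:
    for each functional the coefficients can be chosen to make every term nonnegative. *)
Lemma nuclear_summing X Y (T : {linear X -> Y}) : nuclear T ->
  exists2 W, 0 <= W & forall (K : R) J (x : nat -> nat -> X), 0 <= K ->
    (forall a : nat -> nat -> C, (forall j k, normc (a j k) <= 1) ->
      rnorm (\sum_(j < J) \sum_(k < 2 ^ j) a j k *: x j k) <= K) ->
    \sum_(j < J) \sum_(k < 2 ^ j) rnorm (T (x j k)) <= W * K.
Proof.
move=> [x' [y [xc sm cv]]].
pose u k := dual_norm (x' k) * rnorm (y k).
have u0 k : 0 <= u k by rewrite mulr_ge0 ?rnorm_ge0 ?dual_norm_ge0.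
set s := (\sum_(0 <= k <oo) _)%E in sm.
have s0 : (0 <= s)%E by apply: nneseries_ge0 => k _ _; rewrite lee_fin; exact: u0.
have sE : s = (fine s)%:E by rewrite fineK// ge0_fin_numE.
have us n : \sum_(k < n) u k <= fine s.
  rewrite -lee_fin -sE -sumEFin -(big_mkord xpredT (fun k => (u k)%:E)).
  by apply: nneseries_lim_ge => k _ _; rewrite lee_fin; exact: u0.
exists (fine s); first exact: fine_ge0.
move=> K J x K0 HK.
have one i : \sum_(j < J) \sum_(k < 2 ^ j) normc (x' i (x j k)) <= dual_norm (x' i) * K.
  have /choice[a aP] (jk : nat * nat) : exists c : C, normc c <= 1 /\
      c * x' i (x jk.1 jk.2) = (normc (x' i (x jk.1 jk.2)))%:C.
    by have [v v1 vE] := unimodular (x' i (x jk.1 jk.2)); exists v.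
  pose a' j k := a (j, k).
  have a1 j k : normc (a' j k) <= 1 by have [] := aP (j, k).
  have := le_dual_norm (\sum_(j < J) \sum_(k < 2 ^ j) a' j k *: x j k) (xc i).
  rewrite (linear_sum (x' i)) (eq_bigr (fun j : 'I_J => (\sum_(k < 2 ^ j) normc (x' i (x j k)))%:C)); last first.
    move=> j _; rewrite (linear_sum (x' i)) rmorph_sum; apply: eq_bigr => k _.
    by rewrite linearZ; exact: (aP (nat_of_ord j, nat_of_ord k)).2.
  rewrite -rmorph_sum normc_real ger0_norm; last first.
    by apply: sumr_ge0 => j _; apply: sumr_ge0 => k _; exact: normc_ge0.
  move=> h; apply: le_trans h _; apply: ler_wpM2l; [exact: dual_norm_ge0|exact: HK].
pose F n := \sum_(j < J) \sum_(k < 2 ^ j) rnorm (series (fun i => x' i (x j k) *: y i) n).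
have Fn n : F n <= fine s * K.
  apply: (@le_trans _ _ (\sum_(j < J) \sum_(k < 2 ^ j) \sum_(i < n) normc (x' i (x j k)) * rnorm (y i))).
    apply: ler_sum => j _; apply: ler_sum => k _; rewrite /series /= big_mkord.
    by apply: le_trans (rnorm_sum _ _) _; apply: ler_sum => i _; rewrite rnormZ.
  apply: (@le_trans _ _ (\sum_(i < n) u i * K)); last first.
    by rewrite -mulr_suml ler_wpM2r.
  under eq_bigr do rewrite exchange_big /=.
  rewrite exchange_big /=; apply: ler_sum => i _.
  under eq_bigr do rewrite -mulr_suml.
  rewrite -mulr_suml /u [leRHS]mulrAC.
  by apply: ler_wpM2r; [exact: rnorm_ge0|exact: one].
have Foo : ProperFilter (\oo : set_system nat) by exact: eventually_filter.
have lim1 (v : nat -> Y) (l : Y) : v @ \oo --> l -> (fun n => rnorm (v n)) @ \oo --> rnorm l.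
  move=> vl; apply/cvgrPdist_le => e e0.
  have e0' : 0 < e%:C by rewrite ltcR.
  have := iffLR (@cvgrPdist_le C Y nat \oo (@filter_filter _ _ Foo) v l) vl _ e0'.
  apply: filterS => n; rewrite normed_rnorm lecR => h; apply: le_trans h.
  have h1 := rnormD (v n - l) l; have h2 := rnormD (l - v n) (v n).
  have h3 : rnorm (v n - l) = rnorm (l - v n) by rewrite /rnorm distrC.
  rewrite !subrK h3 in h1 h2; rewrite ler_norml; apply/andP; split; lra.
have cs (p : nat) (f : nat -> nat -> R) (l : nat -> R) : (forall k, f k n @[n --> \oo] --> l k) ->
    \sum_(k < p) f k n @[n --> \oo] --> \sum_(k < p) l k.
  move=> fl; elim: p => [|p ih].
    by rewrite big_ord0; under eq_cvg do rewrite big_ord0; exact: cvg_cst.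
  by rewrite big_ord_recr; under eq_cvg do rewrite big_ord_recr; exact: cvgD.
have Fl : F n @[n --> \oo] --> \sum_(j < J) \sum_(k < 2 ^ j) rnorm (T (x j k)).
  apply: (cs J (fun j n => \sum_(k < 2 ^ j) rnorm (series (fun i => x' i (x j k) *: y i) n))
    (fun j => \sum_(k < 2 ^ j) rnorm (T (x j k)))) => j.
  apply: (cs (2 ^ j)%N (fun k n => rnorm (series (fun i => x' i (x j k) *: y i) n))
    (fun k => rnorm (T (x j k)))) => k.
  exact: lim1 (cv (x j k)).
by apply: (cvgr_to_le Fl); near=> n; exact: Fn.
Unshelve. all: by end_near. Qed.

End AbsolutelySumming.

Section KernelPowers.
Variable R : realType.
Local Notation C := (R[i]).

Lemma cderivM (f g : C -> C) z D E : cderiv f z D -> cderiv g z E ->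
  cderiv (fun w => f w * g w) z (D * g z + f z * E).
Proof.
move=> hf hg e e0.
pose B := normc (g z) + normc D + normc (f z) + 1.
have [g0 D0 f0] : [/\ 0 <= normc (g z), 0 <= normc D & 0 <= normc (f z)] by rewrite !normc_ge0.
have B0 : 0 < B by rewrite /B; lra.
have e1 : 0 < e / (3 * B) by rewrite divr_gt0// mulr_gt0.
have [d1 d10 H1] := hf _ e1; have [d2 d20 H2] := hg _ e1.
have [d3 d30 H3] := cderiv_cont hg e1; have [d4 d40 H4] := cderiv_cont hg ltr01.
exists (Num.min (Num.min d1 d2) (Num.min d3 d4)); first by rewrite !lt_min d10 d20 d30.
move=> h; rewrite !lt_min => /andP[/andP[/H1 h1 /H2 h2] /andP[/H3 h3 /H4 h4]].
have nh := normc_ge0 h.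
have gh : normc (g (z + h)) <= B.
  rewrite -(subrK (g z) (g (z + h))); apply: le_trans (normcD _ _) _.
  by rewrite /B; lra.
rewrite (_ : _ - _ = (f (z + h) - f z - h * D) * g (z + h) +
  (h * D * (g (z + h) - g z) + f z * (g (z + h) - g z - h * E))); last by ring.
have part (x y : R) : 0 <= x -> 0 <= y -> x <= e / (3 * B) * normc h -> y <= B ->
    x * y <= e / 3 * normc h.
  move=> x0 y0 xe yB; apply: le_trans (ler_pM x0 y0 xe yB) _.
  by rewrite le_eqVlt; apply/orP; left; apply/eqP; field; rewrite gt_eqF.
apply: le_trans (normcD _ _) _; apply: le_trans (lerD (lexx _) (normcD _ _)) _.
rewrite !normcM (_ : e * normc h = e / 3 * normc h + (e / 3 * normc h + e / 3 * normc h)); last by field.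
apply: lerD; first by apply: part => //; exact: normc_ge0.
apply: lerD.
  rewrite [X in X <= _](_ : _ = normc (g (z + h) - g z) * normc h * normc D); last by ring.
  apply: part; rewrite ?normc_ge0//.
  - by rewrite mulr_ge0 ?normc_ge0.
  - by rewrite ler_wpM2r.
  - by rewrite /B; lra.
by rewrite mulrC; apply: part; rewrite ?normc_ge0//; rewrite /B; lra.
Qed.

Lemma cderiv_inv1 (y : C) : normc y < 1 ->
  cderiv (fun y => (1 - y)^-1) y ((1 - y)^-1 ^+ 2).
Proof.
move=> y1 e e0; pose s := 1 - normc y; have s0 : 0 < s by rewrite subr_gt0.
have nz v : normc v <= normc y + s / 2 -> s / 2 <= normc (1 - v).
  by move=> hv; apply: le_trans (normc_sub1_ge _); rewrite /s in hv *; lra.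
have e1 : 0 < e * (s / 2) ^+ 3 by rewrite mulr_gt0// exprn_gt0// divr_gt0.
exists (Num.min (s / 2) (e * (s / 2) ^+ 3)); first by rewrite lt_min divr_gt0.
move=> h; rewrite lt_min => /andP[hs he].
have s2 : 0 < s / 2 by rewrite divr_gt0.
have n1 : s / 2 <= normc (1 - y) by apply: nz; rewrite lerDl ltW.
have n2 : s / 2 <= normc (1 - (y + h)).
  by apply: nz; apply: le_trans (normcD _ _) _; rewrite lerD2l ltW.
have z1 : 1 - y != 0 by rewrite -normc_gt0 (lt_le_trans s2).
have z2 : 1 - (y + h) != 0 by rewrite -normc_gt0 (lt_le_trans s2).
have -> : (1 - (y + h))^-1 - (1 - y)^-1 - h * (1 - y)^-1 ^+ 2 =
    h * (h * ((1 - y)^-1 ^+ 2 * (1 - (y + h))^-1)) by field; rewrite z1 z2.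
rewrite normcM mulrC; apply: ler_wpM2r; first exact: normc_ge0.
rewrite normcM (normcM (_ ^+ 2)) normcX !normcV.
apply: (@le_trans _ _ (normc h * ((s / 2)^-1 ^+ 2 * (s / 2)^-1))).
  apply: ler_wpM2l; first exact: normc_ge0.
  have i1 : (normc (1 - y))^-1 <= (s / 2)^-1 by rewrite lef_pV2 ?posrE// (lt_le_trans s2).
  have i2 : (normc (1 - (y + h)))^-1 <= (s / 2)^-1 by rewrite lef_pV2 ?posrE// (lt_le_trans s2).
  have p1 : 0 <= (normc (1 - y))^-1 by rewrite invr_ge0 normc_ge0.
  apply: ler_pM => //; rewrite ?exprn_ge0 ?invr_ge0 ?normc_ge0//.
  by rewrite lerXn2r// nnegrE// (le_trans p1).
rewrite -exprSr exprVn ler_pdivrMr ?exprn_gt0//; exact: ltW.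
Qed.

Lemma cderiv_invX m (y : C) : normc y < 1 ->
  cderiv (fun y => (1 - y)^-1 ^+ m) y (m%:R * (1 - y)^-1 ^+ m.+1).
Proof.
move=> y1; elim: m => [|m ih].
  rewrite mul0r; under [X in cderiv X]eq_fun do rewrite expr0.
  exact: cderiv_cst.
have := cderivM (cderiv_inv1 y1) ih.
rewrite (_ : _ + _ = m.+1%:R * (1 - y)^-1 ^+ m.+2); last by rewrite -natr1 !exprS; ring.
by congr cderiv; apply/funext => w; rewrite exprS.
Qed.

End KernelPowers.

Section WeightedDerivative.
Variable R : realType.
Local Notation C := (R[i]).

(** Cauchy's estimate on the circle of radius [(1 + |z|) / 2], where condition (I) keeps [mu]
    comparable with [mu z]. *)
Lemma weighted_derivative_le (mu : C -> R) : normal mu ->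
  exists2 K, 0 <= K & forall f z, Hinf_set mu f -> disk z ->
    (1 - normc z) * (mu z * normc (derive1 f z)) <= K * wnorm mu f.
Proof.
move=> muN; have [_ [be hI] _ _] := muN.
have [c c0 H] := normalI_ratio muN hI.
exists (16 * (c * 2 `^ be)).
  by apply: mulr_ge0 => //; apply: mulr_ge0; [exact: ltW|exact: powR_ge0].
move=> f z hf dz; have z1 : normc z < 1 by [].
have z0 := normc_ge0 z; set r := normc z in z0 z1 *.
have W0 := wnorm_ge0 muN hf; have af : analytic f by case: hf => -[].
pose rho := (1 + r) / 2.
have [rho0 rho1 rrho] : [/\ 0 < rho, rho < 1 & r < rho] by rewrite /rho; split; lra.
have nrho : normc rho%:C = rho :> R by rewrite normc_real gtr0_norm.
have rhoC : rho%:C != 0 :> C by rewrite -normc_gt0 nrho.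
have drho : disk (rho%:C : C) by rewrite -[disk _]/(is_true (normc _ < 1)) nrho.
have murho := normal_gt0 muN drho; have muz := normal_gt0 muN dz.
pose K := wnorm mu f / mu rho%:C.
have K0 : 0 <= K by rewrite divr_ge0// ltW.
have circ v : normc v = 1 -> normc (f (rho%:C * v)) <= K.
  move=> v1; have nv : normc (rho%:C * v) = rho by rewrite normcM nrho v1 mulr1.
  have dv : disk (rho%:C * v) by rewrite -[disk _]/(is_true (normc _ < 1)) nv.
  by have := Hinf_le muN hf dv; rewrite (normal_radial muN dv) nv.
pose s := (1 + r / rho) / 2.
have rr : r / rho < 1 by rewrite ltr_pdivrMr// mul1r.
have [s1 sr] : s < 1 /\ r / rho < s by rewrite /s; split; lra.
have zs : normc (z / rho%:C) <= s by rewrite normcM normcV nrho -/r ltW.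
have d0 : 0 < rho * (s - r / rho) by rewrite mulr_gt0// subr_gt0.
have D := @cderiv_le R f z (derive1 f z) (4 * K / (1 - s) / rho) _ d0 (analytic_cderiv af dz) _.
have {D} : normc (derive1 f z) <= 4 * K / (1 - s) / rho.
  apply: D => h hd.
  have zhs : normc ((z + h) / rho%:C) <= s.
    rewrite normcM normcV nrho ler_pdivrMr//; apply: le_trans (normcD _ _) _.
    have rE : rho * (r / rho) = r by rewrite mulrC divfK ?gt_eqF.
    by move: hd; rewrite mulrBr rE -/r; lra.
  have rho01 : 0 < rho < 1 by rewrite rho0.
  have := lipschitz_of_circle af rho01 K0 circ s1 zhs zs.
  rewrite ![rho%:C * _]mulrC !divfK// -mulrBl [z + h]addrC addrK normcM normcV nrho.
  by rewrite mulrA mulrAC.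
have sE : (1 - s) * rho = (1 - r) / 4.
  have rE : r / rho * rho = r by rewrite divfK ?gt_eqF.
  rewrite (_ : (1 - s) * rho = rho / 2 - r / rho * rho / 2); last by rewrite /s; field; rewrite gt_eqF.
  by rewrite rE /rho; field.
rewrite -mulrA -invfM sE => hD.
have r1 : 0 < 1 - r by rewrite subr_gt0.
apply: (@le_trans _ _ ((1 - r) * (mu z * (4 * K / ((1 - r) / 4))))).
  by apply: ler_wpM2l; [exact: ltW|apply: ler_wpM2l => //; exact: ltW].
rewrite (_ : _ * (mu z * _) = 16 * (mu z * K)); last by field; rewrite gt_eqF.
rewrite -!mulrA; apply: ler_wpM2l => //.
rewrite [X in X <= _](_ : _ = wnorm mu f * (mu z / mu rho%:C)); last by rewrite /K; ring.
rewrite [X in _ <= X](_ : _ = wnorm mu f * (c * 2 `^ be)); last by ring.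
apply: (ler_wpM2l W0); rewrite ler_pdivrMr//.
have := H z rho%:C dz drho; rewrite nrho => /(_ (ltW rrho)).
have -> : 1 - rho = (1 - r) / 2 by rewrite /rho; field.
have r2 : 0 < (1 - r) / 2 by rewrite divr_gt0.
have e1 : (1 - r) `^ be = 2 `^ be * ((1 - r) / 2) `^ be.
  by rewrite -powRM ?(ltW r2)// mulrC divfK.
have pr : 0 < ((1 - r) / 2) `^ be by rewrite powR_gt0.
rewrite e1 => h; rewrite -(ler_pM2r pr); apply: le_trans h _.
by rewrite le_eqVlt; apply/orP; left; apply/eqP; ring.
Qed.

End WeightedDerivative.

Section GeneralOperator.
Variable R : realType.
Local Notation C := (R[i]).

(** Members of [holo] vanish off the disk, so kernels given by formulas have to be truncated before
    they become elements of the spaces. *)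
Definition cut (h : C -> C) : C -> C := fun w => if `[< disk w >] then h w else 0.

Lemma cutE h w : disk w -> cut h w = h w.
Proof. by move=> dw; rewrite /cut; case: asboolP. Qed.

Lemma cut_cderiv h w D : disk w -> cderiv h w D -> cderiv (cut h) w D.
Proof.
move=> dw hd e /hd[d d0 H]; have w1 : normc w < 1 by [].
exists (Num.min d (1 - normc w)); first by rewrite lt_min d0 subr_gt0.
move=> k; rewrite lt_min => /andP[kd kw]; rewrite !cutE ?H//.
rewrite -[disk _]/(is_true (normc _ < 1)); apply: le_lt_trans (normcD _ _) _.
by rewrite addrC -ltrBrDr.
Qed.

Lemma cut_holo h h' : (forall w, disk w -> cderiv h w (h' w)) -> holo (cut h).
Proof.
move=> hd; split=> [w dw|w dw]; last by rewrite /cut; case: asboolP.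
by have [] := cderiv_derivable (cut_cderiv dw (hd w dw)).
Qed.

Variables (nu mu : C -> R) (g phi : C -> C).
Hypotheses (nuN : normal nu) (muN : normal mu).
Hypotheses (ag : analytic g) (aphi : analytic phi) (self : forall z, disk z -> disk (phi z)).
Variables (X Y : normedModType C) (iX : X -> C -> C) (iY : Y -> C -> C).
Hypotheses (iXD : forall a x y, iX (a *: x + y) = a *: iX x + iX y)
  (iXH : forall x, Hinf_set nu (iX x)) (iYH : forall y, Hinf_set mu (iY y))
  (iXn : forall x, rnorm x = wnorm nu (iX x)) (iYn : forall y, rnorm y = wnorm mu (iY y))
  (rich : forall h, holo h -> (exists K : R, forall w, disk w -> normc (h w) <= K) ->
     exists x, iX x = h).
Variable T : {linear X -> Y}.
Hypothesis hT : forall x z, disk z -> iY (T x) z = Sop g phi (iX x) z.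

Definition gauge z : R := (1 - normc z ^+ 2) * mu z * normc (g z).

Lemma gauge_ge0 z : disk z -> 0 <= gauge z.
Proof.
move=> dz; rewrite /gauge !mulr_ge0 ?normc_ge0// ?(ltW (normal_gt0 muN dz))//.
by rewrite subr_ge0 exprn_ile1 ?normc_ge0// ltW.
Qed.

Let aX x : analytic (iX x). Proof. by have [[]] := iXH x. Qed.
Let aY y : analytic (iY y). Proof. by have [[]] := iYH y. Qed.

Let hS x (z : C) : C := derive1 (iX x) (phi z) * g z.

Let hS_cont x w : disk w -> ccont (hS x) w.
Proof.
move=> dw; apply: (@ccontM R (derive1 (iX x) \o phi) g).
  apply: ccont_comp; first exact: ccont_cderiv (analytic_cderiv aphi dw).
  by apply: derive1_continuous; [exact: aX|exact: self].
exact: ccont_cderiv (analytic_cderiv ag dw).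
Qed.

(** The derivative along rays gives the formula away from the origin; continuity of both sides
    extends it to 0. *)
Lemma operator_derivative x z : disk z -> derive1 (iY (T x)) z = derive1 (iX x) (phi z) * g z.
Proof.
have off0 w : disk w -> w != 0 -> derive1 (iY (T x)) w = hS x w.
  move=> dw w0; apply: (segment_integral_cderiv dw w0 (hS_cont x) (hT x)).
  exact: (analytic_cderiv (@aY (T x)) dw).
have [->|z0 dz] := eqVneq z 0; last exact: off0.
move=> d0; suff small (e : R) : 0 < e -> normc (derive1 (iY (T x)) 0 - hS x 0) <= e.
  apply/eqP; rewrite -subr_eq0 -normc_eq0 eq_le normc_ge0 andbT.
  by apply/ler_addgt0Pr => e e0; rewrite add0r small.
move=> e0; have e2 : 0 < e / 2 by rewrite divr_gt0.
have [d1 d10 H1] := derive1_continuous (@aY (T x)) d0 e2.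
have [d2 d20 H2] := hS_cont x d0 e2.
pose k := Num.min (Num.min d1 d2) 1 / 2.
have k0 : 0 < k by rewrite divr_gt0// !lt_min d10 d20/=.
have [kd1 kd2 k1] : [/\ k < d1, k < d2 & k < 1].
  have h1 : Num.min (Num.min d1 d2) 1 <= d1 by rewrite !ge_min lexx.
  have h2 : Num.min (Num.min d1 d2) 1 <= d2 by rewrite !ge_min lexx !orbT.
  have h3 : Num.min (Num.min d1 d2) 1 <= 1 by rewrite !ge_min lexx !orbT.
  by move: k0; rewrite /k; split; lra.
have nk : normc k%:C = k by rewrite normc_real gtr0_norm.
have := H1 k%:C; have := H2 k%:C; rewrite nk !add0r => /(_ kd2) h2 /(_ kd1) h1.
rewrite off0 in h1; last by rewrite -normc_gt0 nk.
  rewrite (_ : _ - _ = (hS x k%:C - hS x 0) - (hS x k%:C - derive1 (iY (T x)) 0)); last by ring.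
  by apply: le_trans (normcB _ _) _; rewrite [e]splitr lerD.
by rewrite -[disk _]/(is_true (normc _ < 1)) nk.
Qed.

(** Integrating [s / ((1 - |w|) mu w)] along the ray to [z] gives at most a multiple of [s / mu z],
    because by condition (II) the integrand grows at least like a power of [1 / (1 - |w|)]. *)
Lemma operator_bound : exists2 K, 0 <= K & forall x (s : R), 0 <= s ->
  (forall z, disk z -> gauge z * normc (derive1 (iX x) (phi z)) <= s) -> rnorm (T x) <= K * s.
Proof.
have [_ _ [ga hII] _] := muN; have [ga0 _] := hII.
have [c c0 H] := normalII_ratio muN hII.
exists (2 * (c / ga)); first by apply: mulr_ge0 => //; apply: divr_ge0; exact: ltW.
move=> x s s0 hs; rewrite iYn; apply: wnorm_le => z dz.
have z1 : normc z < 1 by []. have r0 := normc_ge0 z; set r := normc z in r0 z1.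
have muz := normal_gt0 muN dz.
have tr (t : R) : 0 <= t <= 1 -> 0 < 1 - t * r by move=> /andP[? ?]; nra.
(* Condition (II) replaces [1 / mu w] by [c (1 - r)^ga / (mu z (1 - t r)^ga)]. The resulting
   majorant is a power of [1 - t r], and [Q] normalizes its primitive [B]. *)
pose Q := s * c * (1 - r) `^ ga / (mu z * ga).
have Q0 : 0 <= Q.
  by rewrite divr_ge0 ?mulr_ge0 ?powR_ge0// ltW.
pose B (t : R) := Q * (1 - t * r) `^ (- ga).
pose B' (t : R) := Q * ((- ga * (1 - t * r) `^ (- ga - 1)) * (- r)).
have Bd (t : R) : 0 <= t <= 1 -> is_derive t 1 B (B' t).
  move=> /tr t0; apply: is_deriveZ.
  have h1 := is_derive1_powR (- ga) t0.
  have h2 : is_derive t 1 (fun t : R => 1 - t * r) (- r).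
    have -> : - r = 0 - (t *: (0 : R) + r *: (1 : R)).
      by rewrite scaler0 !add0r -[r *: 1]/(r * 1) mulr1.
    by apply: is_deriveB; apply: is_deriveM.
  exact: (@is_derive1_comp R (fun v : R => v `^ (- ga)) _ t _ _ h1 h2).
have hB (t : R) : 0 <= t <= 1 -> normc (z * hS x (t%:C * z)) <= B' t.
  move=> t01; have t0 := tr t t01; have /andP[t1 t2] := t01.
  pose w := t%:C * z.
  have nw : normc w = t * r by rewrite normcM normc_real ger0_norm.
  have wr : normc w <= normc z by rewrite nw ler_piMl.
  have dw : disk w by exact: le_lt_trans wr z1.
  have muw := normal_gt0 muN dw.
  have hsw := hs w dw.
  have hmu := H w z dw dz wr; rewrite nw -/r in hmu.
  have S : normc (hS x w) <= s / ((1 - t * r) * mu w).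
    rewrite ler_pdivlMr ?mulr_gt0//; apply: le_trans hsw.
    rewrite /hS normcM /gauge nw.
    have gn := normc_ge0 (g w); have dn := normc_ge0 (derive1 (iX x) (phi w)).
    rewrite [X in _ <= X](_ : _ = mu w * (normc (g w) * normc (derive1 (iX x) (phi w))) * (1 - (t * r) ^+ 2)); last by ring.
    rewrite [X in X <= _](_ : _ = mu w * (normc (g w) * normc (derive1 (iX x) (phi w))) * (1 - t * r)); last by ring.
    apply: ler_wpM2l; first by apply: mulr_ge0; [exact: ltW|exact: mulr_ge0].
    have : 0 <= t * r by rewrite mulr_ge0.
    have : t * r <= 1 by rewrite -subr_ge0 ltW.
    by nra.
  have i1 : (mu w)^-1 <= c * (1 - r) `^ ga / (mu z * (1 - t * r) `^ ga).
    rewrite ler_pdivlMr ?mulr_gt0 ?powR_gt0// mulrC ler_pdivrMr// mulrAC.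
    exact: hmu.
  rewrite normcM -/r; apply: (@le_trans _ _ (r * (s / (1 - t * r) *
      (c * (1 - r) `^ ga / (mu z * (1 - t * r) `^ ga))))).
    apply: ler_wpM2l => //; apply: le_trans S _.
    by rewrite invfM mulrA ler_wpM2l// divr_ge0 ?(ltW t0).
  rewrite le_eqVlt; apply/orP; left; apply/eqP; rewrite /B' /Q.
  have -> : (1 - t * r) `^ (- ga - 1) = ((1 - t * r) `^ ga * (1 - t * r))^-1.
    have e1 : (1 - t * r) `^ ga * (1 - t * r) = (1 - t * r) `^ (ga + 1).
      by rewrite powRD ?powRr1 ?(ltW t0)// (gt_eqF t0) implybT.
    by rewrite e1 -powRN opprD.
  by field; rewrite !gt_eqF ?powR_gt0.
have := segment_integral_le dz (hS_cont x) Bd hB.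
rewrite hT// => h; rewrite mulrC -ler_pdivlMr//; apply: le_trans h _.
have B00 : 0 <= B 0 by rewrite mulr_ge0 ?powR_ge0.
apply: (@le_trans _ _ (2 * B 1)); first by rewrite ler_wpM2l// gerBl.
have r1 : 0 < 1 - r by rewrite subr_gt0.
rewrite le_eqVlt; apply/orP; left; apply/eqP; rewrite /B /Q mul1r powRN.
by field; rewrite !gt_eqF ?powR_gt0.
Qed.

Let iX0 w : iX 0 w = 0.
Proof. by have := iXD (-1) 0 0; rewrite scaler0 addr0 scaleN1r addNr => ->. Qed.

Let iXB x y : iX (x - y) = iX x - iX y.
Proof. by rewrite -[x - y]addrC -scaleN1r iXD scaleN1r addrC. Qed.

Let iXZ a x w : iX (a *: x) w = a * iX x w.
Proof. by rewrite -[a *: x]addr0 iXD -[RHS]addr0 -(iX0 w). Qed.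

Let iXsum (I : Type) (r : seq I) (e : I -> X) w :
  iX (\sum_(i <- r) e i) w = \sum_(i <- r) iX (e i) w.
Proof.
elim: r => [|i r ih]; first by rewrite !big_nil iX0.
by rewrite !big_cons -ih -{1}[e i]scale1r iXD -[LHS]/(1 * iX (e i) w + _) mul1r.
Qed.

(** The rank one terms are [tapp (t m)] followed by [T (e m)], and [operator_bound] estimates the
    norm of [T (e m)] by [ts (t m)]. The same lemma applied to the remainder turns pointwise
    convergence of the derivatives into convergence in norm. *)
Lemma expansion_nuclear (t : nat -> term R) (N : nat -> nat) (W : R) :
  (forall m, tvalid nu gauge phi (t m)) -> (forall m, \sum_(i < m) td (t i) * ts (t i) <= W) ->
  (forall i, (i <= N i)%N) ->
  (forall f w, Hinf_set nu f -> disk w ->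
      clim (fun i => \sum_(m < N i) tapp (t m) f * th' (t m) w) (derive1 f w)) ->
  nuclear T.
Proof.
move=> tv tW NN tlim.
have /choice[e eE] m : exists e, iX e = cut (th (t m)).
  have [[_ _ td_ [K tK]] _] := tv m; apply: rich; first exact: cut_holo td_.
  by exists K => w dw; rewrite cutE//; exact: tK.
have ed m w : disk w -> cderiv (iX (e m)) w (th' (t m) w).
  by move=> dw; rewrite eE; apply: cut_cderiv => //; have [[_ _ h _] _] := tv m; exact: h.
have lin m : linear (fun x => tapp (t m) (iX x) : C).
  move=> a x y; rewrite /tapp iXD.
  have e0 v : (a *: iX x + iX y) v = a * iX x v + iX y v by [].
  rewrite !e0 -[RHS]/(a * (tc (t m) * (iX x (ta (t m)) - te (t m) * iX x (tb (t m)))) +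
     (tc (t m) * (iX y (ta (t m)) - te (t m) * iX y (tb (t m))))).
  by ring.
pose x' m : {scalar X} := HB.pack (fun x => tapp (t m) (iX x) : C)
  (GRing.isLinear.Build _ _ _ _ _ (lin m)).
have x'le m x : normc (x' m x) <= td (t m) * rnorm x.
  by rewrite iXn; have [_ [_ _ h _]] := tv m; exact: h.
have [K K0 HK] := operator_bound.
have tnn m : 0 <= td (t m) * ts (t m) by have [_ [? ? _ _]] := tv m; rewrite mulr_ge0.
exists x', (fun m => T (e m)); split.
- move=> m; apply: bounded_linear_continuous.
  apply/linear_boundedP; exists (td (t m))%:C; split; first by rewrite complex_real.
  move=> r hr x; apply: le_trans (_ : (td (t m))%:C * `|x| <= _); last first.
    by rewrite ler_wpM2r// ltW.
  rewrite (normed_rnorm x).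
  have <- : (td (t m) * rnorm x)%:C = (td (t m))%:C * (rnorm x)%:C :> C by exact: rmorphM.
  by rewrite -[`| _ |]/((normc _)%:C) lecR.
- apply: (@le_lt_trans _ _ (K * W)%:E); last exact: ltry.
  apply: nneseries_le.
    move=> m; rewrite mulr_ge0 ?rnorm_ge0//.
    apply: le_trans (normc_ge0 (x' m 0)) _; apply: ub_le_sup.
      exists (td (t m)) => _ [x x1 <-]; apply: le_trans (x'le m x) _.
      by have [_ [? _ _ _]] := tv m; rewrite ler_piMr.
    by exists 0 => //=; rewrite /rnorm normr0 /=.
  move=> n; apply: (@le_trans _ _ (\sum_(k < n) K * (td (t k) * ts (t k)))); last first.
    by rewrite -mulr_sumr ler_wpM2l.
  apply: ler_sum => m _; have [_ [d0 s0 _ hts]] := tv m.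
  rewrite mulrCA; apply: ler_pM; rewrite ?rnorm_ge0//.
  + apply: le_trans (normc_ge0 (x' m 0)) _; apply: ub_le_sup.
      exists (td (t m)) => _ [x x1 <-]; apply: le_trans (x'le m x) _.
      by rewrite ler_piMr.
    by exists 0 => //=; rewrite /rnorm normr0 /=.
  + by apply: dual_norm_le.
  + apply: HK => // z dz; apply: le_trans (hts z dz).
    rewrite ler_wpM2l ?gauge_ge0//.
    by have [_ ->] := cderiv_derivable (ed m _ (self dz)).
move=> x.
have Fo : Filter (\oo : set_system nat) by exact: eventually_filter.
apply: (iffRL (@cvgrPdist_le C Y nat \oo Fo _ _)) => eps /lt0cE[ep ep0 ->].
pose S n := \sum_(i < n) td (t i) * ts (t i).
have Sub : has_sup (range S).
  by split; [exists (S 0%N), 0%N|exists W => _ [n _ <-]; exact: tW].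
have wx := rnorm_ge0 x.
have ep1 : 0 < ep / (K * rnorm x + 1) by rewrite divr_gt0// ltr_wpDl// mulr_ge0.
have [_ [n0 _ <-] hn0] := sup_adherent ep1 Sub.
have Smono n k : S n <= S (n + k)%N.
  elim: k => [|k ih]; first by rewrite addn0.
  by rewrite addnS /S big_ord_recr /= (le_trans ih)// lerDl.
exists n0 => // n /= nn0.
have tail k : \sum_(i < k) td (t (n + i)%N) * ts (t (n + i)%N) <= ep / (K * rnorm x + 1).
  have -> : \sum_(i < k) td (t (n + i)%N) * ts (t (n + i)%N) = S (n + k)%N - S n.
    by rewrite /S big_split_ord /= addrAC subrr add0r.
  have h1 : S (n + k)%N <= sup (range S) by apply: ub_le_sup; [case: Sub|exists (n + k)%N].
  have h2 : S n0 <= S n by rewrite -(subnKC nn0) Smono.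
  by move: hn0; lra.
(* The partial sum is itself in the range of [T], so the error is [T] of a single element and only
   its derivative at the points [phi z] has to be estimated. *)
have -> : T x - series (fun k => x' k x *: T (e k)) n = T (x - \sum_(m < n) x' m x *: e m).
  rewrite (linearB T) (linear_sum T) /series /= big_mkord.
  by congr (_ + - _); apply: eq_bigr => m _; rewrite linearZ.
rewrite normed_rnorm lecR.
apply: le_trans (HK _ (rnorm x * (ep / (K * rnorm x + 1))) _ _) _.
- by rewrite mulr_ge0// ltW.
- move=> z dz; set w := phi z; have dw : disk w by exact: self.
  have Az := gauge_ge0 dz.
  have -> : derive1 (iX (x - \sum_(m < n) x' m x *: e m)) w =
      derive1 (iX x) w - \sum_(m < n) tapp (t m) (iX x) * th' (t m) w.
    suff : cderiv (iX (x - \sum_(m < n) x' m x *: e m)) w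
      (derive1 (iX x) w - \sum_(m < n) tapp (t m) (iX x) * th' (t m) w).
      by move=> /cderiv_derivable[_ ->].
    rewrite iXB (_ : _ - _ = fun v => iX x v - \sum_(m < n) tapp (t m) (iX x) * iX (e m) v); last first.
      apply/funext => v; rewrite -[LHS]/(iX x v - iX _ v) iXsum.
      congr (_ - _); apply: eq_bigr => m _; exact: iXZ.
    apply: cderivB; first by exact: (analytic_cderiv (@aX x) dw).
    by apply: cderiv_sum => m; apply: cderivZ; exact: ed.
  have L := climB (tlim _ _ (iXH x) dw) (clim_cst (\sum_(m < n) tapp (t m) (iX x) * th' (t m) w)).
  (* Dividing by a positive gauge isolates the norm of the limit, which is then bounded through
     partial sums at ends of blocks beyond [n]. *)
  have [->|gz] := eqVneq (gauge z) 0; first by rewrite mul0r mulr_ge0// ltW.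
  have gz0 : 0 < gauge z by rewrite lt_neqAle eq_sym gz Az.
  rewrite mulrC -ler_pdivlMr//; apply: (clim_le L); exists n => i ni.
  have nNi : (n <= N i)%N by exact: leq_trans (NN i).
  have [k ->] : exists k, N i = (n + k)%N by exists (N i - n)%N; rewrite subnKC.
  rewrite big_split_ord /= addrAC subrr add0r.
  apply: le_trans (normc_sum _ _ _) _; rewrite ler_pdivlMr// mulr_suml.
  apply: le_trans (ler_wpM2l wx (tail k)); rewrite mulr_sumr.
  apply: ler_sum => m _; have [_ [d0 s0 ha hs]] := tv (n + m)%N.
  rewrite normcM -mulrA (mulrA (rnorm x)); apply: ler_pM; rewrite ?normc_ge0//.
  + by rewrite mulr_ge0 ?normc_ge0.
  + by rewrite mulrC; exact: x'le.
  + by rewrite mulrC; exact: hs.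
rewrite mulrA mulrA ler_pdivrMr ?ltr_wpDl ?mulr_ge0//.
nra.
Qed.

Definition test_function m j k (w : C) : C :=
  (dy R j ^+ m / nu (rad R j)%:C)%:C * (1 - conjc (node R j k) * w)^-1 ^+ m.

Let node_mul j k w : disk w -> normc (conjc (node R j k) * w) < 1.
Proof.
move=> dw; rewrite normcM normcJE; apply: le_lt_trans (_ : normc (node R j k) < 1).
  by rewrite ler_piMr ?normc_ge0// ltW.
exact: node_disk.
Qed.

Lemma test_function_cderiv m j k w : disk w -> cderiv (test_function m j k) w
  ((dy R j ^+ m / nu (rad R j)%:C)%:C * (conjc (node R j k) *
     (m%:R * (1 - conjc (node R j k) * w)^-1 ^+ m.+1))).
Proof.
move=> dw; apply: cderivZ; apply: (@cderiv_scale _ (fun y => (1 - y)^-1 ^+ m)).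
by apply: cderiv_invX; exact: node_mul.
Qed.

Let nu_rad_pos j : 0 < nu (rad R j)%:C := nu_rad_gt0 nuN j.

Let cf_ge0 m j : 0 <= dy R j ^+ m / nu (rad R j)%:C.
Proof. by rewrite divr_ge0 ?exprn_ge0// ltW// dy_gt0. Qed.

Lemma normc_test_function m j k w : normc (test_function m j k w) =
  dy R j ^+ m / (nu (rad R j)%:C * normc (1 - conjc (node R j k) * w) ^+ m).
Proof.
rewrite normcM normc_real ger0_norm// normcX normcV.
by rewrite (exprVn (normc _)) -[LHS]mulrA -(invfM (nu _)).
Qed.

Lemma test_function_in m j k : exists x, iX x = cut (test_function m j k).
Proof.
apply: rich; first by apply: cut_holo => w; exact: test_function_cderiv.
exists (dy R j ^+ m / nu (rad R j)%:C * (dy R j / 4)^-1 ^+ m) => w dw.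
have d4 : 0 < dy R j / 4 by rewrite divr_gt0// dy_gt0.
have h := node_kernel_ge j k dw.
rewrite cutE// normc_test_function invfM mulrA; apply: ler_wpM2l => //.
rewrite -exprVn; apply: lerXn2r; rewrite ?nnegrE ?invr_ge0 ?normc_ge0 ?(ltW d4)//.
by rewrite lef_pV2 ?posrE// (lt_le_trans d4).
Qed.

(** The derivative of a test function is at least of order [1 / (dy j nu_j)] near its node, so
    [gauge z] is at most a multiple of [dy j nu_j] times the norm of the image of the test function.
    These norms are summable because [T] is absolutely summing. *)
Lemma nuclear_gauge be E : normalI nu be -> 0 <= E -> nuclear T ->
  exists b W, [/\ forall j k, 0 <= b j k,
    forall j k z, (k < 2 ^ j)%N -> disk z -> normc (phi z - node R j k) <= E * dy R j ->
      gauge z <= b j k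
    & forall J, \sum_(j < J) \sum_(k < 2 ^ j) b j k / (dy R j * nu (rad R j)%:C) <= W].
Proof.
move=> hI E0 /nuclear_summing[W W0 HW].
have [C1 C10 HC1] := weighted_derivative_le muN.
have [_ _ [ga hII] _] := nuN; have [be0 _] := hI.
have [m mbe m2] : exists2 m, 1 + be < m%:R & 2 <= m%:R :> R.
  exists (Num.bound (1 + be)).+2; last by rewrite ler_nat.
  apply: lt_trans (_ : (Num.bound (1 + be))%:R < _); last by rewrite ltr_nat.
  by apply: archi_boundP; rewrite addr_ge0// ltW.
(* With both exponents equal to [m] the power of [1 - |w|] disappears: the sum of the moduli of all
   test functions is at most [K / nu w], a bound uniform in the coefficients. *)
have [K K0 HK] := forelli_rudin nuN hI hII mbe m2 (lexx _).
have /choice[x0 x0E] (jk : nat * nat) := test_function_in m jk.1 jk.2.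
pose x j k := x0 (j, k).
have xE j k : iX (x j k) = cut (test_function m j k) by exact: x0E.
have S J : \sum_(j < J) \sum_(k < 2 ^ j) rnorm (T (x j k)) <= W * K.
  apply: HW; first exact: ltW.
  move=> a a1; rewrite iXn; apply: wnorm_le => w dw.
  have := HK J w dw; rewrite subrr powRr0 mulr1 => h.
  have nw := normal_gt0 nuN dw.
  rewrite mulrC -ler_pdivlMr//; apply: le_trans h.
  rewrite iXsum; apply: le_trans (normc_sum _ _ _) _; apply: ler_sum => j _.
  rewrite iXsum; apply: le_trans (normc_sum _ _ _) _; apply: ler_sum => k _.
  rewrite iXZ normcM xE cutE// normc_test_function !powR_mulrn ?normc_ge0 ?(ltW (dy_gt0 _ _))//.
  rewrite ler_piMl// divr_ge0 ?exprn_ge0 ?(ltW (dy_gt0 _ _))//.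
  by apply: mulr_ge0; [exact: ltW|rewrite exprn_ge0 ?normc_ge0].
have E1 : 0 < 1 + E by rewrite ltr_pwDl.
exists (fun j k => 4 * C1 * (1 + E) ^+ m.+1 * (dy R j * nu (rad R j)%:C) * rnorm (T (x j k))).
exists (4 * C1 * (1 + E) ^+ m.+1 * (W * K)); split.
- move=> j k; apply: mulr_ge0; last exact: rnorm_ge0.
  apply: mulr_ge0; last by apply: mulr_ge0; apply: ltW => //; exact: dy_gt0.
  by apply: mulr_ge0; [exact: mulr_ge0|rewrite exprn_ge0// ltW].
- move=> j k z k2 dz hz; set d := dy R j in hz *; have d0 : 0 < d := dy_gt0 R j.
  set v := phi z in hz; have dv : disk v by exact: self.
  set q := normc (1 - conjc (node R j k) * v).
  have q0 : 0 < q by apply: lt_le_trans (node_kernel_ge j k dv); rewrite divr_gt0.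
  have qE : q <= (1 + E) * d.
    have r0 := rad_gt0 R j; have r1 := rad_lt1 R j; have rs := rad_sub_le R j.
    rewrite /q (_ : 1 - _ = (1 - conjc (node R j k) * node R j k) - conjc (node R j k) * (v - node R j k)); last by ring.
    apply: le_trans (normcB _ _) _; rewrite mulrDl mul1r; apply: lerD; last first.
      rewrite normcM normcJE normc_node; apply: le_trans hz.
      by rewrite ler_piMl ?normc_ge0// ltW.
    have -> : conjc (node R j k) * node R j k = (rad R j ^+ 2)%:C.
      rewrite -(normc_node R j k) -normcJE; case: (node R j k) => a b.
      rewrite /= sqr_sqrtr ?addr_ge0 ?sqr_ge0//.
      by apply/eqP; rewrite eq_complex /= sqrrN; apply/andP; split; apply/eqP; ring.
    have -> : 1 - (rad R j ^+ 2)%:C = (1 - rad R j ^+ 2)%:C by rewrite rmorphB.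
    rewrite normc_real ger0_norm; first by rewrite -/d in rs; nra.
    by nra.
  have D : derive1 (iX (x j k)) v = (d ^+ m / nu (rad R j)%:C)%:C * (conjc (node R j k) *
     (m%:R * (1 - conjc (node R j k) * v)^-1 ^+ m.+1)).
    have h := cut_cderiv dv (test_function_cderiv m j k dv).
    by rewrite xE; have [_ ->] := cderiv_derivable h.
  (* Uses [rad j >= 1/2], [m >= 1] and [q <= (1 + E) * d]. *)
  have nD : (2 * (1 + E) ^+ m.+1 * (d * nu (rad R j)%:C))^-1 <= normc (derive1 (iX (x j k)) v).
    have -> : normc (derive1 (iX (x j k)) v) = d ^+ m / nu (rad R j)%:C * (rad R j * (m%:R * q^-1 ^+ m.+1)).
      rewrite D normcM (normc_real (_ / _)) ger0_norm; last exact: cf_ge0.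
      congr (_ * _).
      rewrite normcM normcJE normc_node; congr (_ * _).
      by rewrite normcM normc_nat normcX normcV.
    apply: (@le_trans _ _ (d ^+ m / nu (rad R j)%:C * (1 / 2 * (1 * ((1 + E) * d)^-1 ^+ m.+1)))).
      rewrite le_eqVlt; apply/orP; left; apply/eqP; rewrite (exprVn ((1 + E) * d)) [((1 + E) * d) ^+ m.+1]exprMn (exprS d).
      have p1 : 0 < (1 + E) ^+ m.+1 by rewrite exprn_gt0.
      have p2 : 0 < d ^+ m by rewrite exprn_gt0.
      have p3 := nu_rad_gt0 nuN j.
      move: ((1 + E) ^+ m.+1) (d ^+ m) (nu (rad R j)%:C) p1 p2 p3 => P Dm nj p1 p2 p3.
      by field; rewrite !gt_eqF.
    apply: ler_wpM2l; first exact: cf_ge0.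
    apply: ler_pM => //.
    - by rewrite mul1r exprn_ge0// invr_ge0 mulr_ge0// ltW.
    - exact: rad_ge.
    - apply: ler_pM => //; first by rewrite exprn_ge0// invr_ge0 mulr_ge0// ltW.
        by move: m2; lra.
      have Ed : 0 < (1 + E) * d by exact: mulr_gt0.
      have i1 : ((1 + E) * d)^-1 <= q^-1 by rewrite lef_pV2 ?posrE.
      by apply: lerXn2r; rewrite ?nnegrE// invr_ge0 ltW.
  have h := HC1 _ _ (iYH (T (x j k))) dz; rewrite -iYn in h.
  rewrite operator_derivative// normcM -/v in h.
  have z1 : normc z < 1 by []. have z0 := normc_ge0 z.
  set D1 := normc (derive1 _ v) in nD h.
  have G : gauge z * D1 <= 2 * C1 * rnorm (T (x j k)).
    rewrite -mulrA; apply: le_trans (_ : 2 * ((1 - normc z) * (mu z * (D1 * normc (g z)))) <= _); last first.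
      by rewrite ler_wpM2l.
    have p : 0 <= mu z * (D1 * normc (g z)).
      by apply: mulr_ge0; [rewrite ltW ?(normal_gt0 muN)|rewrite mulr_ge0 ?normc_ge0].
    rewrite /gauge (_ : _ * D1 = (1 - normc z ^+ 2) * (mu z * (D1 * normc (g z)))); last by ring.
    by rewrite mulrA; apply: ler_wpM2r => //; nra.
  have c0 : 0 < 2 * (1 + E) ^+ m.+1 * (d * nu (rad R j)%:C).
    by rewrite !mulr_gt0// exprn_gt0.
  have gz := gauge_ge0 dz.
  have := le_trans (ler_wpM2l gz nD) G; rewrite ler_pdivrMr// => h'.
  apply: le_trans h' _; rewrite le_eqVlt; apply/orP; left; apply/eqP; ring.
- move=> J; apply: le_trans (ler_wpM2l _ (S J)); last first.
    by apply: mulr_ge0; [exact: mulr_ge0|rewrite exprn_ge0// ltW].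
  rewrite mulr_sumr; apply: ler_sum => j _; rewrite mulr_sumr; apply: ler_sum => k _.
  rewrite le_eqVlt; apply/orP; left; apply/eqP; have d0 := dy_gt0 R j; have n0 := nu_rad_gt0 nuN j.
  by field; rewrite !gt_eqF.
Qed.

End GeneralOperator.

(** * Area integrals *)

Section AreaTools.
Variable R : realType.
Local Notation C := (R[i]).

(* The integrands need not be measurable: the integral of a nonnegative function
   is a supremum over the simple functions below it. *)
Lemma nonneg_integral_le (d : measure_display) (T : measurableType d)
    (m : {measure set T -> \bar R}) (f h : T -> \bar R) :
  (forall x, 0 <= f x)%E -> (forall x, f x <= h x)%E ->
  (\int[m]_x f x <= \int[m]_x h x)%E.
Proof.
move=> f0 fh; have h0 x : (0 <= h x)%E by exact: le_trans (f0 x) (fh x).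
rewrite !ge0_integralTE//; apply: le_ereal_sup => _ [s sf <-].
by exists s => // x; apply: le_trans (sf x) (fh x).
Qed.

Definition area : set (R * R) -> \bar R := (lebesgue_measure \x lebesgue_measure)%E.

Definition square (c : C) (s : R) : set (R * R) :=
  [set` `[complex.Re c - s, complex.Re c + s]] `*` [set` `[complex.Im c - s, complex.Im c + s]].

Lemma measurable_square c s : measurable (square c s).
Proof. by apply: measurableX; exact: measurable_itv. Qed.

Lemma area_square c s : 0 < s -> area (square c s) = ((2 * s) ^+ 2)%:E.
Proof.
move=> s0; rewrite /area /square product_measure1E; try exact: measurable_itv.
have h (x : R) : lebesgue_measure [set` `[x - s, x + s]] = (2 * s)%:E.
  rewrite lebesgue_measure_itv /= lte_fin (_ : x - s < x + s); last by lra.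
  by rewrite -EFinD; congr EFin; ring.
by have := congr2 (@mule R) (h (complex.Re c)) (h (complex.Im c)); rewrite -EFinM expr2.
Qed.

Lemma squareP c s (p : R * R) :
  square c s p <-> `|p.1 - complex.Re c| <= s /\ `|p.2 - complex.Im c| <= s.
Proof.
rewrite /square /= !in_itv /= !ler_distl.
by split=> -[? ?]; split.
Qed.

Lemma square_center c s (p : R * R) : square c s p -> normc (p.1 +i* p.2 - c) <= 2 * s.
Proof.
move=> /squareP[h1 h2]; apply: le_trans (normc_le_ReIm _) _.
by case: c h1 h2 => a b /= h1 h2; lra.
Qed.

Lemma square_near c s (p : R * R) : normc (p.1 +i* p.2 - c) <= s -> square c s p.
Proof.
move=> h; apply/squareP; case: c h => a b h /=; split; apply: le_trans h.
  by have := Re_le_normc (p.1 +i* p.2 - (a +i* b)).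
by have := Im_le_normc (p.1 +i* p.2 - (a +i* b)).
Qed.

Lemma integral_steps (d : measure_display) (T : measurableType d)
    (m : {measure set T -> \bar R}) N (v : nat -> R) (Q : nat -> set T) :
  (forall n, 0 <= v n) -> (forall n, measurable (Q n)) ->
  (\int[m]_p (\sum_(n < N) (v n * \1_(Q n) p)%:E) = \sum_(n < N) (v n)%:E * m (Q n))%E.
Proof.
move=> v0 mQ; rewrite (ge0_integral_sum _ _ (f := fun (n : 'I_N) p => (v n * \1_(Q n) p)%:E)) //.
- apply: eq_bigr => n _; under eq_integral do rewrite EFinM.
  rewrite ge0_integralZl_EFin//; first by rewrite integral_indic// setIT.
  by apply/measurable_EFinP; exact: measurable_indic.
- move=> n; apply/measurable_EFinP; apply: measurable_funM; first exact: measurable_cst.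
  exact: measurable_indic.
- by move=> n p _; rewrite lee_fin mulr_ge0.
Qed.

Lemma integral_step_series (d : measure_display) (T : measurableType d)
    (m : {measure set T -> \bar R}) (v : nat -> \bar R) (Q : nat -> set T) :
  (forall n, 0 <= v n)%E -> (forall n, measurable (Q n)) ->
  (\int[m]_p (\sum_(0 <= n <oo) v n * (\1_(Q n) p)%:E) = \sum_(0 <= n <oo) v n * m (Q n))%E.
Proof.
move=> v0 mQ; have mi n : measurable_fun setT (fun p => (\1_(Q n) p)%:E : \bar R).
  by apply/measurable_EFinP; exact: measurable_indic.
rewrite integral_nneseries//.
- apply: eq_eseriesr => n _; rewrite ge0_integralZl//.
  by rewrite integral_indic// setIT.
- by move=> n; apply: emeasurable_funM => //; exact: measurable_cst.
- by move=> n p _; rewrite mule_ge0// lee_fin.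
Qed.

End AreaTools.

Section Enumeration.
Variable R : realType.
Local Notation C := (R[i]).

(** A positive [n] is [2 ^ level n + rank n], which lists each node once; [n = 0] repeats the node
    (0, 0). Hence the extra term in [sum_enumeration], the factor 2 in [sum_enumeration_le], and
    shifts to [n.+1] where disjointness matters. *)
Definition level n := trunc_log 2 n.
Definition rank n := (n - 2 ^ level n)%N.

Lemma rank_lt n : (rank n < 2 ^ level n)%N.
Proof.
have h : (n < 2 ^ (level n).+1)%N by exact: trunc_log_ltn.
rewrite expnS mul2n -addnn in h; rewrite /rank; case: (leqP (2 ^ level n) n) => [le|/ltnW/eqP->].
  by rewrite ltn_subLR ?expn_gt0.
by rewrite expn_gt0.
Qed.

Lemma levelE j k : (k < 2 ^ j)%N -> level (2 ^ j + k) = j.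
Proof.
move=> kj; apply: trunc_log_eq => //.
by rewrite leq_addr expnS mul2n -addnn ltn_add2l.
Qed.

Lemma rankE j k : (k < 2 ^ j)%N -> rank (2 ^ j + k) = k.
Proof. by move=> kj; rewrite /rank levelE// addKn. Qed.

Lemma sum_enumeration J (u : nat -> nat -> R) :
  \sum_(n < 2 ^ J) u (level n) (rank n) = u 0%N 0%N + \sum_(j < J) \sum_(k < 2 ^ j) u j k.
Proof.
elim: J => [|J ih]; first by rewrite big_ord0 addr0 expn0 big_ord1 /rank /level trunc_log0.
rewrite big_ord_recr /= addrA -ih expnS mul2n -addnn big_split_ord /=; congr (_ + _).
by apply: eq_bigr => k _; rewrite levelE ?rankE.
Qed.

Lemma sum_enumeration_le (u : nat -> nat -> R) W : (forall j k, 0 <= u j k) ->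
  (forall J, \sum_(j < J) \sum_(k < 2 ^ j) u j k <= W) ->
  forall N, \sum_(n < N) u (level n) (rank n) <= 2 * W.
Proof.
move=> u0 uW N; apply: (@le_trans _ _ (\sum_(n < 2 ^ N) u (level n) (rank n))).
  have /subnKC <- : (N <= 2 ^ N)%N by exact: ltnW (ltn_expl _ _).
  by rewrite big_split_ord /= lerDl sumr_ge0.
rewrite sum_enumeration (_ : 2 * W = W + W); last by ring.
apply: lerD => //; apply: le_trans (uW 1%N).
by rewrite big_ord1 expn0 big_ord1.
Qed.

Lemma nneseries_ge_term (u : nat -> \bar R) n : (forall n, 0 <= u n)%E ->
  (u n <= \sum_(0 <= k <oo) u k)%E.
Proof.
move=> u0; apply: le_trans (_ : (\sum_(0 <= k < n.+1) u k <= _)%E); last first.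
  by apply: nneseries_lim_ge.
by rewrite big_nat_recr//= leeDr// sume_ge0.
Qed.

End Enumeration.

Section Geometry.
Variable R : realType.
Local Notation C := (R[i]).

Lemma normc_kernelC (a w : C) : normc (1 - conjc a * w) = normc (1 - conjc w * a).
Proof.
by rewrite -normcJE conjcB conjc1E conjcM conjcK mulrC.
Qed.

(** Moving [b] by [E * (1 - |b|)] changes the denominator by at most [E] times itself, because
    [1 - |b|] is a lower bound of [|1 - conjc b * w|]. *)
Lemma kernel_le (a b w : C) (E : R) : 0 <= E -> normc (a - b) <= E * (1 - normc b) ->
  normc w <= 1 -> normc b <= 1 ->
  normc (1 - conjc a * w) <= (1 + E) * normc (1 - conjc b * w).
Proof.
move=> E0 ab w1 b1; have w0 := normc_ge0 w; have b0 := normc_ge0 b.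
rewrite (_ : 1 - conjc a * w = (1 - conjc b * w) - conjc (a - b) * w); last first.
  by rewrite conjcB; ring.
apply: le_trans (normcB _ _) _; rewrite mulrDl mul1r; apply: lerD => //.
have h : 1 - normc b <= normc (1 - conjc b * w).
  apply: le_trans (normc_sub1_ge _); rewrite normcM normcJE lerD2l lerN2.
  by rewrite ler_piMr.
apply: le_trans (ler_wpM2l E0 h); apply: le_trans ab.
by rewrite normcM normcJE ler_piMr ?normc_ge0.
Qed.

Lemma kernel_gt0 (a w : C) : disk a -> disk w -> 0 < normc (1 - conjc a * w).
Proof.
move=> da dw; apply: lt_le_trans (normc_sub1_ge _).
by rewrite subr_gt0; apply: normcM_lt1; rewrite ?normcJE; [exact: da|exact: ltW].
Qed.

(** [j.+1] is the least level with [dy j.+1 < 1 - |w|], and [k] truncates the argument of [w],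
    measured in turns, to a multiple of [dy j]. *)
Lemma node_cover (w : C) : disk w -> exists j k, [/\ (k < 2 ^ j)%N, dy R j / 2 <= 1 - normc w,
  1 - normc w <= dy R j & normc (w - node R j k) <= (1 + 4 * pi) * dy R j].
Proof.
move=> dw; have w1 : normc w < 1 by []. have w0 := normc_ge0 w.
have ex : exists j, dy R j < 1 - normc w.
  have [N HN] := @expr2_unbounded R ((1 - normc w)^-1 + 1).
  exists N; rewrite /dy invf_plt ?posrE ?exprn_gt0 ?subr_gt0//.
  by apply: lt_le_trans (HN N (leqnn N)); rewrite ltrDl.
case: (ex_minnP ex) => -[|j] hj jmin; first by move: hj; rewrite /dy expr0 invr1; lra.
have up : 1 - normc w <= dy R j.
  by rewrite leNgt; apply/negP => /jmin; rewrite ltnn.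
rewrite dyS in hj; have d0 := dy_gt0 R j.
have [t /andP[t0 t1] wt] := polar w.
have p20 : 0 < 2 ^+ j :> R by exact: exprn_gt0.
have tj : 0 <= t * 2 ^+ j by rewrite mulr_ge0// ltW.
have /andP[k1 k2] := Num.Theory.truncn_itv tj; set k := Num.truncn _ in k1 k2.
exists j, k; split => //; first last.
- rewrite {1}wt (_ : _ - _ = ((normc w)%:C - (rad R j)%:C) * cis t + (rad R j)%:C * (cis t - root2 R j k)); last first.
    by rewrite /node; ring.
  apply: le_trans (normcD _ _) _; rewrite [X in _ <= X](_ : _ = dy R j + 4 * pi * dy R j); last by ring.
  apply: lerD.
    rewrite normcM normc_cis mulr1 -rmorphB normc_real.
    have := rad_sub_le R j; have := rad_lt1 R j; rewrite ler_norml.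
    by move=> ? ?; apply/andP; split; lra.
  rewrite normcM normc_radC; apply: le_trans (_ : 1 * (4 * pi * `|t - k%:R / 2 ^+ j|) <= _).
    by apply: ler_pM; rewrite ?normc_ge0 ?(ltW (rad_gt0 _ _)) ?(ltW (rad_lt1 _ _))//; exact: cis_lipschitz.
  rewrite mul1r; apply: ler_wpM2l; first by rewrite mulr_ge0// pi_ge0.
  rewrite ger0_norm; last by rewrite subr_ge0 ler_pdivrMr.
  have : t <= (k%:R + 1) / 2 ^+ j by rewrite ler_pdivlMr// natr1 ltW.
  by rewrite mulrDl mul1r /dy; lra.
- exact: ltW.
- by rewrite -(ltr_nat R) natrX; apply: le_lt_trans k1 _; rewrite gtr_pMl.
Qed.

(** The exponent may be negative, hence the two-sided comparison and the absolute value. *)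
Lemma powR_comparable (c x y al : R) : 1 <= c -> 0 < x -> x / c <= y -> y <= c * x ->
  y `^ al <= c `^ `|al| * x `^ al.
Proof.
move=> c1 x0 xy yx; have c0 : 0 < c by exact: lt_le_trans ltr01 c1.
have y0 : 0 < y by apply: lt_le_trans xy; rewrite divr_gt0.
have [al0|al0] := leP 0 al.
  by rewrite ger0_norm// -powRM ?(ltW c0) ?(ltW x0)//; apply: powR_le_base => //; exact: ltW.
have xcy : x <= c * y by rewrite mulrC -ler_pdivrMr.
have [g g0 ->] : exists2 g, 0 <= g & al = - g.
  by exists (- al); rewrite ?opprK// oppr_ge0 ltW.
rewrite normrN ger0_norm// !powRN ler_pdivlMr ?powR_gt0//.
rewrite mulrC ler_pdivrMr ?powR_gt0// -powRM ?(ltW c0) ?(ltW y0)//.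
by apply: powR_le_base => //; exact: ltW.
Qed.

End Geometry.

(** * From bounds at the nodes to the finiteness of N_alpha *)

Section AreaCondition.
Variable R : realType.
Local Notation C := (R[i]).
Variables (nu mu : C -> R) (g phi : C -> C) (be al : R).
Hypotheses (nuN : normal nu) (muN : normal mu) (hI : normalI nu be) (al1 : -1 < al) (beal : be < al + 1).
Hypothesis self : forall z, disk z -> disk (phi z).

Let nu_rad_pos j : 0 < nu (rad R j)%:C := nu_rad_gt0 nuN j.

Lemma kernel_two_nodes (E : R) (z w a b : C) : 0 <= E -> disk z -> disk w -> disk a -> disk b ->
  normc (a - z) <= E * (1 - normc z) -> normc (b - w) <= E * (1 - normc w) ->
  normc (1 - conjc a * b) <= (1 + E) ^+ 2 * normc (1 - conjc z * w).
Proof.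
move=> E0 dz dw da db az bw; rewrite expr2 -mulrA.
apply: le_trans (kernel_le E0 az (ltW db) (ltW dz)) _.
rewrite ler_wpM2l ?addr_ge0// normc_kernelC (normc_kernelC z).
by apply: le_trans (kernel_le E0 bw (ltW dz) (ltW dw)) _.
Qed.

Let weight (z : C) : R := (1 - normc z ^+ 2) `^ al / nu z.

(** The supremum over [z] is dominated by a sum over the nodes [m] near which [phi z] may lie, and
    the integral by a sum over squares covering the disk. In the resulting double series the sum
    over squares comes first: for fixed [m] it is a Forelli-Rudin sum at the node [m]. *)
Lemma Nalpha_finite (b : nat -> nat -> R) (W : R) : (forall j k, 0 <= b j k) ->
  (forall j k z, (k < 2 ^ j)%N -> disk z -> normc (phi z - node R j k) <= (1 + 4 * pi) * dy R j ->
      gauge mu g z <= b j k) ->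
  (forall J, \sum_(j < J) \sum_(k < 2 ^ j) b j k / (dy R j * nu (rad R j)%:C) <= W) ->
  (Nalpha nu mu al g phi < +oo)%E.
Proof.
move=> b0 hb bW.
pose E : R := 1 + 4 * pi; have E0 : 0 < E by rewrite ltr_pwDl// mulr_ge0// pi_ge0.
pose p : R := al + 3; have p2 : 2 <= p by move: al1; rewrite /p; lra.
have p0 : 0 <= p by lra.
pose nd n := node R (level n) (rank n); pose d n := dy R (level n); pose nn n := nu (rad R (level n))%:C.
have nd_disk n : disk (nd n) by exact: node_disk.
have d0 n : 0 < d n := dy_gt0 R _. have nn0 n : 0 < nn n := nu_rad_gt0 nuN _.
pose c1 : R := (1 + 2 * E) ^+ 2.
have c10 : 0 < c1 by rewrite exprn_gt0// addr_gt0// mulr_gt0.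
pose c2 : R := 2 `^ `|al| * c1 `^ p.
have c20 : 0 < c2 by rewrite mulr_gt0// powR_gt0.
pose B m := b (level m) (rank m).
(* Bound of the integrand on the square [n] for the points [z] with [phi z] near the node [m]; [c1]
   and [c2] pay for moving both arguments of the kernel, and the density, to the nodes. *)
pose u n m : R := c2 * (d n `^ al / nn n) * (B m / normc (1 - conjc (nd n) * nd m) `^ p).
have u0 n m : 0 <= u n m.
  apply: mulr_ge0; last by apply: divr_ge0; [exact: b0|exact: powR_ge0].
  apply: mulr_ge0; first exact: ltW.
  by apply: divr_ge0; [exact: powR_ge0|exact: ltW].
pose v n : \bar R := (\sum_(0 <= m <oo) (u n m)%:E)%E.
have v0 n : (0 <= v n)%E by apply: nneseries_ge0 => m _ _; rewrite lee_fin.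
pose Q n := square (nd n) (E * d n).
have val_le z w n m : disk z -> disk w -> d n / 2 <= 1 - normc z -> 1 - normc z <= d n ->
    normc (z - nd n) <= E * d n -> d m / 2 <= 1 - normc (phi w) ->
    normc (phi w - nd m) <= E * d m ->
    gauge mu g w / normc (1 - conjc z * phi w) `^ p * weight z <= u n m.
  move=> dz dw z1 z2 zn w1 wm.
  have near x y i : d i / 2 <= 1 - normc x -> normc (x - y) <= E * d i ->
      normc (y - x) <= 2 * E * (1 - normc x).
    by move=> h1 h2; rewrite normc_distC; apply: le_trans h2 _; nra.
  have E20 : 0 <= 2 * E by rewrite mulr_ge0// ltW.
  have dphi := self dw.
  have K := kernel_two_nodes E20 dz dphi (nd_disk n) (nd_disk m) (near _ _ _ z1 zn) (near _ _ _ w1 wm).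
  rewrite -/c1 in K.
  have k1 := kernel_gt0 dz dphi; have k2 := kernel_gt0 (nd_disk n) (nd_disk m).
  have gB : gauge mu g w <= B m by apply: hb => //; exact: rank_lt.
  have g0 := gauge_ge0 g muN dw.
  have i1 : (normc (1 - conjc z * phi w) `^ p)^-1 <= c1 `^ p / normc (1 - conjc (nd n) * nd m) `^ p.
    rewrite ler_pdivlMr ?powR_gt0// mulrC ler_pdivrMr ?powR_gt0//.
    rewrite -powRM ?normc_ge0 ?(ltW c10)//.
    by apply: powR_le_base => //; exact: normc_ge0.
  have i2 : weight z <= 2 `^ `|al| * (d n `^ al / nn n).
    rewrite /weight mulrA; have nz := normal_gt0 nuN dz.
    have z0 := normc_ge0 z; have z11 : normc z < 1 by [].
    apply: ler_pM; rewrite ?powR_ge0 ?invr_ge0 ?(ltW nz)//.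
      by apply: powR_comparable => //; have := d0 n; nra.
    rewrite lef_pV2 ?posrE//; have /normal_decreasing := nuN; apply => //.
    - exact: rad_disk.
    - rewrite normc_radC; have := rad_sub_le R (level n); rewrite -/(d n); lra.
  rewrite (_ : u n m = B m * (c1 `^ p / normc (1 - conjc (nd n) * nd m) `^ p) * (2 `^ `|al| * (d n `^ al / nn n))); last first.
    by rewrite /u /c2; ring.
  apply: ler_pM => //.
  - by rewrite divr_ge0// powR_ge0.
  - by rewrite divr_ge0 ?powR_ge0// ltW// normal_gt0.
  - by apply: ler_pM => //; rewrite invr_ge0 powR_ge0.
have bound z : disk z -> exists n, Q n (complex.Re z, complex.Im z) /\
    (ereal_sup [set ((1 - normc w ^+ 2) * mu w * normc (g w) /
       normc (1 - z^* * phi w) `^ (al + 3))%:E | w in @disk R] * (weight z)%:E <= v n)%E.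
  move=> dz; have [j [k [kj z1 z2 zn]]] := node_cover dz.
  exists (2 ^ j + k)%N; rewrite /Q /nd /d levelE// rankE//; split.
    by apply: square_near => /=; case: (z) zn.
  have wz : 0 < weight z.
    rewrite divr_gt0 ?normal_gt0// powR_gt0// subr_gt0 expr_lt1// normc_ge0.
    by [].
  rewrite -lee_pdivlMr//; apply: ge_ereal_sup => _ [w dw <-].
  rewrite lee_pdivlMr// -EFinM.
  have [i [l [li w1 w2 wn]]] := node_cover (self dw).
  apply: le_trans (nneseries_ge_term (2 ^ i + l) _); last by move=> m; rewrite lee_fin.
  rewrite lee_fin; apply: val_le => //; rewrite /d /nd ?levelE ?rankE//.
have Phi0 z : disk z -> (0 <= ereal_sup [set ((1 - normc w ^+ 2) * mu w * normc (g w) /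
       normc (1 - z^* * phi w) `^ (al + 3))%:E | w in @disk R] * (weight z)%:E)%E.
  move=> dz; apply: mule_ge0; last first.
    by rewrite lee_fin; apply: divr_ge0; [exact: powR_ge0|apply/ltW/normal_gt0].
  apply: le_trans (ereal_sup_ubound _); last by exists 0; first exact: disk0.
  rewrite lee_fin; apply: divr_ge0; last exact: powR_ge0.
  exact: (gauge_ge0 g muN (disk0 R)).
have [_ _ [ga hII] _] := nuN.
have al2 : 1 + be < al + 2 by move: beal; lra.
have alp : al + 2 <= p by rewrite /p lerD2l ler_nat.
have [K K0 HK] := forelli_rudin nuN hI hII al2 p2 alp.
pose A n : R := (2 * (E * d n)) ^+ 2.
pose c3 : R := 2 * (4 * K) * (c2 * (4 * E ^+ 2)).
have c2E : 0 <= c2 * (4 * E ^+ 2).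
  by apply: mulr_ge0; [exact: ltW|apply: mulr_ge0 => //; apply: exprn_ge0; exact: ltW].
have c30 : 0 <= c3.
  by apply: mulr_ge0 => //; apply: mulr_ge0 => //; apply: mulr_ge0 => //; exact: ltW.
have c2B m : 0 <= c2 * (4 * E ^+ 2) * B m by apply: mulr_ge0 => //; exact: b0.
(* Exponents [a = al + 2] and [p = al + 3] leave the single power [1 / (1 - rad)], of order
   [1 / d m]; this yields exactly the terms bounded by [W]. *)
have col m N : \sum_(n < N) u n m * A n <= c3 * (B m / (d m * nn m)).
  have := sum_enumeration_le (u := fun j k => dy R j `^ (al + 2) /
    (nu (rad R j)%:C * normc (1 - conjc (node R j k) * nd m) `^ p)) _ (fun J => HK J _ (nd_disk m)) N.
  have r0 : 0 < 1 - rad R (level m) by rewrite subr_gt0 rad_lt1.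
  rewrite (_ : p - (al + 2) = 1); last by rewrite /p; ring.
  rewrite normc_node normal_nodeE// powRr1 ?(ltW r0)// => h.
  have {}h := h _; apply: (@le_trans _ _ (c2 * (4 * E ^+ 2) * B m * (2 * (K / (nn m * (1 - rad R (level m))))))).
    apply: le_trans (ler_wpM2l (c2B m) (h _)); last first.
      by move=> j k; apply: divr_ge0; [exact: powR_ge0|apply: mulr_ge0; [exact: ltW|exact: powR_ge0]].
    rewrite mulr_sumr; apply: ler_sum => n _.
    have e1 : d n `^ (al + 2) = d n `^ al * d n ^+ 2.
      by rewrite powRD ?powR_mulrn ?(ltW (d0 n))// (gt_eqF (d0 n)) implybT.
    rewrite -/(d n) e1 -/(nn n) /u /A le_eqVlt; apply/orP; left; apply/eqP.
    have kp : 0 < normc (1 - conjc (nd n) * nd m) `^ p by rewrite powR_gt0// kernel_gt0.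
    by have := nn0 n; rewrite -/(nd n) => ?; field; rewrite !gt_eqF.
  have rs := rad_sub_ge R (level m); rewrite -/(d m) in rs.
  rewrite /c3 (_ : _ * (B m / _) = c2 * (4 * E ^+ 2) * B m * (2 * (K * (4 / (d m * nn m))))); last first.
    by have := nn0 m; have := d0 m => ? ?; field; rewrite !gt_eqF.
  apply: ler_wpM2l; first exact: c2B.
  apply: ler_wpM2l => //; apply: ler_wpM2l; first exact: ltW.
  have := nn0 m; have := d0 m => dm nm.
  rewrite ler_pdivlMr ?mulr_gt0// mulrC ler_pdivrMr ?mulr_gt0//.
  by rewrite mulrC mulrCA ler_pM2l//; lra.
rewrite /Nalpha /area_integral.
have pV : (0 <= (pi^-1)%:E :> \bar R)%E by rewrite lee_fin invr_ge0 pi_ge0.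
apply: (@le_lt_trans _ _ ((pi^-1)%:E * (\sum_(0 <= n <oo) v n * area (Q n)))%E).
  apply: lee_wpmul2l => //; rewrite integral_mkcond.
  rewrite -integral_step_series//; last by move=> n; exact: measurable_square.
  apply: nonneg_integral_le => x; rewrite patchE; case: ifPn => //.
  - by move=> /set_mem /= dx; exact: Phi0.
  - move=> /set_mem /= dx; have [n [Qn le]] := bound _ dx.
    apply: le_trans le _; apply: le_trans (nneseries_ge_term n _); last first.
      by move=> i; rewrite mule_ge0// lee_fin.
    have Qx : x \in Q n by apply/mem_set; case: (x) Qn.
    by rewrite indicE Qx mule1.
  - by move=> _; apply: nneseries_ge0 => i _ _; rewrite mule_ge0// lee_fin.
have -> : (\sum_(0 <= n <oo) v n * area (Q n))%E = (\sum_(0 <= n <oo) \sum_(0 <= m <oo) (u n m * A n)%:E)%E.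
  apply: eq_eseriesr => n _; rewrite area_square; last by rewrite mulr_gt0.
  rewrite muleC -nneseriesZl; last by move=> m _; rewrite lee_fin.
  by apply: eq_eseriesr => m _; rewrite -EFinM mulrC.
have A0 n : 0 <= A n.
  by apply: exprn_ge0; apply: mulr_ge0 => //; apply: mulr_ge0; exact: ltW.
rewrite nneseries_interchange; last by move=> n m; rewrite lee_fin mulr_ge0.
apply: (@le_lt_trans _ _ (pi^-1 * (c3 * (2 * W)))%:E); last exact: ltry.
rewrite EFinM; apply: lee_wpmul2l => //.
apply: (@le_trans _ _ (\sum_(0 <= m <oo) (c3 * (B m / (d m * nn m)))%:E)%E).
  apply: lee_nneseries => [m _ _|m _]; first by apply: nneseries_ge0 => n _ _; rewrite lee_fin mulr_ge0.
  by apply: nneseries_le => [n|N]; [rewrite mulr_ge0|exact: col].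
have D0 j k : 0 <= b j k / (dy R j * nu (rad R j)%:C).
  by rewrite divr_ge0// mulr_ge0// ltW ?dy_gt0.
apply: nneseries_le => [m|N]; first by apply: mulr_ge0 => //; exact: D0.
rewrite -mulr_sumr; apply: ler_wpM2l => //.
exact: (sum_enumeration_le (u := fun j k => b j k / (dy R j * nu (rad R j)%:C)) D0 bW).
Qed.

End AreaCondition.

Section DisjointSets.

Lemma disjoint_steps_le (R : realType) (d : measure_display) (T : measurableType d)
    (m : {measure set T -> \bar R}) (F : T -> \bar R) N (v : nat -> R) (Q : nat -> set T) :
  (forall x, 0 <= F x)%E -> (forall n, 0 <= v n) -> (forall n, measurable (Q n)) ->
  (forall i j x, Q i x -> Q j x -> i = j) ->
  (forall n x, Q n x -> (v n)%:E <= F x)%E ->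
  (\sum_(n < N) (v n)%:E * m (Q n) <= \int[m]_x F x)%E.
Proof.
move=> F0 v0 mQ dQ vF; rewrite -integral_steps//; apply: nonneg_integral_le => x.
  by apply: sume_ge0 => n _; rewrite lee_fin mulr_ge0.
have [[n Qn]|no] := pselect (exists n : 'I_N, Q n x); last first.
  rewrite big1 => [//|n _]; rewrite indicE memNset ?mulr0// => Qn.
  by apply: no; exists n.
rewrite (bigD1 n) //= big1 ?adde0 => [|i ni].
  by rewrite indicE mem_set// mulr1; exact: vF.
rewrite indicE memNset ?mulr0// => Qi.
by move/eqP: ni; apply; apply: val_inj; exact: dQ Qi Qn.
Qed.

End DisjointSets.

Section NodeSquares.
Variable R : realType.
Local Notation C := (R[i]).

(** Half-side [dy / 128] puts two centers whose squares meet within [dy / 32] of each other, below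
    the radial gap [dy / 16] between circles and the distance [dy] between nodes of one circle. *)
Definition node_square n : set (R * R) :=
  square (node R (level n) (rank n)) (dy R (level n) / 128).

Lemma node_square_near n (p : R * R) : node_square n p ->
  normc (p.1 +i* p.2 - node R (level n) (rank n)) <= dy R (level n) / 64.
Proof. by move=> /square_center h; apply: le_trans h _; lra. Qed.

Lemma node_square_modulus n (p : R * R) : node_square n p ->
  dy R (level n) / 8 <= 1 - normc (p.1 +i* p.2) <= dy R (level n).
Proof.
move=> /node_square_near h; set z := _ +i* _ in h *.
have := rad_sub_ge R (level n); have := rad_sub_le R (level n).
have h1 := normcD (node R (level n) (rank n)) (z - node R (level n) (rank n)).
have h2 := normcB z (z - node R (level n) (rank n)).
rewrite addrC subrK normc_node in h1; rewrite subKr normc_node in h2.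
by have d0 := dy_gt0 R (level n); move=> ? ?; apply/andP; split; lra.
Qed.

Lemma node_separated j k l : (l < k < 2 ^ j)%N ->
  dy R j <= normc (node R j k - node R j l).
Proof.
move=> /andP[lk kj].
have kl : (0 < k - l < 2 ^ j)%N by rewrite subn_gt0 lk (leq_ltn_trans (leq_subr _ _)).
have := root2_separated R kl.
have -> : node R j k - node R j l = (rad R j)%:C * (root2 R j l * (root2 R j (k - l) - 1)).
  rewrite /node -mulrBr; congr (_ * _); rewrite mulrBr mulr1; congr (_ - _).
  rewrite /root2 -cisD; congr cis; rewrite -mulrDl -natrD subnKC//.
  exact: ltnW.
rewrite normcM normc_radC normcM normc_root2 mul1r => h.
have r0 := rad_ge R j; apply: le_trans (ler_wpM2l (ltW (rad_gt0 R j)) h).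
rewrite mulrA /dy -[leLHS]mul1r; apply: ler_wpM2r; first by rewrite invr_ge0 exprn_ge0.
by rewrite -ler_pdivrMr//.
Qed.

Lemma node_square_disjoint n m (p : R * R) : (0 < n)%N -> (0 < m)%N ->
  node_square n p -> node_square m p -> n = m.
Proof.
wlog lnm : n m / (level n <= level m)%N.
  move=> H n0 m0 pn pm; have [nm|/ltnW mn] := leqP (level n) (level m); first exact: H.
  by apply/esym; exact: H.
move=> n0 m0 /node_square_near pn /node_square_near pm.
set z := _ +i* _ in pn pm.
have dist : normc (node R (level n) (rank n) - node R (level m) (rank m)) <= dy R (level n) / 32.
  apply: le_trans (normc_dist_tri z _ _) _; rewrite normc_distC.
  by have := dy_le R lnm; lra.
have decomp i : (0 < i)%N -> i = (2 ^ level i + rank i)%N.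
  by move=> i0; rewrite /rank subnKC// trunc_logP.
move: lnm; rewrite leq_eqVlt => /orP[/eqP e|lt].
  rewrite (decomp n)// (decomp m)// e; congr (_ + _)%N.
  rewrite e in dist; have d0 := dy_gt0 R (level m).
  have rn := rank_lt n; have rm := rank_lt m; rewrite e in rn; clear e.
  case: (ltngtP (rank n) (rank m)) => // h.
    have hm : (rank n < rank m < 2 ^ level m)%N by rewrite h rm.
    by exfalso; have := node_separated hm; rewrite normc_distC; lra.
  have hn : (rank m < rank n < 2 ^ level m)%N by rewrite h rn.
  by exfalso; have := node_separated hn; lra.
exfalso; have := rad_gap R lt; have := normcB (node R (level m) (rank m)) (node R (level m) (rank m) - node R (level n) (rank n)).
have h3 := normcD (node R (level n) (rank n)) (node R (level m) (rank m) - node R (level n) (rank n)).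
rewrite addrC subrK !normc_node in h3; rewrite normc_distC in dist.
by have := dy_gt0 R (level n); lra.
Qed.

Lemma area_node_square n : area (node_square n) = ((dy R (level n) / 64) ^+ 2)%:E.
Proof.
rewrite area_square; last by rewrite divr_gt0// dy_gt0.
by congr ((_ ^+ 2)%:E); field.
Qed.

End NodeSquares.

(** * From the finiteness of N_alpha to bounds at the nodes *)

Section AreaLowerBound.
Variable R : realType.
Local Notation C := (R[i]).
Variables (nu mu : C -> R) (g phi : C -> C) (be al : R).
Hypotheses (nuN : normal nu) (muN : normal mu) (hI : normalI nu be) (al1 : -1 < al).
Hypothesis self : forall z, disk z -> disk (phi z).

Let nu_rad_pos j : 0 < nu (rad R j)%:C := nu_rad_gt0 nuN j.

Let weight (z : C) : R := (1 - normc z ^+ 2) `^ al / nu z.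

Let ratio a w : R := gauge mu g w / normc (1 - conjc a * phi w) `^ (al + 3).

Let nd n := node R (level n) (rank n).
Let d n := dy R (level n).
Let nn n := nu (rad R (level n))%:C.

(** Kernel and density vary by bounded factors on the square. Where a point is closer to 0 than the
    node, [nu] may be larger there and condition (I) limits by how much; otherwise monotonicity is
    enough. *)
Lemma node_square_lower : exists2 c, 0 < c & forall n (p : R * R) w, node_square n p -> disk w ->
  c * (d n `^ al / nn n) * ratio (nd n) w <= ratio (p.1 +i* p.2) w * weight (p.1 +i* p.2).
Proof.
have [c0 c00 H] := normalI_ratio nuN hI; have [be0 _] := hI.
(* [c1] compares the values of [nu], [c2] the kernels (factor 2 to the power [al + 3]), and [c3] the
   powers of [1 - |z|^2] and [dy] (ratio at most 8). *)
pose c1 : R := 1 + c0 * 4 `^ be.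
have c10 : 0 < c1 by rewrite ltr_pwDl// mulr_ge0 ?powR_ge0// ltW.
pose q : R := al + 3; have q0 : 0 <= q by move: al1; rewrite /q; lra.
pose c2 : R := 2 `^ q; pose c3 : R := 8 `^ `|al|.
have c20 : 0 < c2 by rewrite powR_gt0.
have c30 : 0 < c3 by rewrite powR_gt0.
exists (c2 * (c3 * c1))^-1; first by rewrite invr_gt0 !mulr_gt0.
move=> n p w np dw; have /andP[m1 m2] := node_square_modulus np.
have near := node_square_near np; set z : C := _ +i* _ in m1 m2 near *.
have d0 : 0 < d n := dy_gt0 R _; have n0 : 0 < nn n := nu_rad_gt0 nuN _.
have dz : disk z by rewrite -[disk _]/(is_true (normc _ < 1)) -subr_gt0 (lt_le_trans _ m1)// divr_gt0// dy_gt0.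
have dnd : disk (nd n) by exact: node_disk.
have dphi := self dw.
have z0 := normc_ge0 z; have z1 : normc z < 1 by [].
have k1 := kernel_gt0 dz dphi; have k2 := kernel_gt0 dnd dphi.
have K : normc (1 - conjc z * phi w) <= 2 * normc (1 - conjc (nd n) * phi w).
  have h : normc (z - nd n) <= 1 * (1 - normc (nd n)).
    by rewrite mul1r normc_node; have := rad_sub_ge R (level n); have := d0; move: near; rewrite /d /nd; lra.
  have := kernel_le ler01 h (ltW dphi) (ltW dnd).
  by rewrite (_ : 1 + 1 = 2).
have g0 := gauge_ge0 g muN dw.
have r1 : c2^-1 * ratio (nd n) w <= ratio z w.
  rewrite /ratio -/q mulrCA; apply: ler_wpM2l => //.
  rewrite -invfM lef_pV2 ?posrE ?mulr_gt0 ?powR_gt0//.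
  rewrite -powRM ?normc_ge0//; apply: powR_le_base => //; exact: normc_ge0.
have nz := normal_gt0 nuN dz.
have w1 : (c3 * c1)^-1 * (d n `^ al / nn n) <= weight z.
  rewrite invfM mulrACA /weight; apply: ler_pM.
  - by rewrite mulr_ge0 ?powR_ge0// invr_ge0 ltW.
  - by rewrite mulr_ge0// invr_ge0 ltW.
  - rewrite mulrC ler_pdivrMr// mulrC.
    rewrite -/(d n) in m1 m2; apply: (@powR_comparable R 8); first by rewrite ler1n.
    + by nra.
    + by nra.
    + by nra.
  - rewrite -invfM lef_pV2 ?posrE ?mulr_gt0// /c1 mulrDl mul1r.
    have rd : disk ((rad R (level n))%:C : C) := rad_disk R _.
    have [zr|/ltW rz] := leP (normc z) (rad R (level n)); last first.
      apply: (@le_trans _ _ (nn n)); last by rewrite lerDl !mulr_ge0 ?powR_ge0// ltW.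
      by apply: (normal_decreasing nuN) => //; rewrite normc_radC.
    apply: (@le_trans _ _ (c0 * 4 `^ be * nn n)); last by rewrite lerDr ltW.
    have := H z (rad R (level n))%:C dz rd; rewrite normc_radC => /(_ zr) h.
    have r0 : 0 < 1 - rad R (level n) by rewrite subr_gt0 rad_lt1.
    have pr : 0 < (1 - rad R (level n)) `^ be by rewrite powR_gt0.
    rewrite -(ler_pM2r pr); apply: le_trans h _.
    rewrite -/(nn n) -!mulrA; apply: ler_wpM2l; first exact: ltW.
    rewrite mulrCA; apply: ler_wpM2l; first exact: ltW.
    rewrite -powRM ?(ltW r0)//; apply: powR_le_base; first exact: ltW.
      by rewrite subr_ge0 ltW.
    by have := rad_sub_ge R (level n); rewrite -/(d n) in m2 *; lra.
rewrite invfM (_ : _ * ratio (nd n) w = (c2^-1 * ratio (nd n) w) * ((c3 * c1)^-1 * (d n `^ al / nn n))); last by ring.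
apply: ler_pM => //.
- apply: mulr_ge0; first by rewrite invr_ge0 ltW.
  by apply: divr_ge0 => //; exact: powR_ge0.
- apply: mulr_ge0; first by rewrite invr_ge0 mulr_ge0 ?ltW.
  by apply: divr_ge0; [exact: powR_ge0|exact: ltW].
Qed.

(** [b j k] is the supremum of the integrand with [zeta] at the node, so the first bound is its
    definition. On each of the disjoint squares the integrand dominates a multiple of [b], and the
    integral dominates the sum. *)
Lemma Nalpha_nodes : (Nalpha nu mu al g phi < +oo)%E -> exists b W,
    (forall j k z, (k < 2 ^ j)%N -> disk z ->
      gauge mu g z <= b j k * normc (1 - conjc (node R j k) * phi z) `^ (al + 3)) /\
    (forall J, \sum_(j < J) layer_mass nu al b j <= W).
Proof.
have [c c0 low] := node_square_lower.
rewrite /Nalpha /area_integral integral_mkcond.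
set F := (_ \_ _)%E; set I := (\int[_]_ _ F _)%E.
have F0 x : (0 <= F x)%E.
  rewrite /F patchE; case: ifPn => // /set_mem /= dx; apply: mule_ge0; last first.
    by rewrite lee_fin; apply: divr_ge0; [exact: powR_ge0|apply/ltW/normal_gt0].
  apply: le_trans (ereal_sup_ubound _); last by exists 0; first exact: disk0.
  rewrite lee_fin; apply: divr_ge0; last exact: powR_ge0.
  exact: (gauge_ge0 g muN (disk0 R)).
have I0 : (0 <= I)%E by apply: integral_ge0 => x _; exact: F0.
move=> hN; have Ifin : (I < +oo)%E.
  move: hN; case: I I0 => [r _ _| |]//; first exact: ltry.
  by rewrite gt0_muley// lte_fin invr_gt0 pi_gt0.
have IE : I = (fine I)%:E by rewrite fineK// ge0_fin_numE.
have ratio_ge0 a w : disk w -> 0 <= ratio a w.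
  by move=> dw; apply: divr_ge0; [exact: gauge_ge0|exact: powR_ge0].
have d0 n : 0 < d n := dy_gt0 R _. have n0 n : 0 < nn n := nu_rad_gt0 nuN _.
have cf0 n : 0 < c * (d n `^ al / nn n) by rewrite mulr_gt0// divr_gt0// powR_gt0.
have Flow n (p : R * R) w : node_square n p -> disk w ->
    ((c * (d n `^ al / nn n) * ratio (nd n) w)%:E <= F p)%E.
  move=> np dw; have dp : disk (p.1 +i* p.2).
    rewrite -[disk _]/(is_true (normc _ < 1)) -subr_gt0.
    by have /andP[h _] := node_square_modulus np; apply: lt_le_trans h; rewrite divr_gt0// dy_gt0.
  rewrite /F patchE mem_set//; apply: le_trans (_ : (ratio (p.1 +i* p.2) w * weight (p.1 +i* p.2))%:E <= _)%E.
    by rewrite lee_fin; exact: low.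
  rewrite EFinM; apply: lee_wpmul2r.
    by rewrite lee_fin; apply: divr_ge0; [exact: powR_ge0|apply/ltW/normal_gt0].
  by apply: ereal_sup_ubound; exists w.
(* The shift drops the index 0, whose square would coincide with that of index 1. *)
pose Q n : set (R * R) := node_square n.+1.
have steps N (v : nat -> R) : (forall n, 0 <= v n) ->
    (forall n p, Q n p -> (v n)%:E <= F p)%E ->
    \sum_(n < N) v n * (d n.+1 / 64) ^+ 2 <= fine I.
  move=> v0 vF; rewrite -lee_fin -IE.
  have := @disjoint_steps_le R _ _ (lebesgue_measure \x lebesgue_measure)%E F N v Q F0 v0 _ _ vF.
  rewrite -sumEFin => h; apply: le_trans (h _ _).
  - by apply: lee_sum => n _; rewrite EFinM -area_node_square.
  - by move=> n; exact: measurable_square.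
  - by move=> i j x qi qj; apply: succn_inj; exact: (node_square_disjoint _ _ qi qj).
pose V n := [set ratio (nd n) w | w in @disk R].
(* Finiteness of each supremum also comes from the integral: a step function supported on one square
   bounds every single ratio. *)
have Vsup n : has_sup (V n.+1).
  split; first by exists (ratio (nd n.+1) 0), 0 => //; exact: disk0.
  pose a := c * (d n.+1 `^ al / nn n.+1) * (d n.+1 / 64) ^+ 2.
  have a0 : 0 < a by rewrite mulr_gt0// exprn_gt0// divr_gt0.
  exists (fine I / a) => _ [w dw <-]; rewrite ler_pdivlMr//.
  pose v i := if i == n then c * (d n.+1 `^ al / nn n.+1) * ratio (nd n.+1) w else 0.
  have v0 i : 0 <= v i.
    rewrite /v; case: ifP => // _; apply: mulr_ge0; last exact: ratio_ge0.
    exact: ltW.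
  have vn : v n = c * (d n.+1 `^ al / nn n.+1) * ratio (nd n.+1) w by rewrite /v eqxx.
  have := steps n.+1 v v0; rewrite big_ord_recr /= vn => h.
  apply: le_trans (h _); last first.
    by move=> i p; rewrite /v; case: eqP => [-> qp|_ _]; [exact: Flow|exact: F0].
  rewrite ler_wpDl//; first by apply: sumr_ge0 => i _; rewrite mulr_ge0// sqr_ge0.
  by rewrite le_eqVlt /a; apply/orP; left; apply/eqP; ring.
pose b j k := sup [set ratio (node R j k) w | w in @disk R].
have bE n : sup (V n.+1) = b (level n.+1) (rank n.+1) by [].
have bub j k w : (k < 2 ^ j)%N -> disk w -> ratio (node R j k) w <= b j k.
  move=> kj dw; have : (0 < 2 ^ j + k)%N by rewrite addn_gt0 expn_gt0.
  case E : (2 ^ j + k)%N => [//|n] _.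
  have [h1 h2] : level n.+1 = j /\ rank n.+1 = k by rewrite -E levelE// rankE.
  rewrite -h1 -h2 -bE; apply: ub_le_sup; first by case: (Vsup n).
  by exists w.
have b0 n : 0 <= b (level n.+1) (rank n.+1).
  by apply: le_trans (ratio_ge0 _ _ (disk0 R)) (bub _ _ 0 (rank_lt _) (disk0 R)).
have total N : \sum_(n < N) d n.+1 `^ (al + 2) / nn n.+1 * b (level n.+1) (rank n.+1) <=
    64 ^+ 2 / c * fine I.
  have vF n p : Q n p -> ((c * (d n.+1 `^ al / nn n.+1) * b (level n.+1) (rank n.+1))%:E <= F p)%E.
    move=> qp; have := Flow _ p _ qp; have := F0 p; case: (F p) => [r _ h|_ _|//]; last exact: leey.
    rewrite lee_fin mulrC -ler_pdivlMr//; apply: ge_sup; first by case: (Vsup n).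
    by move=> _ [w dw <-]; rewrite ler_pdivlMr// mulrC -lee_fin; exact: h.
  have := steps N _ (fun n => mulr_ge0 (ltW (cf0 n.+1)) (b0 n)) vF => h.
  have cc : 0 <= 64 ^+ 2 / c by rewrite divr_ge0 ?exprn_ge0// ltW.
  apply: le_trans (ler_wpM2l cc h); rewrite mulr_sumr; apply: ler_sum => n _.
  have e1 : d n.+1 `^ (al + 2) = d n.+1 `^ al * d n.+1 ^+ 2.
    by rewrite powRD ?powR_mulrn ?(ltW (d0 _))// (gt_eqF (d0 _)) implybT.
  rewrite e1 le_eqVlt; apply/orP; left; apply/eqP.
  by have := n0 n.+1 => ?; field; rewrite !gt_eqF.
exists b, (64 ^+ 2 / c * fine I); split.
- move=> j k z kj dz; have := bub j k z kj dz; rewrite ler_pdivrMr//.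
  by rewrite powR_gt0// kernel_gt0//; [exact: node_disk|exact: self].
- move=> J; apply: le_trans (total (2 ^ J).-1).
  have := sum_enumeration J (fun j k => dy R j `^ (al + 2) / nu (rad R j)%:C * b j k).
  have -> : (2 ^ J)%N = (2 ^ J).-1.+1 by rewrite prednK// expn_gt0.
  rewrite big_ord_recl /= /rank /level trunc_log0 sub0n => /addrI h.
  rewrite /layer_mass; under eq_bigr do rewrite mulr_sumr.
  by rewrite -h.
Qed.

End AreaLowerBound.

(** * The criterion *)

Section NuclearCriterion.
Variable R : realType.
Local Notation C := (R[i]).
Variables (nu mu : C -> R) (g phi : C -> C) (be al : R).
Hypotheses (nuN : normal nu) (muN : normal mu).
Hypotheses (hI : normalI nu be) (al1 : -1 < al) (beal : be < al + 1).
Hypotheses (ag : analytic g) (aphi : analytic phi) (self : forall z, disk z -> disk (phi z)).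
Variables (X Y : normedModType C) (iX : X -> C -> C) (iY : Y -> C -> C).
Hypotheses (iXD : forall a x y, iX (a *: x + y) = a *: iX x + iX y)
  (iXH : forall x, Hinf_set nu (iX x)) (iYH : forall y, Hinf_set mu (iY y))
  (iXn : forall x, rnorm x = wnorm nu (iX x)) (iYn : forall y, rnorm y = wnorm mu (iY y))
  (rich : forall h, holo h -> (exists K : R, forall w, disk w -> normc (h w) <= K) ->
     exists x, iX x = h).
Variable T : {linear X -> Y}.
Hypothesis hT : forall x z, disk z -> iY (T x) z = Sop g phi (iX x) z.

Lemma nuclear_iff : nuclear T <-> (Nalpha nu mu al g phi < +oo)%E.
Proof.
have pi0 : 0 <= pi :> R := pi_ge0 R.
split => [nT|].
  have E0 : 0 <= 1 + 4 * pi :> R by rewrite addr_ge0// mulr_ge0.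
  have [b [W [b0 hb bW]]] := nuclear_gauge nuN muN ag aphi self iXD iXH iYH iXn iYn rich hT hI E0 nT.
  exact: (Nalpha_finite nuN muN hI al1 beal self b0 hb bW).
move=> /(Nalpha_nodes nuN muN hI al1 self)[b [W [hb bW]]].
(* [M0] makes the remainder of the reproducing formula vanish, [Mbe] the layers summable, and [Mal]
   the kernels controlled by the bounds at the nodes. *)
have [M [M0 Mbe Mal]] : exists M, [/\ (0 < M)%N, be + 1 <= M%:R & al + 1 <= M%:R].
  pose M1 := (Num.bound (be + 1)); pose M2 := Num.bound (al + 1); exists (M1 + M2).+1.
  have [be0 _] := hI.
  have h1 : be + 1 < M1%:R by apply: archi_boundP; rewrite addr_ge0// ltW.
  have h2 : al + 1 < M2%:R by apply: archi_boundP; move: al1; lra.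
  split => //.
    by apply: le_trans (ltW h1) _; rewrite ler_nat ltnW// ltnS leq_addr.
  by apply: le_trans (ltW h2) _; rewrite ler_nat ltnW// ltnS leq_addl.
have [Lam [Lam' [c c0 [hLam reprod]]]] := reproducing R M0.
have A0 z : disk z -> 0 <= gauge mu g z by move=> dz; exact: gauge_ge0.
(* A new root lies within [4 * pi * dy j] of its old neighbour, which lies within [4 * pi * dy j] of
   its lattice node. *)
have E0 : 0 <= 8 * pi :> R by rewrite mulr_ge0.
have [K1 K10 HK1] := Hinf_diff_le nuN hI.
have [K2 K20 HK2] := hz_estimates c0 hLam self A0 hb Mal E0.
have [t [N [W' [tv ts tN tlim]]]] := expansion_blocks nuN hI c0 hLam Mbe self A0 hb
  K10 K20 HK1 HK2 erefl reprod bW.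
exact: (expansion_nuclear muN ag aphi self iXD iXH iXn iYn rich hT tv ts tN tlim).
Qed.

End NuclearCriterion.

Section Embeddings.
Variable R : realType.
Local Notation C := (R[i]).
Variable nu : normalWeight R.

Lemma weighted_bounded (h : C -> C) K z : (forall w, disk w -> normc (h w) <= K) -> disk z ->
  nu z * normc (h z) <= nu 0 * K.
Proof.
move=> hK dz; have nuN := weight_normal nu.
apply: ler_pM; rewrite ?normc_ge0 ?hK//; first exact/ltW/normal_gt0.
apply: (normal_decreasing nuN) => //; first exact: disk0.
by rewrite normc0 normc_ge0.
Qed.

Lemma Hinf_rich (h : C -> C) : holo h -> (exists K : R, forall w, disk w -> normc (h w) <= K) ->
  exists x : Hinf nu, Hinf_fun x = h.
Proof.
move=> hh [K hK]; have hm : h \in Hinf_pred nu.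
  by apply/mem_set; split => //; exists (nu 0 * K) => _ [z dz <-]; exact: weighted_bounded.
by exists (MkHinf hm).
Qed.

(** Condition (II) compared with the origin gives [nu z <= c * nu 0 * (1 - |z|)^ga], so the weight
    itself tends to 0 at the boundary and bounded functions are in the small space. *)
Lemma H0_rich (h : C -> C) : holo h -> (exists K : R, forall w, disk w -> normc (h w) <= K) ->
  exists x : H0 nu, H0_fun x = h.
Proof.
move=> hh [K hK]; suff hm : h \in H0_pred nu by exists (MkH0 hm).
apply/mem_set; split => // e e0; have nuN := weight_normal nu.
have [_ _ [ga hII] _] := nuN; have [ga0 _] := hII.
have [c c0 H] := normalII_ratio nuN hII.
have K0 : 0 <= K by apply: le_trans (hK 0 (disk0 R)); exact: normc_ge0.
have nu0 := normal_gt0 nuN (disk0 R).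
have B0 : 0 < c * nu 0 * K + 1 by rewrite ltr_wpDl// mulr_ge0// mulr_ge0// ltW.
pose t := (e / (c * nu 0 * K + 1)) `^ ga^-1.
have t0 : 0 < t by rewrite powR_gt0// divr_gt0.
near=> r => z zr.
have r1 : r < 1 by near: r; exact: nbhs_left_lt.
have rt : 1 - t < r by near: r; apply: nbhs_left_gt; rewrite gtrBl.
have dz : disk z by rewrite -[disk _]/(is_true (normc _ < 1)) zr.
have h1 := H 0 z (disk0 R) dz; rewrite normc0 subr0 powR1 mulr1 zr in h1.
have {}h1 := h1 (le_trans (normc_ge0 z) _); rewrite zr lexx in h1; have {}h1 := h1 isT.
have p0 : 0 <= (1 - r) `^ ga by exact: powR_ge0.
have pt : (1 - r) `^ ga < e / (c * nu 0 * K + 1).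
  have -> : e / (c * nu 0 * K + 1) = t `^ ga.
    by rewrite -powRrM mulVf ?gt_eqF// powRr1// divr_ge0 ?ltW.
  by apply: gt0_ltr_powR => //; rewrite ?nnegrE ?subr_ge0 ?(ltW r1) ?(ltW t0)//; lra.
apply: (@le_lt_trans _ _ (c * nu 0 * (1 - r) `^ ga * K)).
  by apply: ler_pM; rewrite ?normc_ge0 ?hK//; exact/ltW/normal_gt0.
rewrite ltr_pdivlMr// in pt; apply: le_lt_trans pt.
rewrite mulrDr mulr1 (_ : c * nu 0 * _ * K = (1 - r) `^ ga * (c * nu 0 * K)); last by ring.
by rewrite lerDl.
Unshelve. all: by end_near. Qed.

End Embeddings.

Theorem theorem7 (R : realType) (nu mu : normalWeight R)
    (alpha : R) (halpha : -1 < alpha)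
    (omega : R[i] -> R) (hpair : normal_pair nu omega alpha)
    (g : R[i] -> R[i]) (hg : analytic g)
    (phi : R[i] -> R[i]) (hphi : analytic phi)
    (hself : forall z, disk z -> disk (phi z))
    (S : {linear Hinf nu -> Hinf mu})
    (hS : forall f z, disk z -> S f z = Sop g phi f z)
    (hbd : bounded_operator S) :
  (nuclear S <-> (Nalpha nu mu alpha g phi < +oo)%E) /\
  (forall S0 : {linear H0 nu -> H0 mu},
    (forall f z, disk z -> S0 f z = Sop g phi f z) ->
    (nuclear S0 <-> nuclear S)).
Proof.
have [nuN [_ _ _ _ [_ [be hI be1]]]] := hpair.
have muN := weight_normal mu.
have beal : be < alpha + 1 by rewrite -ltrBlDr.
have critS : nuclear S <-> (Nalpha nu mu alpha g phi < +oo)%E.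
  exact: (@nuclear_iff R nu mu g phi be alpha nuN muN hI halpha beal hg hphi hself
    (Hinf nu) (Hinf mu) (@Hinf_fun R nu) (@Hinf_fun R mu) (fun _ _ _ => erefl)
    (@HinfP R nu) (@HinfP R mu) (fun=> erefl) (fun=> erefl) (@Hinf_rich R nu) S hS).
split => // S0 hS0; apply: iff_trans (iff_sym critS).
exact: (@nuclear_iff R nu mu g phi be alpha nuN muN hI halpha beal hg hphi hself
  (H0 nu) (H0 mu) (@H0_fun R nu) (@H0_fun R mu) (fun _ _ _ => erefl)
  (@H0P R nu) (@H0P R mu) (fun=> erefl) (fun=> erefl) (@H0_rich R nu) S0 hS0).
Qed.
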